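(* Let $d\ge 1$ and $a,\lambda\in\Lambda=(0,\infty)^d$. If $F:\mathbb{R}^d\to\mathbb{R}$ is an integrable function that satisfies (i) $F(x)\ge G_\lambda(x)$ for each $x\in\mathbb{R}^d$, and (ii) $\hat F(\xi)=0$ for each $\xi\notin Q(a)$, then $$\int_{\mathbb{R}^d}F(x)\,dx\ \ge\ \prod_{j=1}^d\lambda_j^{-1/2}\,\Theta(0;ia_j^2/\lambda_j).$$ Moreover, equality holds if $F=M_{\lambda,a}$.
   Context: Notation: $\Lambda=(0,\infty)^d$. For $\lambda\in\Lambda$, $G_\lambda(x)=\prod_{j=1}^d e^{-\lambda_j\pi x_j^2}$ for $x\in\mathbb{R}^d$. For $a\in\Lambda$, $Q(a)=\prod_{j=1}^d[-a_j,a_j]$. The Fourier transform is $\hat F(\xi)=\int_{\mathbb{R}^d}e^{-2\pi i x\cdot\xi}F(x)\,dx$. Jacobi's theta function is $\Theta(v;\tau)=\sum_{n\in\mathbb{Z}}e^{2\pi i nv}e^{\pi i\tau n^2}$ for $\operatorname{Im}\tau>0$. For $\delta>0$ let $g_\delta(t)=e^{-\delta\pi t^2}$ and let $m_\delta$ be the entire function $$m_\delta(z)=\Big(\frac{\sin\pi z}{\pi}\Big)^2\Big\{\sum_{k\in\mathbb{Z}}\frac{g_\delta(k)}{(z-k)^2}+\sum_{k\in\mathbb{Z}}\frac{g_\delta'(k)}{z-k}\Big\}$$ (with removable singularities at the integers filled in). For $\lambda\in\Lambda$ put $M_\lambda(z)=\prod_{j=1}^d m_{\lambda_j}(z_j)$,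 and for $a,\lambda\in\Lambda$ put $M_{\lambda,a}(z)=M_{\lambda/a^2}(az)$, where operations on vectors are coordinatewise: $\lambda/a^2=(\lambda_1/a_1^2,\dots,\lambda_d/a_d^2)$ and $az=(a_1z_1,\dots,a_dz_d)$. *)

(* Defs.v *)
From HB Require Import structures.
From mathcomp Require Import all_boot all_order all_algebra complex.
From mathcomp Require Import all_classical all_reals all_analysis.

Set Implicit Arguments.
Unset Strict Implicit.
Unset Printing Implicit Defensive.

Import Order.TTheory GRing.Theory Num.Theory.
Import numFieldNormedType.Exports.

Local Open Scope classical_set_scope.
Local Open Scope ring_scope.
Local Open Scope complex_scope.

(* Points of R^d; the sigma-algebra inferred on tuples is the product (Borel)
   one. *)
Notation rvec R d := (d.-tuple (measurableTypeR R)).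

Section LebesgueMeasureOnRd.
Variable R : realType.

Definition cons_vec d (p : measurableTypeR R * rvec R d) : rvec R d.+1 :=
  [tuple of p.1 :: p.2].

Fixpoint borel_lebesgue d : set (rvec R d) -> \bar R :=
  match d with
  | 0 => \d_[tuple]
  | d'.+1 => pushforward (lebesgue_measure \x @borel_lebesgue d')%E
               (@cons_vec d')
  end.

Let measurable_cons_vec d : measurable_fun setT (@cons_vec d).
Proof.
exact: (measurable_cons measurable_fst measurable_snd).
Qed.

Let split_vec d (x : rvec R d.+1) : measurableTypeR R * rvec R d :=
  (thead x, [tuple of behead x]).

Let measurable_split_vec d : measurable_fun setT (@split_vec d).
Proof.
apply/measurable_fun_pair; first exact: measurable_tnth.
apply/measurable_fun_tnthP => i.
rewrite (_ : _ \o _ = fun x : rvec R d.+1 => tnth x (lift ord0 i)).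
  exact: measurable_tnth.
by apply/funext => x /=; rewrite [in RHS](tuple_eta x) tnthS.
Qed.

Let borel_lebesgue_spec d :
  {m : {sigma_finite_measure set (rvec R d) -> \bar R} |
    @borel_lebesgue d = m}.
Proof.
elim: d => [|d [m IHm]].
  by exists (\d_([tuple] : rvec R 0) : {sigma_finite_measure set _ -> \bar R}).
rewrite /= IHm.
pose l : {sigma_finite_measure set (measurableTypeR R) -> \bar R} :=
  lebesgue_measure.
pose mu : {measure set (measurableTypeR R * rvec R d)%type -> \bar R} :=
  (l \x m)%E.
pose nu0 := pushforward mu (@cons_vec d).
have nu0T : sigma_finite setT nu0.
  have /sigma_finiteP[F [TF ndF Foo]] := sigma_finiteT l.
  have /sigma_finiteP[G [TG ndG Goo]] := sigma_finiteT m.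
  exists (fun k => @split_vec d @^-1` (F k `*` G k)).
    rewrite -preimage_bigcup (_ : \bigcup_k _ = setT) ?preimage_setT//.
    rewrite -subTset => -[x y] _.
    have [n _ Fnx] : (\bigcup_k F k) x by rewrite -TF.
    have [k _ Gky] : (\bigcup_k G k) y by rewrite -TG.
    exists (maxn n k) => //; split => /=.
    - by move: x Fnx; exact/subsetPset/ndF/leq_maxl.
    - by move: y Gky; exact/subsetPset/ndG/leq_maxr.
  move=> k; have [mFk Fk] := Foo k; have [mGk Gk] := Goo k; split.
    rewrite -[X in measurable X]setTI; apply: measurable_split_vec => //.
    exact: measurableX.
  rewrite /nu0 /pushforward -comp_preimage.
  rewrite (_ : @split_vec d \o @cons_vec d = id) ?preimage_id; last first.
    by apply/funext => -[x y]/=; congr pair; exact/val_inj.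
  by rewrite [ltLHS]product_measure1E// lte_mul_pinfty// ge0_fin_numE.
pose nu1 : {measure set (rvec R d.+1) -> \bar R} :=
  measure_function_pushforward__canonical__measure_function_Measure mu (@measurable_cons_vec d).
pose sf := Measure_isSigmaFinite.Build _ _ _ nu1 nu0T.
pose nu : {sigma_finite_measure set (rvec R d.+1) -> \bar R} := HB.pack nu0 nu1 sf.
by exists (nu (@measurable_cons_vec d)).
Qed.

Let borel_lebesgue0 d : @borel_lebesgue d set0 = 0%E.
Proof. by have [m ->] := borel_lebesgue_spec d; rewrite measure0. Qed.

Let borel_lebesgue_ge0 d A : (0 <= @borel_lebesgue d A)%E.
Proof. by have [m ->] := borel_lebesgue_spec d. Qed.

Let borel_lebesgue_semi_sigma_additive d :
  semi_sigma_additive (@borel_lebesgue d).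
Proof.
have [m ->] := borel_lebesgue_spec d; exact: measure_semi_sigma_additive.
Qed.

HB.instance Definition _ d := isMeasure.Build _ _ _ (@borel_lebesgue d)
  (borel_lebesgue0 d) (@borel_lebesgue_ge0 d)
  (@borel_lebesgue_semi_sigma_additive d).

Let borel_lebesgue_sigma_finite d : sigma_finite setT (@borel_lebesgue d).
Proof. have [m ->] := borel_lebesgue_spec d; exact: sigma_finiteT. Qed.

HB.instance Definition _ d := Measure_isSigmaFinite.Build _ _ _
  (@borel_lebesgue d) (borel_lebesgue_sigma_finite d).

Lemma borel_lebesgue_box d (A : 'I_d -> set (measurableTypeR R)) :
  (forall j, measurable (A j)) ->
  @borel_lebesgue d [set x | forall j, A j (tnth x j)] =
  (\prod_(j < d) lebesgue_measure (A j))%E.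
Proof.
elim: d A => [|d IHd] A mA.
  rewrite big_ord0 /= (_ : [set _ | _] = setT) ?diracT//.
  by apply/seteqP; split => // x _ [].
rewrite big_ord_recl /= /pushforward -IHd//.
rewrite (_ : _ @^-1` _ =
    A ord0 `*` [set x | forall j, A (lift ord0 j) (tnth x j)]).
  rewrite product_measure1E//.
  rewrite (_ : [set _ | _] = \bigcap_(j in [set: 'I_d])
      (@tnth d (measurableTypeR R) ^~ j @^-1` A (lift ord0 j))).
    apply: fin_bigcap_measurable => // j _.
    by rewrite -[X in measurable X]setTI; exact: measurable_tnth.
  by apply/seteqP; split => x /= Ax j //=; exact: Ax.
apply/seteqP; split => [[y x]/= Ax|[y x]/= [Ay Ax] j].
- split; first by have := Ax ord0; rewrite tnth0.
  by move=> j; have := Ax (lift ord0 j); rewrite tnthS.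
- by case: (unliftP ord0 j) => [i ->|->]; rewrite ?tnthS ?tnth0.
Qed.

(* The Borel measure above is completed, so that measurability and
   integrability on R^d are taken in the sense of Lebesgue. *)
Definition lebesgue d : set (caratheodory_type (@borel_lebesgue d)^*%mu) -> \bar R :=
  @completed_measure_extension _ _ R (@borel_lebesgue d).

HB.instance Definition _ d := Measure.on (@lebesgue d).

Let lebesgue_sigma_finite d : sigma_finite setT (@lebesgue d).
Proof. exact/completed_measure_extension_sigma_finite/sigma_finiteT. Qed.

HB.instance Definition _ d := Measure_isSigmaFinite.Build _ _ _
  (@lebesgue d) (lebesgue_sigma_finite d).

End LebesgueMeasureOnRd.
Arguments lebesgue : clear implicits.

Section ComplexAnalysis.
Variable R : realType.
Implicit Types z v tau : R[i].

Definition cexp z : R[i] :=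
  (expR (complex.Re z))%:C * (cos (complex.Im z) +i* sin (complex.Im z)).

Definition csin z : R[i] := (cexp ('i%C * z) - cexp (- ('i%C * z))) / (2 * 'i%C).

(* R[i]^o carries the usual topology of the complex plane, that of the norm;
   a bilateral series is the sum of its two unilateral halves. *)
Definition zsum (f : int -> R[i]) : R[i] :=
  limn (series (fun n : nat => f n%:Z : R[i]^o)) +
  limn (series (fun n : nat => f (- n.+1%:Z) : R[i]^o)).

Definition Theta v tau : R[i] :=
  zsum (fun n : int => cexp (2 * pi%:C * 'i%C * n%:~R * v) *
                cexp (pi%:C * 'i%C * tau * n%:~R ^+ 2)).

Definition gauss1 (delta t : R) : R := expR (- delta * pi * t ^+ 2).

Definition m_formula (delta : R) z : R[i] :=
  (csin (pi%:C * z) / pi%:C) ^+ 2 *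
  (zsum (fun k : int => (gauss1 delta k%:~R)%:C / (z - k%:~R) ^+ 2) +
   zsum (fun k : int => (derive1 (gauss1 delta) k%:~R)%:C / (z - k%:~R))).

(* The formula is meaningless at the integers, which are removable
   singularities. *)
Definition m_delta (delta : R) z : R[i] :=
  if `[< exists k : int, z = k%:~R >]
  then lim ((m_formula delta w : R[i]^o) @[w --> (z : R[i]^o)^'])
  else m_formula delta z.

Definition M_prod d (lambda : d.-tuple R) (z : d.-tuple R[i]) : R[i] :=
  \prod_(j < d) m_delta (tnth lambda j) (tnth z j).

Definition M_scaled d (lambda a : d.-tuple R) (z : d.-tuple R[i]) : R[i] :=
  M_prod [tuple tnth lambda j / tnth a j ^+ 2 | j < d]
         [tuple (tnth a j)%:C * tnth z j | j < d].

End ComplexAnalysis.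

Section FourierOnRd.
Variables (R : realType) (d : nat).
Implicit Types (a lambda x xi : d.-tuple R) (F : d.-tuple R -> R).

Definition Lambda : set (d.-tuple R) := [set lambda | forall j, 0 < tnth lambda j].

Definition gaussian lambda x : R :=
  \prod_(j < d) expR (- tnth lambda j * pi * tnth x j ^+ 2).

Definition Qbox a : set (d.-tuple R) :=
  [set xi | forall j, - tnth a j <= tnth xi j <= tnth a j].

Definition dotp x xi : R := \sum_(j < d) tnth x j * tnth xi j.

Definition cintegral (f : d.-tuple R -> R[i]) : R[i] :=
  (\int[lebesgue R d]_x complex.Re (f x)) +i* (\int[lebesgue R d]_x complex.Im (f x)).

Definition fourier F xi : R[i] :=
  cintegral (fun x => cexp (- (2 * pi%:C * 'i%C * (dotp x xi)%:C)) * (F x)%:C).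

End FourierOnRd.

(* Main.v *)
(* Lower bound.  For [b_j > a_j], integrate [F - G_lambda >= 0] against
   [|sum_p exp (2 pi i sum_j p_j b_j x_j)|^2], [p] running over [{0,..,N-1}^d].
   The off-diagonal terms of the integral against [F] are values of its Fourier
   transform outside [Q(a)], hence vanish, and the diagonal contributes
   [N^d * int F]; the integral against [G_lambda] is a product of one-dimensional
   Fejer sums of Gaussians.  Let [b] tend to [a] and then [N] to infinity: the
   Cesaro means converge to theta series.  No Poisson summation is needed.

   Extremal function.  On the real line, [m_delta] is the cosine transform of an
   explicit function [phi delta] supported in [0, 1], so it is bandlimited with
   integral [theta delta].  That it majorizes the Gaussian amounts to
   [exp (pi delta x^2) * sum_k (g(k) / (x-k)^2 + g'(k) / (x-k)) >=
   sum_k 1 / (x-k)^2]: equality holds at [delta = 0], and the derivative of the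
   left side in [delta], taken under Fejer means, is nonnegative because
   [sqrt delta * sum_k exp (- pi delta k^2)] increases with [delta].

   Equality.  For [d = 1] and [a = 1], the lower bound applied to the extremal
   function gives [theta delta >= delta^(-1/2) * theta (1 / delta)]; together
   with the same inequality at [1 / delta] this is Jacobi's inversion formula,
   which identifies the two sides in every dimension. *)

Require Import Defs.
From HB Require Import structures.
From mathcomp Require Import all_boot all_order all_algebra complex.
From mathcomp Require Import all_classical all_reals all_analysis.
From mathcomp Require Import measurable_realfun.
From mathcomp Require Import ring lra zify.

Set Implicit Arguments.
Unset Strict Implicit.
Unset Printing Implicit Defensive.

Import Order.TTheory GRing.Theory Num.Theory.
Import numFieldNormedType.Exports.

Local Open Scope classical_set_scope.
Local Open Scope ring_scope.
Local Open Scope complex_scope.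

(** * Gaussian integrals *)

(** Hypothesis (ii) gives no information on the boundary of the closed box, hence the strict
    [b_j > a_j]; for fixed [N] the Gaussian side is a finite sum continuous in [b], so [b] may tend
    to [a] before [N] grows.

    The monotonicity in [delta] is positivity in disguise: [sqrt delta * exp (- pi delta k^2)] is
    the Fourier transform at [k] of [exp (- pi y^2 / delta)], which increases with [delta] at every
    [y], and a Fejer sum over [k] integrates it against a nonnegative kernel. After multiplication
    by [exp (pi delta x^2)] the [k]-th summand has a [delta]-derivative without poles: a positive
    factor times [g(k) (1 - 2 pi delta k^2)], plus a term odd in [k], which the symmetric sum kills.
    All differentiation is done on finite sums.

    Integrability of the majorant is not visible from [phi]. Its nonnegativity, supplied by the
    majorization, lets a Gaussian damping be removed by monotone convergence, which gives
    integrability and the value of the integral at once. *)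

Section GaussianIntegral.
Variable R : realType.
Notation mu := (@lebesgue_measure R).
Implicit Types (e x y xi al : R).

Lemma gauss1_gt0 e x : 0 < gauss1 e x. Proof. exact: expR_gt0. Qed.

Lemma gauss1_ge0 e x : 0 <= gauss1 e x. Proof. exact: expR_ge0. Qed.

Lemma gauss1N e x : gauss1 e (- x) = gauss1 e x.
Proof. by rewrite /gauss1 sqrrN. Qed.

Lemma gauss1_le1 e x : 0 <= e -> gauss1 e x <= 1.
Proof.
move=> e0; rewrite -expR0 ler_expR -!mulrA mulNr oppr_le0.
by rewrite mulr_ge0// mulr_ge0 ?pi_ge0 ?sqr_ge0.
Qed.

Lemma is_derive_gauss1 e x :
  is_derive x 1 (gauss1 e) (- (2 * pi * e * x) * gauss1 e x).
Proof.
rewrite /gauss1; apply: trigger_derive; rewrite /GRing.scale/=; ring.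
Qed.

Lemma continuous_gauss1 e : continuous (gauss1 e).
Proof.
move=> x; apply/differentiable_continuous/derivable1_diffP.
exact: (@ex_derive _ _ _ _ _ _ _ (is_derive_gauss1 e x)).
Qed.

Lemma measurable_gauss1 e D : measurable_fun D (gauss1 e).
Proof.
apply: measurable_funTS; apply: continuous_measurable_fun.
exact: continuous_gauss1.
Qed.

Let gauss1E e : 0 < e ->
  gauss1 e = fun x => (Num.sqrt e)^-1 * normal_pdf 0 (Num.sqrt (2 * pi * e)^-1) x.
Proof.
move=> e0; have pi0 := @pi_gt0 R.
have e2 : 0 < 2 * pi * e by rewrite !mulr_gt0.
apply/funext => x; rewrite normal_pdfE ?gt_eqF ?sqrtr_gt0 ?invr_gt0//.
rewrite /normal_peak /normal_fun/= subr0 sqr_sqrtr ?invr_ge0 ?ltW//.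
rewrite (_ : (2 * pi * e)^-1 * pi *+ 2 = e^-1); last first.
  by move: pi pi0 => p p0; field; rewrite !gt_eqF.
rewrite sqrtrV ?ltW// invrK mulrA mulVf ?gt_eqF ?sqrtr_gt0// mul1r.
congr expR; move: pi pi0 e2 => p p0 e2; field.
by rewrite !gt_eqF.
Qed.

Lemma integrable_gauss1 e : 0 < e -> mu.-integrable setT (EFin \o gauss1 e).
Proof.
move=> e0; rewrite gauss1E// (_ : _ \o _ = fun x =>
  ((Num.sqrt e)^-1)%:E * (normal_pdf 0 (Num.sqrt (2 * pi * e)^-1) x)%:E)%E//.
apply: integrableZl => //; exact: integrable_normal_pdf.
Qed.

Lemma Rintegral_gauss1 e : 0 < e -> \int[mu]_x gauss1 e x = (Num.sqrt e)^-1.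
Proof.
move=> e0; rewrite gauss1E// RintegralZl//; last exact: integrable_normal_pdf.
by rewrite /Rintegral integral_normal_pdf mulr1.
Qed.

Lemma integrable_le (D : set R) (f g : R -> R) : measurable D ->
  measurable_fun D f ->
  (forall x, D x -> `|f x| <= g x) -> mu.-integrable D (EFin \o g) ->
  mu.-integrable D (EFin \o f).
Proof.
move=> mD mf fg; apply: le_integrable => //; first exact/measurable_EFinP.
move=> x Dx /=; rewrite lee_fin; apply: le_trans (fg _ Dx) _.
by rewrite ler_norm.
Qed.

Lemma integrable_gauss1_bounded e (h : R -> R) C : 0 < e ->
  measurable_fun setT h -> (forall x, `|h x| <= C) ->
  mu.-integrable setT (EFin \o (fun x => gauss1 e x * h x)).
Proof.
move=> e0 mh hC; apply: (@integrable_le _ _ (fun x => C * gauss1 e x)) => //.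
- by apply: measurable_funM => //; exact: measurable_gauss1.
- move=> x _; rewrite normrM (ger0_norm (gauss1_ge0 _ _)) mulrC.
  by rewrite ler_wpM2r// gauss1_ge0.
- rewrite (_ : _ \o _ = fun x => C%:E * (gauss1 e x)%:E)%E//.
  by apply: integrableZl => //; exact: integrable_gauss1.
Qed.

(** Half of the exponent absorbs [|x|]: with [u = |x| sqrt e], one has [u <= 1 + u^2 <= 1 + (pi / 2)
    u^2 <= exp ((pi / 2) u^2)]. *)
Lemma norm_mul_gauss1_le e x : 0 < e ->
  `|x| * gauss1 e x <= (Num.sqrt e)^-1 * gauss1 (e / 2) x.
Proof.
move=> e0; set s := Num.sqrt e; have s0 : 0 < s by rewrite sqrtr_gt0.
have -> : gauss1 e x = gauss1 (e / 2) x * gauss1 (e / 2) x.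
  by rewrite /gauss1 -expRD; congr expR; field.
rewrite mulrA ler_wpM2r ?gauss1_ge0// -[leRHS]mulr1 ler_pdivlMl// mulrA (mulrC s).
rewrite /gauss1; set u := `|x| * s.
have u0 : 0 <= u by rewrite mulr_ge0// ltW.
have ue : u ^+ 2 = e * x ^+ 2.
  by rewrite exprMn real_normK ?num_real// sqr_sqrtr ?ltW// mulrC.
rewrite (_ : - (e / 2) * pi * x ^+ 2 = - (pi / 2 * u ^+ 2)); last first.
  by rewrite ue; field.
rewrite expRN ler_pdivrMr ?expR_gt0// mul1r.
apply: (@le_trans _ _ (1 + pi / 2 * u ^+ 2)); last exact: expR_ge1Dx.
apply: (@le_trans _ _ (1 + u ^+ 2)); first by nra.
rewrite lerD2l ler_peMl ?sqr_ge0//.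
exact: pihalf_ge1.
Qed.

Lemma integrable_norm_mul_gauss1 e : 0 < e ->
  mu.-integrable setT (EFin \o (fun x => `|x| * gauss1 e x)).
Proof.
move=> e0.
apply: (@integrable_le _ _ (fun x => (Num.sqrt e)^-1 * gauss1 (e / 2) x)) => //.
- apply: measurable_funM; last exact: measurable_gauss1.
  exact: normr_measurable.
- move=> x _; rewrite ger0_norm ?norm_mul_gauss1_le//.
  by rewrite mulr_ge0// gauss1_ge0.
- rewrite (_ : _ \o _ = fun x => ((Num.sqrt e)^-1)%:E * (gauss1 (e / 2) x)%:E)%E//.
  by apply: integrableZl => //; apply: integrable_gauss1; rewrite divr_gt0.
Qed.

Lemma gauss1_le_inv e x : 0 < e -> 0 < x -> gauss1 e x <= (e * pi * x ^+ 2)^-1.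
Proof.
move=> e0 x0; have pi0 := @pi_gt0 R.
have z0 : 0 < e * pi * x ^+ 2 by rewrite !mulr_gt0// exprn_gt0.
rewrite /gauss1 !mulNr expRN lef_pV2 ?posrE ?expR_gt0//.
by apply: le_trans (expR_ge1Dx _); rewrite lerDr.
Qed.

Lemma cvg_gauss1_nat e : 0 < e -> gauss1 e n%:R @[n --> \oo] --> (0 : R).
Proof.
move=> e0; have pi0 := @pi_gt0 R.
have h : (e * pi)^-1 * (n.+1%:R)^-1 @[n --> \oo] --> (0 : R).
  by rewrite -[X in _ --> X](mulr0 (e * pi)^-1); apply: cvgMr; exact: cvg_harmonic.
rewrite -(cvg_shiftS (fun n => gauss1 e n%:R)).
apply: (squeeze_cvgr _ (cvg_cst 0) h); apply: nearW => n /=.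
rewrite gauss1_ge0/=; apply: le_trans (gauss1_le_inv _ _) _ => //.
rewrite -invfM lef_pV2 ?posrE ?mulr_gt0 ?exprn_gt0//.
by rewrite ler_pM2l ?mulr_gt0// ler_eXnr// ler1n.
Qed.

Lemma itv_cvg_setT (f : R -> R) x :
  (fun n : nat => f x * \1_(`[- n%:R, n%:R]) x) n @[n --> \oo] --> f x.
Proof.
apply: cvg_near_cst; near=> n.
have nx : `|x| <= n%:R by near: n; exact: nbhs_infty_ger.
rewrite indicE mem_set ?mulr1//= in_itv/=.
by move: nx; rewrite ler_norml.
Unshelve. all: end_near. Qed.

Lemma Rintegral_derive_eq0 (F f : R -> R) : continuous f ->
  (forall x, is_derive x 1 F (f x)) ->
  mu.-integrable setT (EFin \o f) ->
  F n%:R @[n --> \oo] --> (0 : R) ->  F (- n%:R) @[n --> \oo] --> (0 : R) ->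
  \int[mu]_x f x = 0.
Proof.
move=> cf dF intf Fy FNy.
have dc := @dominated_convergence _ _ R mu setT measurableT
  (fun n x => (f x * \1_(`[- n%:R, n%:R]) x)%:E) (EFin \o f)
  (fun x => `|f x|%:E).
have mf : measurable_fun setT f by exact: continuous_measurable_fun.
case: dc.
- move=> n; apply/measurable_EFinP; apply: measurable_funM => //.
- exact/measurable_EFinP.
- by apply: aeW => x _; apply: cvg_EFin; [exact: nearW|exact: itv_cvg_setT].
- by have := integrable_norm intf.
- apply: aeW => x n _ /=; rewrite lee_fin normrM indicE.
  by case: (_ \in _); rewrite ?(normr1,normr0,mulr1,mulr0).
move=> _ _ lim1.
have lim2 : (\int[mu]_x (f x * \1_(`[- n%:R, n%:R]) x)%:E)%E @[n --> \oo] --> 0%E.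
  (* The index is shifted because the fundamental theorem of calculus is applied on a nondegenerate
     interval, and [[-n, n]] degenerates at [n = 0]. *)
  rewrite -(cvg_shiftS (fun n => \int[mu]_x (f x * \1_(`[- n%:R, n%:R]) x)%:E)%E).
  rewrite [X in X @ _ --> _](_ : _ = fun n => (F n.+1%:R - F (- n.+1%:R))%:E).
    apply: cvg_EFin; first exact: nearW.
    rewrite -[X in _ --> X](subr0 0); apply: cvgB.
      by rewrite (cvg_shiftS (fun n => F n%:R)).
    by rewrite (cvg_shiftS (fun n => F (- n%:R))).
  apply/funext => n /=.
  have n0 : - n.+1%:R < n.+1%:R :> R by rewrite gtrN.
  rewrite EFinB -(@continuous_FTC2 R f F)//.
  - rewrite [RHS]integral_mkcond; apply: eq_integral => x _.
    rewrite patchE indicE; case: ifPn => _; by rewrite ?mulr1 ?mulr0.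
  - by apply: continuous_subspaceT.
  - split.
    + by move=> x _; exact: (@ex_derive _ _ _ _ _ _ _ (dF x)).
    + apply: cvg_at_right_filter; apply/differentiable_continuous/derivable1_diffP.
      exact: (@ex_derive _ _ _ _ _ _ _ (dF _)).
    + apply: cvg_at_left_filter; apply/differentiable_continuous/derivable1_diffP.
      exact: (@ex_derive _ _ _ _ _ _ _ (dF _)).
  - by move=> x _; rewrite derive1E; exact: (@derive_val _ _ _ _ _ _ _ (dF x)).
rewrite /Rintegral.
by rewrite -(cvg_lim _ lim1)// (cvg_lim _ lim2).
Qed.

Definition gauss_hat e xi := (Num.sqrt e)^-1 * gauss1 e^-1 xi.

Lemma gauss_hat_ge0 (e x : R) : 0 <= gauss_hat e x.
Proof. by rewrite mulr_ge0 ?invr_ge0 ?sqrtr_ge0 ?gauss1_ge0. Qed.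

Lemma gauss_hatM (e r x : R) :
  gauss_hat e (r * x) = (Num.sqrt e)^-1 * gauss1 (r ^+ 2 / e) x.
Proof. by rewrite /gauss_hat /gauss1; congr (_ * expR _); ring. Qed.

Let I e al xi := \int[mu]_x (gauss1 e x * cos (2 * pi * xi * x + al)).

Lemma measurable_cos_affine (a b : R) (D : set R) :
  measurable_fun D (fun x : R => cos (a * x + b)).
Proof.
apply: measurable_funTS; apply: continuous_measurable_fun => x.
apply: continuous_comp; last exact: continuous_cos.
by apply: cvgD; [apply: cvgMr; exact: cvg_id|exact: cvg_cst].
Qed.

Lemma measurable_sin_affine (a b : R) (D : set R) :
  measurable_fun D (fun x : R => sin (a * x + b)).
Proof.
apply: measurable_funTS; apply: continuous_measurable_fun => x.
apply: continuous_comp; last exact: continuous_sin.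
by apply: cvgD; [apply: cvgMr; exact: cvg_id|exact: cvg_cst].
Qed.

Let is_derive_integrand e al xi x :
  is_derive xi 1 (fun xi => gauss1 e x * cos (2 * pi * xi * x + al))
   (- (2 * pi * x) * gauss1 e x * sin (2 * pi * xi * x + al)).
Proof. by apply: trigger_derive; rewrite /GRing.scale/=; ring. Qed.

Let J e al xi := \int[mu]_x (- (2 * pi * x) * gauss1 e x * sin (2 * pi * xi * x + al)).

Let integrable_J e al xi : 0 < e -> mu.-integrable setT
  (EFin \o (fun x => - (2 * pi * x) * gauss1 e x * sin (2 * pi * xi * x + al))).
Proof.
move=> e0; have pi0 := @pi_gt0 R.
apply: (@integrable_le _ _ (fun x => 2 * pi * (`|x| * gauss1 e x))) => //.
- apply: measurable_funM; last exact: measurable_sin_affine.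
  apply: measurable_funM; last exact: measurable_gauss1.
  by apply: measurableT_comp => //; apply: measurable_funM.
- move=> x _; rewrite normrM -[leRHS]mulr1 ler_pM// ?sin_max//.
  rewrite normrM normrN !normrM (ger0_norm (gauss1_ge0 _ _)).
  by rewrite normr_nat (ger0_norm (ltW pi0)) mulrA.
- rewrite (_ : _ \o _ = fun x => (2 * pi)%:E * (`|x| * gauss1 e x)%:E)%E//.
  by apply: integrableZl => //; exact: integrable_norm_mul_gauss1.
Qed.

Let is_derive_I e al xi : 0 < e -> is_derive xi 1 (I e al) (J e al xi).
Proof.
move=> e0; have pi0 := @pi_gt0 R.
pose f xi x := gauss1 e x * cos (2 * pi * xi * x + al).
have h : forall a, (xi - 1 < a < xi + 1) ->  mu.-integrable setT (EFin \o f a).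
  move=> b _; apply: (@integrable_gauss1_bounded _ _ 1) => //.
    exact: measurable_cos_affine.
  by move=> x; exact: cos_max.
have ipf : xi \in `]xi - 1, xi + 1[.
  by rewrite in_itv/=; apply/andP; split; rewrite ?ltrDl ?ltrBlDr ?ltrDl.
have p1 x y : partial1of2 f x y =
   - (2 * pi * y) * gauss1 e y * sin (2 * pi * x * y + al).
  rewrite partial1of2E; exact: (@derive_val _ _ _ _ _ _ _ (is_derive_integrand e al x y)).
have nf z x : z \in `]xi - 1, xi + 1[ -> setT x -> derivable (f ^~ x) z 1.
  move=> _ _; exact: (@ex_derive _ _ _ _ _ _ _ (is_derive_integrand e al z x)).
have G0 x : 0 <= 2 * pi * (`|x| * gauss1 e x).
  by rewrite mulr_ge0 ?mulr_ge0 ?gauss1_ge0 ?(ltW pi0).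
have iG : mu.-integrable setT (EFin \o (fun x => 2 * pi * (`|x| * gauss1 e x))).
  rewrite (_ : _ \o _ = fun x => (2 * pi)%:E * (`|x| * gauss1 e x)%:E)%E//.
  by apply: integrableZl => //; exact: integrable_norm_mul_gauss1.
have Gub z x : z \in `]xi - 1, xi + 1[ -> setT x ->
    `|partial1of2 f z x| <= 2 * pi * (`|x| * gauss1 e x).
  move=> _ _; rewrite p1 normrM -[leRHS]mulr1 ler_pM// ?sin_max//.
  rewrite normrM normrN !normrM (ger0_norm (gauss1_ge0 _ _)).
  by rewrite normr_nat (ger0_norm (ltW pi0)) mulrA.
split.
  exact: (@derivable_under_integral R _ _ mu f setT measurableT
    xi (xi - 1) (xi + 1) ipf h nf _ G0 iG Gub).
rewrite -derive1E (@differentiation_under_integral R _ _ mu f setT measurableT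
    xi (xi - 1) (xi + 1) ipf h nf _ G0 iG Gub).
by apply: eq_Rintegral => x _; rewrite p1.
Qed.

(** Integration by parts: the derivative in [x] of [gauss1 e x * sin (2 pi xi x + al)] has integral
    0, and it is a combination of the integrands of [J] and [I]. *)
Let JE e al xi : 0 < e -> J e al xi = - (2 * pi * xi / e) * I e al xi.
Proof.
move=> e0; have pi0 := @pi_gt0 R.
pose s x : R := sin (2 * pi * xi * x + al).
pose c x : R := cos (2 * pi * xi * x + al).
have dF x : is_derive x 1 (fun x => gauss1 e x * s x)
    (e * (- (2 * pi * x) * gauss1 e x * s x) + 2 * pi * xi * (gauss1 e x * c x)).
  by rewrite /s /c /gauss1; apply: trigger_derive; rewrite /GRing.scale/=; ring.
have iJ := integrable_J al xi e0.
have iI : mu.-integrable setT (EFin \o (fun x => gauss1 e x * c x)).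
  apply: (@integrable_gauss1_bounded _ _ 1) => //; last by move=> x; exact: cos_max.
  exact: measurable_cos_affine.
have iJ' : mu.-integrable setT (EFin \o (fun x => e * (- (2 * pi * x) * gauss1 e x * s x))).
  rewrite (_ : _ \o _ = fun x => e%:E * (- (2 * pi * x) * gauss1 e x * s x)%:E)%E//.
  exact: integrableZl.
have iI' : mu.-integrable setT (EFin \o (fun x => 2 * pi * xi * (gauss1 e x * c x))).
  rewrite (_ : _ \o _ = fun x => (2 * pi * xi)%:E * (gauss1 e x * c x)%:E)%E//.
  exact: integrableZl.
have cg n : `|gauss1 e n%:R * s n%:R| <= gauss1 e n%:R.
  by rewrite normrM (ger0_norm (gauss1_ge0 _ _)) ler_piMr ?gauss1_ge0 ?sin_max.
have cgN n : `|gauss1 e (- n%:R) * s (- n%:R)| <= gauss1 e n%:R.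
  by rewrite gauss1N normrM (ger0_norm (gauss1_ge0 _ _)) ler_piMr ?gauss1_ge0 ?sin_max.
have sq (u : R^nat) : (forall n, `|u n| <= gauss1 e n%:R) -> u @ \oo --> (0 : R).
  move=> ug; apply/norm_cvg0P; apply: (squeeze_cvgr _ (cvg_cst 0) (cvg_gauss1_nat e0)).
  by apply: nearW => n /=; rewrite normr_ge0 ug.
have := Rintegral_derive_eq0 _ dF.
rewrite RintegralD// !RintegralZl// => /(_ _ _ (sq _ cg) (sq _ cgN)) H.
rewrite -/(J e al xi) -/(I e al xi) in H.
have {H} : e * J e al xi + 2 * pi * xi * I e al xi = 0.
  apply: H; last exact: integrableD iJ' iI'.
  move=> x; apply/differentiable_continuous/derivable1_diffP.
  rewrite /s /c; apply: ex_derive.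
move=> /eqP; rewrite addr_eq0 => /eqP H.
apply: (mulfI (lt0r_neq0 e0)); rewrite H; field.
by rewrite gt_eqF.
Qed.

(** As a function of [xi] the integral solves [I' = - (2 pi xi / e) I] ([is_derive_I] and [JE]), so
    [exp (pi xi^2 / e) * I] is constant. The phase [al] treats cosine and sine transforms
    together. *)
Lemma gauss_cos e al xi : 0 < e ->
  \int[mu]_x (gauss1 e x * cos (2 * pi * xi * x + al)) = gauss_hat e xi * cos al.
Proof.
move=> e0; have pi0 := @pi_gt0 R.
pose K xi := expR (pi / e * xi ^+ 2) * I e al xi.
have dK x : is_derive x 1 K 0.
  have dI := is_derive_I al x e0.
  rewrite /K; apply: trigger_derive; rewrite /GRing.scale/= JE//; ring.
have : K xi = K 0.
  by apply: is_derive_0_is_cst => x; exact: dK.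
rewrite /K expr0n/= mulr0 expR0 mul1r => H.
apply: (mulfI (lt0r_neq0 (expR_gt0 (pi / e * xi ^+ 2)))).
have E : expR (pi / e * xi ^+ 2) * gauss1 e^-1 xi = 1.
  rewrite /gauss1 -expRD (_ : _ + _ = 0) ?expR0//; field.
  by rewrite gt_eqF.
rewrite [LHS]H /gauss_hat [RHS]mulrA [X in X * cos al]mulrCA E mulr1 /I -Rintegral_gauss1//.
under eq_Rintegral do rewrite mulr0 mul0r add0r.
by rewrite RintegralZr//; exact: integrable_gauss1.
Qed.

End GaussianIntegral.

(** * Fejer sums *)

Section FejerSums.
Variable R : realType.
Implicit Types (a f : int -> R).

(** Collecting [k = i - j], this is the sum of [(N - |k|) a(k)], that is, [N] times the Cesaro mean
    of the symmetric partial sums. The double sum is the form in which positivity shows. *)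
Definition fejer_sum a (N : nat) : R := \sum_(i < N) \sum_(j < N) a (i%:Z - j%:Z).

(* [series (zpair a)] runs over the symmetric partial sums of [a]. *)
Definition zpair a (k : nat) : R :=
  if k is k'.+1 then a k%:Z + a (- k%:Z) else a 0.

Lemma eq_fejer_sum a f N : a =1 f -> fejer_sum a N = fejer_sum f N.
Proof. by move=> af; do 2 (apply: eq_bigr => ? _); rewrite af. Qed.

Lemma fejer_sumZ c a N : fejer_sum (fun k => c * a k) N = c * fejer_sum a N.
Proof. by rewrite /fejer_sum mulr_sumr; under [RHS]eq_bigr do rewrite mulr_sumr. Qed.

Lemma fejer_sumD a f N :
  fejer_sum (fun k => a k + f k) N = fejer_sum a N + fejer_sum f N.
Proof. by rewrite /fejer_sum -big_split/=; apply: eq_bigr => i _; rewrite -big_split. Qed.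

Lemma fejer_sum_odd a N : (forall k, a (- k) = - a k) -> fejer_sum a N = 0.
Proof.
move=> aN; suff : fejer_sum a N = - fejer_sum a N.
  by move/eqP; rewrite -addr_eq0 -mulr2n mulrn_eq0 => /eqP.
rewrite {1}/fejer_sum exchange_big/= /fejer_sum -sumrN; apply: eq_bigr => i _.
by rewrite -sumrN; apply: eq_bigr => j _; rewrite -aN opprB.
Qed.

Lemma series_zpairE a N : series (zpair a) N.+1 =
  a 0 + \sum_(k < N) (a k.+1%:Z + a (- k.+1%:Z)).
Proof. by rewrite /series/= big_nat_recl// big_mkord. Qed.

(** Passing from [N] to [N + 1] adds one row, one column and a corner, which together form a
    symmetric partial sum of [a]. *)
Lemma fejer_sumE a N : fejer_sum a N = \sum_(0 <= n < N) series (zpair a) n.+1.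
Proof.
elim: N => [|N IH]; first by rewrite /fejer_sum !big_ord0 big_geq.
rewrite big_nat_recr//= -IH /fejer_sum big_ord_recr/=.
under eq_bigr do rewrite big_ord_recr/=.
rewrite big_split/= -addrA; congr (_ + _).
rewrite series_zpairE big_ord_recr/= subrr.
rewrite [RHS]addrC addrA; congr (_ + _); rewrite big_split/= addrC; congr (_ + _).
  rewrite (reindex_inj rev_ord_inj)/=; apply: eq_bigr => i _; congr a.
  by have := ltn_ord i; lia.
rewrite (reindex_inj rev_ord_inj)/=; apply: eq_bigr => i _; congr a.
by have := ltn_ord i; lia.
Qed.

Lemma fejer_mean_cvg a (l : R) : series (zpair a) @ \oo --> l ->
  (fun N => N.+1%:R^-1 * fejer_sum a N.+1) @ \oo --> l.
Proof.
rewrite -cvg_shiftS => /cesaro; apply: cvg_trans.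
rewrite (_ : (fun N => _) = arithmetic_mean (fun n => series (zpair a) n.+1))//.
by apply/funext => N; rewrite fejer_sumE.
Qed.

Lemma cvg_series_zpair a (l1 l2 : R) :
  series (fun n : nat => a n%:Z) @ \oo --> l1 ->
  series (fun n : nat => a (- n.+1%:Z)) @ \oo --> l2 ->
  series (zpair a) @ \oo --> l1 + l2.
Proof.
move=> h1 h2; rewrite -cvg_shiftS.
have : (fun n => series (fun n : nat => a n%:Z) n.+1 +
                 series (fun n : nat => a (- n.+1%:Z)) n) @ \oo --> l1 + l2.
  by apply: cvgD => //; rewrite cvg_shiftS.
apply: cvg_trans; rewrite (_ : (fun n => _ + _) = (fun n => series (zpair a) n.+1))//.
apply/funext => n; rewrite series_zpairE /series/= big_nat_recl// -addrA.
by rewrite !big_mkord big_split.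
Qed.

(** Both sides are [|sum_p exp (i th_p)|^2]. *)
Lemma sum_cosB (I : finType) (th : I -> R) :
  \sum_(p : I) \sum_(q : I) cos (th p - th q) =
  (\sum_p cos (th p)) ^+ 2 + (\sum_p sin (th p)) ^+ 2.
Proof.
under eq_bigr do under eq_bigr do rewrite cosB.
rewrite !expr2 !mulr_suml -big_split/=; apply: eq_bigr => p _.
by rewrite !mulr_sumr -big_split.
Qed.

Lemma sum_cosB_ge0 (I : finType) (th : I -> R) :
  0 <= \sum_(p : I) \sum_(q : I) cos (th p - th q).
Proof. by rewrite sum_cosB addr_ge0 ?sqr_ge0. Qed.

End FejerSums.

Section RintegralSum.
Context d (T : measurableType d) (R : realType) (mu : {measure set T -> \bar R}).

Lemma integrable_sumR (D : set T) (I : Type) (s : seq I) (f : I -> T -> R) :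
  measurable D -> (forall i, mu.-integrable D (EFin \o f i)) ->
  mu.-integrable D (EFin \o (fun x => \sum_(i <- s) f i x)).
Proof.
move=> mD If; rewrite (_ : _ \o _ = fun x => (\sum_(i <- s) (f i x)%:E)%E).
  by apply: integrable_sum => // i _; exact: If.
by apply/funext => x /=; rewrite sumEFin.
Qed.

Lemma Rintegral_sum (D : set T) (I : Type) (s : seq I) (f : I -> T -> R) :
  measurable D -> (forall i, mu.-integrable D (EFin \o f i)) ->
  \int[mu]_(x in D) (\sum_(i <- s) f i x) = \sum_(i <- s) \int[mu]_(x in D) f i x.
Proof.
move=> mD If; elim: s => [|i s IH].
  rewrite big_nil; under eq_Rintegral do rewrite big_nil.
  by rewrite Rintegral_cst// mul0r.
rewrite big_cons -IH -RintegralD//; last exact: integrable_sumR.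
by apply: eq_Rintegral => x _; rewrite big_cons.
Qed.

End RintegralSum.

(** * Fejer sums of Gaussians and their monotonicity in the parameter *)

Section FejerGauss.
Variable R : realType.
Notation mu := (@lebesgue_measure R).
Implicit Types (d x : R) (k : int).

(** This is [N] times the Fejer kernel of period 1. *)
Let cos2 N (y : R) := fejer_sum (fun k : int => cos (2 * pi * k%:~R * y)) N.

Let cos2_ge0 N y : 0 <= cos2 N y.
Proof.
have := sum_cosB_ge0 (fun i : 'I_N => 2 * pi * y * i%:R : R).
congr (0 <= _); do 2 (apply: eq_bigr => ? _); congr cos.
rewrite intrB; ring.
Qed.

Lemma gauss_hatV d x : 0 < d -> gauss_hat d^-1 x = Num.sqrt d * gauss1 d x.
Proof. by move=> d0; rewrite /gauss_hat sqrtrV ?ltW// !invrK. Qed.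

Let cosi d k : 0 < d -> mu.-integrable setT
  (EFin \o (fun y => gauss1 d y * cos (2 * pi * k%:~R * y))).
Proof.
move=> d0; apply: (@integrable_gauss1_bounded _ _ _ 1) => //.
  apply: continuous_measurable_fun => x.
  apply: continuous_comp; last exact: continuous_cos.
  by apply: cvgMr; exact: cvg_id.
by move=> x; exact: cos_max.
Qed.

Let cos2E d N y : gauss1 d y * cos2 N y =
  \sum_(i < N) \sum_(j < N) gauss1 d y * cos (2 * pi * (i%:Z - j%:Z)%:~R * y).
Proof. by rewrite mulr_sumr; apply: eq_bigr => i _; rewrite mulr_sumr. Qed.

Let icos2 d N : 0 < d -> mu.-integrable setT (EFin \o (fun y => gauss1 d y * cos2 N y)).
Proof.
move=> d0; rewrite (_ : (fun y => _) = fun y =>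
  \sum_(i < N) \sum_(j < N) gauss1 d y * cos (2 * pi * (i%:Z - j%:Z)%:~R * y)).
  by apply: integrable_sumR => // i; apply: integrable_sumR => // j; exact: cosi.
by apply/funext => y; rewrite cos2E.
Qed.

Lemma Rintegral_fejer_gauss d N : 0 < d ->
  \int[mu]_y (gauss1 d^-1 y * cos2 N y) = Num.sqrt d * fejer_sum (fun k => gauss1 d k%:~R) N.
Proof.
move=> d0; have di : 0 < d^-1 by rewrite invr_gt0.
under eq_Rintegral do rewrite cos2E.
rewrite Rintegral_sum//; last first.
  by move=> i; apply: integrable_sumR => // j; exact: cosi.
rewrite /fejer_sum mulr_sumr; apply: eq_bigr => i _.
rewrite Rintegral_sum//; last by move=> j; exact: cosi.
rewrite mulr_sumr; apply: eq_bigr => j _.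
have := gauss_cos 0 (i%:Z - j%:Z)%:~R di; rewrite cos0 mulr1 gauss_hatV// => <-.
by apply: eq_Rintegral => y _; rewrite addr0.
Qed.

Lemma gauss1_le_param d1 d2 y : d1 <= d2 -> gauss1 d2 y <= gauss1 d1 y :> R.
Proof.
move=> d12; rewrite /gauss1 ler_expR -!mulrA !mulNr lerN2 ler_wpM2r//.
by rewrite mulr_ge0 ?pi_ge0 ?sqr_ge0.
Qed.

(** By [Rintegral_fejer_gauss] the parameter enters only through [gauss1 d^-1 y], which grows with
    [d], integrated against the nonnegative kernel [cos2]. *)
Lemma sqrt_fejer_gauss_le d1 d2 N : 0 < d1 -> d1 <= d2 ->
  Num.sqrt d1 * fejer_sum (fun k => gauss1 d1 k%:~R) N <=
  Num.sqrt d2 * fejer_sum (fun k => gauss1 d2 k%:~R) N.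
Proof.
move=> d10 d12; have d20 := lt_le_trans d10 d12.
rewrite -!Rintegral_fejer_gauss//; apply: le_Rintegral => //.
- by apply: icos2; rewrite invr_gt0.
- by apply: icos2; rewrite invr_gt0.
- move=> y _; rewrite ler_wpM2r ?cos2_ge0// gauss1_le_param//.
  by rewrite lef_pV2.
Qed.

Lemma is_derive_bigsum n (f : 'I_n -> R -> R) (df : 'I_n -> R) x :
  (forall i, is_derive x 1 (f i) (df i)) ->
  is_derive x 1 (fun x => \sum_(i < n) f i x) (\sum_(i < n) df i).
Proof.
move=> fd; rewrite (_ : (fun x => _) = \sum_(i < n) f i).
  exact: is_derive_sum.
by apply/funext => y; rewrite fct_sumE.
Qed.

Lemma is_derive_fejer (f : int -> R -> R) (df : int -> R) x N :
  (forall k, is_derive x 1 (f k) (df k)) ->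
  is_derive x 1 (fun x => fejer_sum (f^~ x) N) (fejer_sum df N).
Proof.
by move=> fd; apply: is_derive_bigsum => i; apply: is_derive_bigsum => j.
Qed.

(* Up to the factor [2 * Num.sqrt d], this is the derivative in [d] of the
   nondecreasing function of [sqrt_fejer_gauss_le]. *)
Lemma fejer_dgauss_ge0 d N : 0 < d ->
  0 <= fejer_sum (fun k => gauss1 d k%:~R * (1 - 2 * pi * d * k%:~R ^+ 2)) N.
Proof.
move=> d0; set W := fejer_sum _ N.
pose S x := fejer_sum (fun k => gauss1 x k%:~R : R) N.
pose dS x := fejer_sum (fun k => - (pi * k%:~R ^+ 2) * gauss1 x k%:~R : R) N.
have SD x : is_derive x 1 S (dS x).
  apply: is_derive_fejer => k; rewrite /gauss1.
  by apply: trigger_derive; rewrite /GRing.scale/=; ring.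
have s0 : 0 < Num.sqrt d by rewrite sqrtr_gt0.
suff : forall e, 0 < e -> 0 <= (2 * Num.sqrt d)^-1 * W + e.
  move=> h; have {}h : 0 <= (2 * Num.sqrt d)^-1 * W.
    by apply/ler_addgt0Pr => e e0; exact: h.
  by rewrite pmulr_rge0 // in h; rewrite invr_gt0 mulr_gt0.
move=> e e0.
(* The term [e * x] makes [f] strictly increasing, as [incr_derive1_ge0_itvy] asks; [e] is
   arbitrary. *)
pose f x := Num.sqrt x * S x + e * x.
have fD x : 0 < x -> is_derive x 1 f ((2 * Num.sqrt x)^-1 * S x + Num.sqrt x * dS x + e).
  move=> x0; have := is_derive1_sqrt x0 => dsq; rewrite /f.
  by apply: trigger_derive; rewrite /GRing.scale/=; ring.
have -> : (2 * Num.sqrt d)^-1 * W + e = derive1 f d.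
  rewrite derive1E (@derive_val _ _ _ _ _ _ _ (fD d d0)); congr (_ + _).
  have -> : W = S d + 2 * d * dS d.
    rewrite /W /S /dS -fejer_sumZ -fejer_sumD; apply: eq_fejer_sum => k; ring.
  rewrite (_ : 2 * d * dS d = 2 * Num.sqrt d ^+ 2 * dS d); last first.
    by rewrite sqr_sqrtr// ltW.
  field.
  by rewrite gt_eqF.
apply: (@incr_derive1_ge0_itvy R f false 0 d).
- move=> x; rewrite inE/= in_itv/= andbT => x0.
  exact: (@ex_derive _ _ _ _ _ _ _ (fD x x0)).
- move=> x y; rewrite !in_itv/= !andbT => x0 y0 xy; rewrite /f.
  by rewrite ler_ltD ?ltr_pM2l// sqrt_fejer_gauss_le// ltW.
- by rewrite in_itv/= andbT.
Qed.

End FejerGauss.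

(** * A Gaussian interpolation inequality *)

Section CosecantSquared.
Variable R : realType.
Implicit Types (x y u : R).

Lemma sin_sqrDintpi (k : int) y : sin (y + pi * k%:~R) ^+ 2 = sin y ^+ 2 :> R.
Proof.
have nat n z : sin (z + pi * n%:R) ^+ 2 = sin z ^+ 2 :> R.
  by rewrite mulr_natr (alternatingn (@sinDpi R)) exprMn sqrr_sign mul1r.
case: k => n; first exact: nat.
by rewrite NegzE mulrNz mulrN -(nat n.+1 (_ - _)) subrK.
Qed.

Lemma sinpi_neq0 x : (forall k : int, x != k%:~R) -> sin (pi * x) != 0.
Proof.
move=> xZ; pose k := Num.floor x; have pi0 := @pi_gt0 R.
have kx : k%:~R < x by rewrite lt_neqAle eq_sym xZ floor_le_tmp.
have xk : x < k%:~R + 1 by have := floorD1_gt x; rewrite intrD.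
rewrite -sqrf_eq0 -(sin_sqrDintpi (- k)) sqrf_eq0 gt_eqF//.
rewrite mulrNz -mulrDr sin_gt0_pi// mulr_gt0 ?subr_gt0//=.
by rewrite -ltr_pdivlMl// mulVf ?gt_eqF// ltrBlDl.
Qed.

Let E y := (sin y ^+ 2)^-1.

(** Divide [cos^2 + sin^2 = 1] at [y / 2] by [sin^2 y = 4 sin^2 (y / 2) cos^2 (y / 2)]; the cosine
    is a sine shifted by [pi / 2]. *)
Let E_half y : sin y != 0 -> E y = (E (y / 2) + E ((y + pi) / 2)) / 4.
Proof.
rewrite /E (mulrDl y pi) sinDpihalf.
have -> : sin y = 2 * (cos (y / 2) * sin (y / 2)).
  rewrite [in LHS](_ : y = (y / 2) *+ 2) ?sin_mulr2n ?mulr_natl//.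
  by rewrite -mulr_natr divfK.
rewrite !mulf_eq0 negb_or pnatr_eq0/= negb_or => /andP[c0 s0].
rewrite -[LHS]mul1r -[X in X * _](cos2Dsin2 (y / 2)); field.
by rewrite c0 s0.
Qed.

Let sum_double (f : nat -> R) m :
  \sum_(i < 2 * m) f i = \sum_(i < m) f (2 * i)%N + \sum_(i < m) f (2 * i).+1.
Proof.
elim: m => [|m IH]; first by rewrite !big_ord0 addr0.
rewrite (_ : (2 * m.+1 = (2 * m).+2)%N); last by lia.
by rewrite 2!big_ord_recr/= IH !big_ord_recr/=; ring.
Qed.

(* [E_half] iterated; bounding each term by [E_le] yields one inequality of
   the partial fraction expansion of [(pi / sin (pi * x)) ^+ 2], the only one
   needed. *)
Let E_sum n y : sin y != 0 ->
  \sum_(i < 2 ^ n) E ((y + pi * i%:R) / 2 ^+ n) = 4 ^+ n * E y.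
Proof.
elim: n y => [|n IH] y sy.
  by rewrite expn0 big_ord_recr big_ord0/= add0r mulr0 addr0 !expr0 divr1 mul1r.
have [s1 s2] : sin (y / 2) != 0 /\ sin ((y + pi) / 2) != 0.
  rewrite mulrDl sinDpihalf; apply/andP; move: sy.
  rewrite -[in X in X -> _](divfK (_ : 2 != 0) y)// mulr_natr sin_mulr2n.
  by rewrite -mulr_natr !mulf_eq0 !negb_or pnatr_eq0/= andbT andbC.
rewrite expnS (sum_double (fun i => E ((y + pi * i%:R) / 2 ^+ n.+1))) E_half// mulrDl mulrDr.
rewrite [X in _ = X + _](_ : _ = 4 ^+ n * E (y / 2)); last by rewrite exprS; field.
rewrite [X in _ = _ + X](_ : _ = 4 ^+ n * E ((y + pi) / 2)); last by rewrite exprS; field.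
rewrite -!IH//; congr (_ + _); apply: eq_bigr => i _; congr E.
  by rewrite natrM exprS; field; rewrite expf_neq0.
by rewrite -addn1 natrD natrM exprS; field; rewrite expf_neq0.
Qed.

(** This is [u <= tan u], in a form that survives at [pi / 2]. *)
Let sin_ge_mulcos u : 0 <= u -> u <= pi / 2 -> u * cos u <= sin u.
Proof.
rewrite le_eqVlt => /predU1P[<- _|u0 upi]; first by rewrite mul0r sin0.
have pi0 := @pi_gt0 R.
pose h v : R := sin v - v * cos v.
have dh (v : R) : is_derive v 1 h (v * sin v).
  by rewrite /h; apply: trigger_derive; rewrite /GRing.scale/=; ring.
have [] := @MVT R h (fun v => v * sin v) 0 u u0.
- apply: continuous_subspaceT => v; apply/differentiable_continuous/derivable1_diffP.
  exact: (@ex_derive _ _ _ _ _ _ _ (dh v)).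
move=> c; rewrite in_itv/= => /andP[c0 cu].
rewrite /h sin0 mul0r !subr0 => H; rewrite -subr_ge0 H.
rewrite !mulr_ge0 ?(ltW c0) ?(ltW u0)// sin_ge0_pi// (ltW c0)/=.
by apply: ltW; apply: lt_le_trans cu (le_trans upi _); lra.
Qed.

(** The range is the one met in [finite_csc]: [|x| <= 2^n / 2] and [|k| <= 2^n] give
    [|x - k| / 2^(n+1) <= 3/4]. Up to [pi / 2] the bound, even with 1 in place of 2, follows from
    [u <= tan u]; beyond, [sin^2 u >= 1/2]. *)
Let E_le u : u != 0 -> sin u != 0 -> `|u| <= pi * (3 / 4) -> E u <= (u ^+ 2)^-1 + 2.
Proof.
wlog u0 : u / 0 < u => [hw|].
  move=> un0; have [u0|ul] := ltP 0 u; first by move=> *; exact: hw.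
  have := hw (- u); rewrite /E sinN !sqrrN normrN oppr_gt0 !oppr_eq0.
  by apply => //; rewrite lt_neqAle un0.
move=> un0 su; rewrite gtr0_norm// => upi; have pi0 := @pi_gt0 R.
have s0 : 0 < sin u ^+ 2 by rewrite lt_neqAle sqr_ge0 eq_sym expf_neq0.
have u20 : 0 < u ^+ 2 by rewrite exprn_gt0.
rewrite /E; have [ul|ul] := leP u (pi / 2).
  have h := sin_ge_mulcos (ltW u0) ul.
  have c0 : 0 <= cos u by apply: cos_ge0_pihalf; rewrite ul andbT; lra.
  have : u ^+ 2 <= sin u ^+ 2 * (1 + u ^+ 2).
    have : (u * cos u) ^+ 2 <= sin u ^+ 2.
      have m0 : 0 <= u * cos u by rewrite mulr_ge0// ltW.
      by rewrite ler_pXn2r// nnegrE//; exact: le_trans h.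
    rewrite exprMn cos2sin2; nra.
  move=> H; apply: (@le_trans _ _ ((u ^+ 2)^-1 + 1)); last by rewrite lerD2l ler1n.
  rewrite (_ : (u ^+ 2)^-1 + 1 = (1 + u ^+ 2) / u ^+ 2); last by field.
  by rewrite ler_pdivlMr// mulrC ler_pdivrMr// mulrC.
apply: (@le_trans _ _ 2); last by rewrite lerDr invr_ge0 ltW.
have : 2^-1 <= sin u ^+ 2.
  have := cos_mulr2n u; rewrite cos2sin2.
  have -> : cos (u *+ 2) = - cos (u *+ 2 - pi).
    by rewrite -[in LHS](subrK pi (u *+ 2)) cosDpi.
  have : 0 <= cos (u *+ 2 - pi) by apply: cos_ge0_pihalf; lra.
  lra.
by move=> h; rewrite -[leRHS]invrK lef_pV2// posrE invr_gt0.
Qed.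

(** Repeated halving produces an even number of nodes, here [M, ..., 1 - M], one short of the
    symmetric window. *)
Lemma sum_window (f : int -> R) M :
  \sum_(i < M + M) f (M%:Z - i%:Z) + f (- M%:Z) = series (zpair f) M.+1.
Proof.
rewrite big_split_ord/= series_zpairE.
have -> : \sum_(i < M) f (M%:Z - i%:Z) = \sum_(k < M) f (k.+1%:Z).
  rewrite (reindex_inj rev_ord_inj)/=; apply: eq_bigr => i _; congr f.
  by have := ltn_ord i; lia.
have -> : \sum_(i < M) f (M%:Z - (M + i)%:Z) = \sum_(i < M) f (- i%:Z).
  by apply: eq_bigr => i _; congr f; lia.
rewrite big_split/= -addrA [RHS]addrCA; congr (_ + _).
have <- : \sum_(i < M.+1) f (- (i : nat)%:Z) = \sum_(i < M) f (- i%:Z) + f (- M%:Z).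
  by rewrite big_ord_recr.
by rewrite big_ord_recl/= oppr0.
Qed.

(** [E_sum] is used at depth [n + 1] from [y = pi (x - M)] with [M = 2^n], so that its [2M] points
    are [pi (x - k) / 2^(n+1)] for [k] from [M] down to [1 - M], nearly centred. The errors of
    [E_le] add up to [2M * pi^2 * 2 / 4^(n+1) = pi^2 / 2^n]. *)
Let finite_csc n x : (forall k : int, x != k%:~R) -> `|x| <= 2 ^+ n / 2 ->
  pi ^+ 2 * E (pi * x) <=
  series (zpair (fun k => ((x - k%:~R) ^+ 2)^-1)) (2 ^ n).+1 + pi ^+ 2 / 2 ^+ n.
Proof.
move=> xZ xn; have pi0 := @pi_gt0 R; set f := fun k : int => _.
set M := (2 ^ n)%N; have MR : M%:R = 2 ^+ n :> R by rewrite natrX.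
have M0 : 0 < 2 ^+ n :> R by rewrite exprn_gt0.
set y := pi * (x - M%:R).
have sy : sin y ^+ 2 = sin (pi * x) ^+ 2.
  by rewrite /y mulrBr -mulrN -[M%:R]/(M%:Z%:~R) -mulrNz sin_sqrDintpi.
have sy0 : sin y != 0 by rewrite -sqrf_eq0 sy sqrf_eq0 sinpi_neq0.
have := E_sum n.+1 sy0; rewrite expnS mul2n -addnn -/M => H.
have {}H : E (pi * x) = (4 ^+ n.+1)^-1 * \sum_(i < M + M) E ((y + pi * i%:R) / 2 ^+ n.+1).
  by rewrite H mulKf ?expf_neq0// /E sy.
have term (i : 'I_(M + M)) : pi ^+ 2 * ((4 ^+ n.+1)^-1 * E ((y + pi * i%:R) / 2 ^+ n.+1)) <=
   f (M%:Z - i%:Z) + pi ^+ 2 * ((4 ^+ n.+1)^-1 * 2).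
  set u := (y + _) / _.
  have uE : u = pi * (x - (M%:Z - i%:Z)%:~R) / 2 ^+ n.+1.
    by rewrite /u /y intrB/=; congr (_ / _); ring.
  have xk : x - (M%:Z - i%:Z)%:~R != 0 by rewrite subr_eq0 xZ.
  have un0 : u != 0.
    by rewrite uE !mulf_eq0 !negb_or xk gt_eqF// invr_eq0 expf_neq0.
  have su : sin u != 0.
    rewrite uE -mulrA sinpi_neq0// => k; apply/negP => /eqP h.
    have : x = (k * (2 ^ n.+1)%:Z + (M%:Z - i%:Z))%:~R.
      rewrite intrD intrM -h -[(2 ^ n.+1)%:Z%:~R]/((2 ^ n.+1)%:R) natrX divfK ?expf_neq0//.
      by rewrite subrK.
    by move/eqP; apply/negP/xZ.
  have ub : `|u| <= pi * (3 / 4).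
    rewrite uE -mulrA normrM gtr0_norm// ler_pM2l// normrM normfV (ger0_norm (_ : 0 <= 2 ^+ n.+1)) ?exprn_ge0//.
    rewrite ler_pdivrMr ?exprn_gt0// exprS.
    have : `|(M%:Z - i%:Z)%:~R| <= 2 ^+ n :> R.
      rewrite -MR -[M%:R]/(M%:Z%:~R) -intr_norm ler_int.
      by have := ltn_ord i; lia.
    have := ler_normB x (M%:Z - i%:Z)%:~R; lra.
  have := E_le un0 su ub.
  have -> : f (M%:Z - i%:Z) = pi ^+ 2 * ((4 ^+ n.+1)^-1 * (u ^+ 2)^-1).
    rewrite /f uE !exprMn exprVn -exprM mulnC exprM (_ : 2 ^+ 2 = 4); last by rewrite -natrX.
    have z4 : (4 : R) ^+ n.+1 != 0 by rewrite expf_neq0.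
    move: (x - _) xk (4 ^+ n.+1) z4 pi pi0 => X X0 Z Z0 p p0; field.
    by rewrite Z0 X0 gt_eqF.
  by rewrite -mulrDr -mulrDr => h; rewrite !ler_pM2l ?exprn_gt0 ?invr_gt0 ?exprn_gt0.
rewrite H mulrA mulr_sumr.
apply: (@le_trans _ _ (\sum_(i < M + M) (f (M%:Z - i%:Z) + pi ^+ 2 * ((4 ^+ n.+1)^-1 * 2)))).
  by apply: ler_sum => i _; rewrite -mulrA; exact: term.
(* The node [- M] that [sum_window] brings in on the right only adds a nonnegative term there. *)
rewrite big_split/= sumr_const card_ord -sum_window -addrA lerD2l.
rewrite (_ : _ *+ _ = pi ^+ 2 / 2 ^+ n).
  by rewrite lerDr invr_ge0 sqr_ge0.
rewrite -mulr_natr natrD MR.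
have -> : (4 : R) ^+ n.+1 = 4 * (2 ^+ n) ^+ 2.
  by rewrite exprS -exprM mulnC exprM (_ : 2 ^+ 2 = 4)// -natrX.
move: (2 ^+ n) M0 => Z Z0; field.
by rewrite gt_eqF.
Qed.

Lemma csc2_le_near x e : (forall k : int, x != k%:~R) -> 0 < e ->
  \forall n \near \oo, pi ^+ 2 / sin (pi * x) ^+ 2 - e <=
     series (zpair (fun k => ((x - k%:~R) ^+ 2)^-1)) n.
Proof.
move=> xZ e0; have pi0 := @pi_gt0 R; set f := fun k : int => _.
have [n xn en] : exists2 n : nat, `|x| <= 2 ^+ n / 2 & pi ^+ 2 / 2 ^+ n <= e.
  pose m := Num.trunc (`|x| * 2 + pi ^+ 2 / e).
  have hm : `|x| * 2 + pi ^+ 2 / e < m.+1%:R by rewrite truncnS_gt.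
  have m2 : m.+1%:R <= 2 ^+ m.+1 :> R by rewrite -natrX ler_nat ltnW// ltn_expl.
  have x2 : 0 <= `|x| * 2 by rewrite mulr_ge0.
  have p2 : 0 <= pi ^+ 2 / e by rewrite divr_ge0 ?sqr_ge0 ?ltW.
  exists m.+1; first by rewrite ler_pdivlMr//; lra.
  rewrite ler_pdivrMr ?exprn_gt0// mulrC -ler_pdivrMr//; lra.
have fs := finite_csc xZ xn; near=> N.
rewrite lerBlDr; apply: le_trans fs _; apply: lerD => //.
have mono : nondecreasing_seq (series (zpair f)).
  apply/nondecreasing_seqP => k; rewrite /series/= big_nat_recr//= lerDl.
  by case: k => [|k]/=; rewrite ?addr_ge0// invr_ge0 sqr_ge0.
by apply: mono; near: N; exact: nbhs_infty_ge.
Unshelve. all: end_near. Qed.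

Lemma gauss_interpolation_ge (d x L : R) : 0 < d -> (forall k : int, x != k%:~R) ->
  series (zpair (fun k => gauss1 d k%:~R / (x - k%:~R) ^+ 2 +
     - (2 * pi * d * k%:~R) * gauss1 d k%:~R / (x - k%:~R))) @ \oo --> L ->
  gauss1 d x * (pi ^+ 2 / sin (pi * x) ^+ 2) <= L.
Proof.
move=> d0 xZ; have pi0 := @pi_gt0 R.
set q := fun k : int => _; set A := pi ^+ 2 / _ => qL.
pose f (k : int) := ((x - k%:~R) ^+ 2)^-1.
(* The Fejer sums of [t^~ dd] vanish at [dd = 0] and are nondecreasing in [dd]
   by [fejer_dgauss_ge0], the part of [dt] that is odd in [k] cancelling. *)
pose t (k : int) dd := expR (pi * dd * x ^+ 2) * (gauss1 dd k%:~R / (x - k%:~R) ^+ 2 +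
     - (2 * pi * dd * k%:~R) * gauss1 dd k%:~R / (x - k%:~R)) - f k.
(* The factor [x^2 - k^2] brought down by the exponentials lowers each pole by one order; the
   derivative of the explicit [dd] cancels the simple pole that remains. *)
pose dt (k : int) dd := expR (pi * dd * x ^+ 2) * (pi *
   (gauss1 dd k%:~R * (1 - 2 * pi * dd * k%:~R ^+ 2) - 2 * pi * dd * x * (k%:~R * gauss1 dd k%:~R))).
have tD k (dd : R) : is_derive dd 1 (t k) (dt k dd).
  have xk : x - k%:~R != 0 by rewrite subr_eq0 xZ.
  rewrite /t /dt /f /gauss1; apply: trigger_derive; rewrite /GRing.scale/=.
  move: pi => p; field.
  exact: xk.
pose T dd N := fejer_sum (t^~ dd) N.
have TD N (dd : R) : is_derive dd 1 (T^~ N) (fejer_sum (dt^~ dd) N).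
  by apply: is_derive_fejer => k; exact: tD.
have dT N dd : 0 < dd -> 0 <= fejer_sum (dt^~ dd) N.
  move=> dd0; rewrite /dt fejer_sumZ mulr_ge0 ?expR_ge0// fejer_sumZ mulr_ge0 ?pi_ge0//.
  rewrite fejer_sumD (fejer_sum_odd _ (a := fun k => - _)) ?addr0 ?fejer_dgauss_ge0// => k.
  by rewrite mulrNz gauss1N; ring.
have T0 N : 0 <= T d N.
  have [c + H] : exists2 c, c \in `]0, d[%R & T d N - T 0 N = fejer_sum (dt^~ c) N * (d - 0).
    apply: MVT => //.
    apply: continuous_subspaceT => v; apply/differentiable_continuous/derivable1_diffP.
    exact: (@ex_derive _ _ _ _ _ _ _ (TD N v)).
  have T00 : T 0 N = 0.
    rewrite /T /t (@eq_fejer_sum _ _ (fun=> 0 * 0)) ?fejer_sumZ ?mul0r// => k.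
    rewrite /gauss1 /f !(mulr0,mul0r,oppr0,expR0,mul1r,addr0).
    by rewrite subrr.
  rewrite in_itv/= => /andP[c0 _]; move: H; rewrite T00 !subr0 => ->.
  by rewrite mulr_ge0 ?(ltW d0) ?dT.
have qT N : 0 <= expR (pi * d * x ^+ 2) * fejer_sum q N - fejer_sum f N.
  have := T0 N; rewrite /T /t (@eq_fejer_sum _ _ (fun k => expR (pi * d * x ^+ 2) * q k + -1 * f k)).
    by rewrite fejer_sumD !fejer_sumZ mulN1r.
  by move=> k; rewrite mulN1r.
pose s n := series (zpair f) n.+1.
(* Only a lower bound for the partial sums is at hand, so they are capped at [A]: the capped sums
   converge to [A], hence so do their Cesaro means, which lie below the Fejer means of [f]. *)
have minA : (fun n => Num.min (s n) A) @ \oo --> A.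
  apply/cvgrPdist_le => e e0; have := csc2_le_near xZ e0.
  rewrite -/A -/f => sA; near=> n.
  have : A - e <= s n.
    by near: n; case: sA => M _ hM; exists M => // k Mk; apply: hM; exact: leqW.
  move=> h; have [As|As] := leP A (s n); first by rewrite subrr normr0 ltW.
  by rewrite ger0_norm ?subr_ge0 ?(ltW As)//; lra.
have qm := fejer_mean_cvg qL.
have h : A <= expR (pi * d * x ^+ 2) * L.
  have c1 := cesaro minA.
  have c2 : (fun N => expR (pi * d * x ^+ 2) * (N.+1%:R^-1 * fejer_sum q N.+1)) @ \oo -->
     expR (pi * d * x ^+ 2) * L by exact: cvgMr.
  apply: (ler_cvg_to c1 c2).
  apply: nearW => N; rewrite /arithmetic_mean mulrCA ler_pM2l ?invr_gt0//.
  have := qT N.+1; rewrite subr_ge0 => /(le_trans _); apply.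
  rewrite fejer_sumE; apply: ler_sum => i _.
  by rewrite ge_min lexx.
rewrite mulrC -ler_pdivlMr ?gauss1_gt0//; apply: le_trans h _.
rewrite /gauss1 -expRN (_ : - (- d * pi * x ^+ 2) = pi * d * x ^+ 2); last by ring.
by rewrite mulrC.
Unshelve. all: end_near. Qed.

End CosecantSquared.

(** * Cosine transforms of compactly supported functions *)

Section ProductIntegral.
Context d1 d2 (T1 : measurableType d1) (T2 : measurableType d2) (R : realType).
Variables (m1 : {sigma_finite_measure set T1 -> \bar R})
          (m2 : {sigma_finite_measure set T2 -> \bar R}).

Lemma EFin_Rintegral d (T : measurableType d) (mu : {measure set T -> \bar R})
    D (f : T -> R) : measurable D -> mu.-integrable D (EFin \o f) ->
  (\int[mu]_(x in D) f x)%:E = (\int[mu]_(x in D) (f x)%:E)%E.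
Proof. by move=> mD fi; rewrite fineK//; exact: integrable_fin_num. Qed.

Lemma integrable_prod (u : T1 -> R) (v : T2 -> R) :
  m1.-integrable setT (EFin \o u) -> m2.-integrable setT (EFin \o v) ->
  (m1 \x m2)%E.-integrable setT (EFin \o (fun z => u z.1 * v z.2)).
Proof.
move=> ui vi.
have mu' : measurable_fun setT u by exact/measurable_EFinP/(measurable_int m1).
have mv' : measurable_fun setT v by exact/measurable_EFinP/(measurable_int m2).
apply/integrable12ltyP.
  by apply/measurable_EFinP; apply: measurable_funM; apply: measurableT_comp.
have ie x : (\int[m2]_y `|(EFin \o (fun z => u z.1 * v z.2)%R) (x, y)|)%E =
    (`|(u x)%:E| * \int[m2]_y `|(v y)%:E|)%E.
  rewrite -ge0_integralZl//; last first.
    by apply: measurableT_comp => //; exact/measurable_EFinP.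
  by apply: eq_integral => y _ /=; rewrite -EFinM normrM.
under eq_integral do rewrite ie.
have /integrableP[_ uoo] := ui; have /integrableP[_ voo] := vi.
have vf : (\int[m2]_y `|(v y)%:E|)%E \is a fin_num.
  by rewrite ge0_fin_numE// integral_ge0.
rewrite -(fineK vf) ge0_integralZr//; last 2 first.
- by apply: measurableT_comp => //; exact/measurable_EFinP.
- by rewrite lee_fin fine_ge0// integral_ge0.
rewrite muleC lte_mul_pinfty//.
by rewrite lee_fin fine_ge0// integral_ge0.
Qed.

Lemma Rintegral_prod (u : T1 -> R) (v : T2 -> R) :
  m1.-integrable setT (EFin \o u) -> m2.-integrable setT (EFin \o v) ->
  \int[(m1 \x m2)%E]_z (u z.1 * v z.2) = \int[m1]_x u x * \int[m2]_y v y.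
Proof.
move=> ui vi; apply: EFin_inj; rewrite EFin_Rintegral//; last exact: integrable_prod.
rewrite -(integral12_prod_meas1 (integrable_prod ui vi)).
rewrite EFinM (EFin_Rintegral _ ui)// -(integralZr _ ui)//.
apply: eq_integral => x _; rewrite /fubini_F/= (EFin_Rintegral _ vi)//.
by rewrite -(integralZl _ vi).
Qed.

Lemma RFubini (F : T1 * T2 -> R) :
  (m1 \x m2)%E.-integrable setT (EFin \o F) ->
  (forall x, m2.-integrable setT (fun y => (F (x, y))%:E)) ->
  (forall y, m1.-integrable setT (fun x => (F (x, y))%:E)) ->
  \int[m1]_x (\int[m2]_y F (x, y)) = \int[m2]_y (\int[m1]_x F (x, y)).
Proof.
move=> Fi F2 F1; rewrite {1}/Rintegral [RHS]/Rintegral; congr fine.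
under eq_integral => x _ do rewrite (EFin_Rintegral _ (F2 x))//.
under [RHS]eq_integral => y _ do rewrite (EFin_Rintegral _ (F1 y))//.
exact: (Fubini Fi).
Qed.

End ProductIntegral.

(** * Integral and band limitation of a nonnegative cosine transform *)

Section Bandlimited.
Variable R : realType.
Notation mu := (@lebesgue_measure R).
Variables (Phi : R -> R) (B L a : R).
Hypothesis mPhi : measurable_fun setT Phi.
Hypothesis PhiB : forall t, `|Phi t| <= B * \1_(`[0, 1]) t.
Hypothesis PhiL : forall t, 0 <= t -> `|Phi t - Phi 0| <= L * t.
Hypothesis a0 : 0 < a.

(** [Phi] carries the right half of an even function supported in [[-1, 1]], hence the factor 2:
    this is the Fourier transform of the even extension. *)
Definition cos_transform x := \int[mu]_t (2 * Phi t * cos (2 * pi * x * t)).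

Let ind01 := \1_(`[0, 1]) : R -> R.

Let B0 : 0 <= B.
Proof.
have := PhiB 0; rewrite indicE mem_set ?mulr1.
  exact: le_trans.
by rewrite /= in_itv/= lexx ler01.
Qed.

Let iB c : mu.-integrable setT (EFin \o (fun t => c * ind01 t)).
Proof.
rewrite (_ : _ \o _ = fun t => c%:E * (ind01 t)%:E)%E//.
apply: integrableZl => //; exact: integrable_indic_itv.
Qed.

Let int_ind01 : \int[mu]_t ind01 t = 1.
Proof.
rewrite /Rintegral /ind01 integral_indic// setIT.
transitivity (fine (lebesgue_measure (`[0%R, 1%R]%classic : set R))) => //.
by rewrite lebesgue_measure_itv/= lte01 oppr0 adde0.
Qed.

Let measurable_coslin (c : R) (D : set R) : measurable_fun D (fun x : R => cos (c * x)).
Proof.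
apply: measurable_funTS; apply: continuous_measurable_fun => x.
apply: continuous_comp; last exact: continuous_cos.
by apply: cvgMr; exact: cvg_id.
Qed.

Let integrable_kernel x :
  mu.-integrable setT (EFin \o (fun t => 2 * Phi t * cos (2 * pi * x * t))).
Proof.
apply: (@integrable_le _ _ _ (fun t => (2 * B) * ind01 t)) => //.
- apply: measurable_funM; last exact: measurable_coslin.
  exact: measurable_funM.
- move=> t _; rewrite normrM -[leRHS]mulr1 ler_pM// ?cos_max//.
  by rewrite normrM normr_nat -mulrA ler_pM2l.
Qed.

Lemma continuous_cos_transform : continuous cos_transform.
Proof.
move=> x.
have xi : x \in `]x - 1, x + 1[.
  by rewrite in_itv/=; apply/andP; split; rewrite ?ltrDl ?ltrBlDr ?ltrDl.
apply: (@continuity_under_integral R _ _ mu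
  (fun x t => 2 * Phi t * cos (2 * pi * x * t)) setT measurableT (x - 1) (x + 1)
   _ _ (fun t => 2 * B * ind01 t) (iB _) _ x).
- by move=> y _; exact: integrable_kernel.
- apply: aeW => t _ y _.
  apply: cvgMr; apply: continuous_comp; last exact: continuous_cos.
  by apply: cvgMl; apply: cvgMr; exact: cvg_id.
- move=> y _; apply: aeW => t _; rewrite normrM -[leRHS]mulr1 ler_pM// ?cos_max//.
  by rewrite normrM normr_nat -mulrA ler_pM2l.
- by rewrite inE.
Qed.

Let f x := cos_transform (a * x).

Let mf D : measurable_fun D f.
Proof.
apply: measurable_funTS; apply: continuous_measurable_fun => x.
apply: (@continuous_comp _ _ _ (fun x => a * x) cos_transform).
  by apply: cvgMr; exact: cvg_id.
exact: continuous_cos_transform.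
Qed.

(** Fubini, which the Gaussian permits; a product-to-sum formula makes the inner integral two
    instances of [gauss_cos], at the frequencies [xi + a t] and [xi - a t]. *)
Lemma damped_cos_transform e xi al : 0 < e ->
  \int[mu]_x (gauss1 e x * cos (2 * pi * xi * x + al) * f x) =
  cos al * \int[mu]_t (Phi t * (gauss_hat e (xi + a * t) + gauss_hat e (xi - a * t))).
Proof.
move=> e0.
pose F (z : measurableTypeR R * measurableTypeR R) : R := gauss1 e z.1 * cos (2 * pi * xi * z.1 + al) *
  (2 * Phi z.2 * cos (2 * pi * (a * z.1) * z.2)).
have mcos : measurable_fun setT (@cos R).
  by apply: continuous_measurable_fun; exact: continuous_cos.
have mF : measurable_fun setT F.
  apply: measurable_funM; apply: measurable_funM.
  - by apply: measurableT_comp; [exact: measurable_gauss1|].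
  - apply: measurableT_comp => //; apply: measurable_funD => //.
    by apply: measurable_funM.
  - apply: measurable_funM => //; exact: measurableT_comp.
  - apply: measurableT_comp => //; apply: measurable_funM => //.
    by do 2 apply: measurable_funM => //.
have Fle z : `|F z| <= gauss1 e z.1 * (2 * B * ind01 z.2).
  rewrite /F normrM ler_pM//.
    rewrite normrM (ger0_norm (gauss1_ge0 _ _)).
    by rewrite ler_piMr ?gauss1_ge0// cos_max.
  rewrite normrM -[leRHS]mulr1 ler_pM// ?cos_max//.
  by rewrite normrM normr_nat -mulrA ler_pM2l.
have Gi := integrable_prod (m1 := mu) (m2 := mu) (integrable_gauss1 e0) (iB (2 * B)).
have Fi : (mu \x mu)%E.-integrable setT (EFin \o F).
  apply: (le_integrable _ _ _ Gi) => //; first exact/measurable_EFinP.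
  by move=> z _ /=; rewrite lee_fin; apply: le_trans (Fle z) _; rewrite ler_norm.
have F1 x : mu.-integrable setT (fun t => (F (x, t))%:E).
  rewrite /F/= (_ : (fun t => _) = fun t => (gauss1 e x * cos (2 * pi * xi * x + al))%:E *
    (2 * Phi t * cos (2 * pi * (a * x) * t))%:E)%E//.
  by apply: integrableZl => //; exact: integrable_kernel.
have aux (g p u v : R) : g * cos u * (2 * p * cos v) = p * (g * (cos (u + v) + cos (u - v))).
  by rewrite cosD cosB; ring.
have F2E t x : F (x, t) = Phi t * (gauss1 e x * cos (2 * pi * (xi + a * t) * x + al) +
     gauss1 e x * cos (2 * pi * (xi - a * t) * x + al)).
  rewrite /F/= -mulrDr.
  have -> : 2 * pi * (xi + a * t) * x + al = (2 * pi * xi * x + al) + 2 * pi * (a * x) * t by ring.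
  have -> : 2 * pi * (xi - a * t) * x + al = (2 * pi * xi * x + al) - 2 * pi * (a * x) * t by ring.
  exact: aux.
have gi c : mu.-integrable setT (fun x => (gauss1 e x * cos (2 * pi * c * x + al))%:E).
  apply: (@integrable_gauss1_bounded _ _ _ 1) => //; last by move=> x; exact: cos_max.
  exact: measurable_cos_affine.
have F2i t : mu.-integrable setT (EFin \o (fun x => gauss1 e x * cos (2 * pi * (xi + a * t) * x + al) +
     gauss1 e x * cos (2 * pi * (xi - a * t) * x + al))).
  by rewrite (_ : _ \o _ = (fun x => (gauss1 e x * cos (2 * pi * (xi + a * t) * x + al))%:E +
     (gauss1 e x * cos (2 * pi * (xi - a * t) * x + al))%:E)%E)//; apply: integrableD.
have F2 t : mu.-integrable setT (fun x => (F (x, t))%:E).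
  rewrite (_ : (fun x => _) = fun x => (Phi t)%:E * (gauss1 e x * cos (2 * pi * (xi + a * t) * x + al) +
     gauss1 e x * cos (2 * pi * (xi - a * t) * x + al))%:E)%E; last first.
    by apply/funext => x; rewrite F2E EFinM.
  exact: (integrableZl measurableT (Phi t) (F2i t)).
have := RFubini Fi F1 F2.
rewrite (_ : \int[mu]_x (\int[mu]_t F (x, t)) =
  \int[mu]_x (gauss1 e x * cos (2 * pi * xi * x + al) * f x)); last first.
  by apply: eq_Rintegral => x _; rewrite /F/= RintegralZl//; exact: integrable_kernel.
move=> ->.
have hatm (s : R) : measurable_fun setT (fun t : R => gauss_hat e (xi + s * t)).
  rewrite /gauss_hat; apply: measurable_funM => //.
  apply: measurableT_comp; first exact: measurable_gauss1.
  by apply: measurable_funD => //; exact: measurable_funM.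
have hat1 s : gauss_hat e s <= (Num.sqrt e)^-1.
  rewrite /gauss_hat ler_piMr ?invr_ge0 ?sqrtr_ge0// gauss1_le1// invr_ge0 ltW//.
have hat0 s : 0 <= gauss_hat e s by exact: gauss_hat_ge0.
rewrite -RintegralZl//; last first.
  apply: (@integrable_le _ _ _ (fun t => B * (Num.sqrt e)^-1 *+ 2 * ind01 t)) => //.
    apply: measurable_funM => //; apply: measurable_funD => //.
    rewrite (_ : (fun t => gauss_hat e (xi - a * t)) = fun t => gauss_hat e (xi + - a * t)).
      exact: hatm.
    by apply/funext => t; rewrite mulNr.
  move=> t _; rewrite normrM (ger0_norm (addr_ge0 _ _))//.
  rewrite [leRHS](_ : _ = B * ind01 t * ((Num.sqrt e)^-1 + (Num.sqrt e)^-1)); last by ring.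
  by rewrite ler_pM// ?addr_ge0// lerD.
apply: eq_Rintegral => t _.
under eq_Rintegral do rewrite F2E.
rewrite RintegralZl// RintegralD//; try exact: gi.
by rewrite !gauss_cos// -mulrDl; ring.
Qed.

Let gh_le (e s : R) : 0 < e -> 0 < s -> gauss_hat e s <= Num.sqrt e * (pi * s ^+ 2)^-1.
Proof.
move=> e0 s0; rewrite /gauss_hat; have se0 : 0 < Num.sqrt e by rewrite sqrtr_gt0.
rewrite ler_pdivrMl//; apply: le_trans (gauss1_le_inv _ s0) _; first by rewrite invr_gt0.
rewrite [leRHS](_ : _ = Num.sqrt e ^+ 2 * (pi * s ^+ 2)^-1); last by ring.
by rewrite sqr_sqrtr ?(ltW e0)// -mulrA invfM invrK.
Qed.

Let gh_mono (e s r : R) : 0 < e -> 0 <= r -> r <= `|s| -> gauss_hat e s <= gauss_hat e r.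
Proof.
move=> e0 r0 rs; rewrite /gauss_hat ler_wpM2l ?invr_ge0 ?sqrtr_ge0//.
rewrite /gauss1 ler_expR -!mulrA !mulNr lerN2 !ler_wpM2l ?invr_ge0 ?pi_ge0 ?(ltW e0)//.
by rewrite -(real_normK (num_real s)) ler_pXn2r// nnegrE.
Qed.

(* A Gaussian factor makes Fubini applicable to the integral over the line; it
   is removed by monotone convergence, hence the hypothesis [f_ge0] below. *)
Let eps n : R := n.+1%:R^-1.

Let eps_gt0 n : 0 < eps n. Proof. by rewrite invr_gt0. Qed.

Let cvg_sqrt_eps : (fun n => Num.sqrt (eps n)) @ \oo --> (0 : R).
Proof.
rewrite -sqrtr0; apply: continuous_cvg; first exact: sqrt_continuous.
exact: cvg_harmonic.
Qed.

Let cvg_gauss_eps (x : R) : (fun n => gauss1 (eps n) x) @ \oo --> (1 : R).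
Proof.
rewrite -expR0; apply: continuous_cvg; first exact: continuous_expR.
rewrite [X in X @ _ --> _](_ : _ = fun n => (- pi * x ^+ 2) * eps n).
  by rewrite -[X in _ --> X](mulr0 (- pi * x ^+ 2)); apply: cvgMr; exact: cvg_harmonic.
by apply/funext => n; ring.
Qed.

Let mhat (e s c : R) : measurable_fun setT (fun t => gauss_hat e (s + c * t)).
Proof.
rewrite /gauss_hat; apply: measurable_funM => //.
apply: measurableT_comp; first exact: measurable_gauss1.
by apply: measurable_funD => //; exact: measurable_funM.
Qed.

(** For [t] in [[0, 1]] the frequencies [xi + a t] and [xi - a t] stay at distance at least
    [|xi| - a] from 0, where [gauss_hat e] is [O(sqrt e)]. *)
Let damped_bound (e xi al : R) : 0 < e -> a < `|xi| ->
  `|\int[mu]_x (gauss1 e x * cos (2 * pi * xi * x + al) * f x)| <=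
  Num.sqrt e * (2 * B / (pi * (`|xi| - a) ^+ 2)).
Proof.
move=> e0 axi; have r0 : 0 < `|xi| - a by rewrite subr_gt0.
rewrite damped_cos_transform// normrM.
set J := \int[mu]_t _.
apply: (@le_trans _ _ `|J|); first by rewrite ler_piMl// cos_max.
set G := gauss_hat e (`|xi| - a).
have hat0 s : 0 <= gauss_hat e s by exact: gauss_hat_ge0.
have ptw t : `|Phi t * (gauss_hat e (xi + a * t) + gauss_hat e (xi - a * t))| <=
    2 * B * G * ind01 t.
  rewrite normrM (ger0_norm (addr_ge0 _ _))//; have := PhiB t.
  rewrite -/ind01 /ind01 indicE; case: (boolP (t \in _)) => [|_]; last first.
    by rewrite !mulr0 normr_le0 => /eqP ->; rewrite normr0 mul0r.
  rewrite inE/= in_itv/= !mulr1 => /andP[t0 t1] Pt.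
  rewrite -mulrA mulrCA; apply: ler_pM => //; first by rewrite addr_ge0.
  rewrite mulr_natl mulr2n.
  have at1 : `|a * t| <= a.
    by rewrite normrM (gtr0_norm a0) (ger0_norm t0) ler_piMr// ltW.
  apply: lerD; apply: gh_mono => //; rewrite ?(ltW r0)//.
    by have := lerB_normD xi (a * t); lra.
  by have := lerB_dist xi (a * t); lra.
have mk : measurable_fun setT (fun t => Phi t * (gauss_hat e (xi + a * t) + gauss_hat e (xi - a * t))).
  apply: measurable_funM => //; apply: measurable_funD => //.
  rewrite (_ : (fun t => gauss_hat e (xi - a * t)) = fun t => gauss_hat e (xi + - a * t)).
    exact: mhat.
  by apply/funext => t; rewrite mulNr.
have ki : mu.-integrable setT (EFin \o (fun t => Phi t * (gauss_hat e (xi + a * t) + gauss_hat e (xi - a * t)))).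
  by apply: (integrable_le _ mk _ (iB (2 * B * G))).
apply: le_trans (le_normr_Rintegral _ ki) _ => //.
apply: le_trans (le_Rintegral _ _ (iB (2 * B * G)) _) _ => //.
  by have := integrable_norm ki.
rewrite RintegralZl//; last exact: integrable_indic_itv.
rewrite int_ind01 mulr1.
rewrite [leRHS](_ : _ = 2 * B * (Num.sqrt e * (pi * (`|xi| - a) ^+ 2)^-1)); last by ring.
by rewrite ler_wpM2l ?mulr_ge0// gh_le.
Qed.

Let Phi0 t : t < 0 -> Phi t = 0.
Proof.
move=> t0; have := PhiB t; rewrite indicE memNset ?mulr0 ?normr_le0 => [/eqP//|/=].
by rewrite in_itv/= leNgt t0.
Qed.

Let half_gauss (E : R) : 0 < E ->
  \int[mu]_t (gauss1 E t * \1_(`[0, +oo[) t) = (Num.sqrt E)^-1 / 2.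
Proof.
move=> E0; have H := Rintegral_gauss1 E0.
have i1 : mu.-integrable setT (EFin \o (fun t => gauss1 E t * \1_(`[0, +oo[) t)).
  by apply: (@integrable_gauss1_bounded _ _ _ 1) => // x; rewrite indicE; case: (_ \in _); rewrite ?normr1 ?normr0.
suff : \int[mu]_x gauss1 E x = 2 * \int[mu]_t (gauss1 E t * \1_(`[0, +oo[) t).
  by rewrite H => ->; rewrite mulrC mulKf.
apply: EFin_inj; rewrite EFinM !EFin_Rintegral//; last exact: integrable_gauss1.
rewrite ge0_symfun_integralT//.
- congr (_ * _)%E; rewrite [LHS]integral_mkcond; apply: eq_integral => t _.
  rewrite patchE indicE (_ : [set x | _] = `[0, +oo[%classic); last first.
    by apply/seteqP; split => x/=; rewrite in_itv/= andbT.
  by case: ifPn => _; rewrite ?mulr1 ?mulr0.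
- by move=> x; exact: gauss1_ge0.
- exact: continuous_gauss1.
- by move=> x /=; rewrite gauss1N.
Qed.

(** On the half-line [2 e^(-1/2) gauss1 (a^2 / e)] is an approximate identity of mass [1 / a] and
    width of order [sqrt e / a]; the Lipschitz bound of [Phi] at 0 turns the width into the
    error. *)
Let damped_value (e : R) : 0 < e ->
  `|\int[mu]_x (gauss1 e x * f x) - Phi 0 / a| <= Num.sqrt e * (4 * L / a ^+ 2).
Proof.
move=> e0; have E0 : 0 < a ^+ 2 / e by rewrite divr_gt0// exprn_gt0.
have se0 : 0 < Num.sqrt e by rewrite sqrtr_gt0.
have L0 : 0 <= L by have := PhiL ler01; rewrite mulr1; exact: le_trans.
have sE : Num.sqrt (a ^+ 2 / e) = a / Num.sqrt e.
  by rewrite sqrtrM ?sqr_ge0// sqrtrV ?ltW// sqrtr_sqr gtr0_norm.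
set ep := \1_(`[0, +oo[) : R -> R.
have mep : measurable_fun setT ep by rewrite /ep; exact: measurable_indic.
have -> : \int[mu]_x (gauss1 e x * f x) = \int[mu]_t (2 * (Num.sqrt e)^-1 * (gauss1 (a ^+ 2 / e) t * Phi t)).
  have := damped_cos_transform 0 0 e0; rewrite cos0 mul1r => H.
  transitivity (\int[mu]_x (gauss1 e x * cos (2 * pi * 0 * x + 0) * f x)).
    by apply: eq_Rintegral => x _; rewrite mulr0 mul0r addr0 cos0 mulr1.
  rewrite H; apply: eq_Rintegral => t _.
  rewrite add0r sub0r -mulrN !gauss_hatM gauss1N; ring.
have -> : Phi 0 / a = \int[mu]_t (2 * (Num.sqrt e)^-1 * (gauss1 (a ^+ 2 / e) t * (Phi 0 * ep t))).
  have i1 : mu.-integrable setT (EFin \o (fun t => gauss1 (a ^+ 2 / e) t * ep t)).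
    by apply: (@integrable_gauss1_bounded _ _ _ 1) => // x; rewrite /ep indicE; case: (_ \in _); rewrite ?normr1 ?normr0.
  transitivity (\int[mu]_t (2 * (Num.sqrt e)^-1 * Phi 0 * (gauss1 (a ^+ 2 / e) t * ep t))).
    rewrite RintegralZl// half_gauss// sE; field.
    by rewrite !gt_eqF.
  by apply: eq_Rintegral => t _; ring.
have i1 : mu.-integrable setT (EFin \o (fun t => 2 * (Num.sqrt e)^-1 * (gauss1 (a ^+ 2 / e) t * Phi t))).
  rewrite (_ : _ \o _ = fun t => (2 * (Num.sqrt e)^-1)%:E * (gauss1 (a ^+ 2 / e) t * Phi t)%:E)%E//.
  apply: integrableZl => //; apply: (@integrable_gauss1_bounded _ _ _ B) => // t.
  apply: le_trans (PhiB t) _; rewrite indicE; case: (_ \in _); rewrite ?mulr1 ?mulr0//.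
have i2 : mu.-integrable setT (EFin \o (fun t => 2 * (Num.sqrt e)^-1 * (gauss1 (a ^+ 2 / e) t * (Phi 0 * ep t)))).
  rewrite (_ : _ \o _ = fun t => (2 * (Num.sqrt e)^-1)%:E * (gauss1 (a ^+ 2 / e) t * (Phi 0 * ep t))%:E)%E//.
  apply: integrableZl => //; apply: (@integrable_gauss1_bounded _ _ _ `|Phi 0|) => //.
    by apply: measurable_funM.
  by move=> t; rewrite /ep indicE; case: (_ \in _); rewrite ?mulr1 ?mulr0 ?normr0.
rewrite -RintegralB//.
have i12 := integrableB measurableT i1 i2.
apply: le_trans (le_normr_Rintegral _ i12) _ => //.
have i3 : mu.-integrable setT (EFin \o (fun t => 2 * L / a * gauss1 (a ^+ 2 / e / 2) t)).
  rewrite (_ : _ \o _ = fun t => (2 * L / a)%:E * (gauss1 (a ^+ 2 / e / 2) t)%:E)%E//.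
  by apply: integrableZl => //; apply: integrable_gauss1; rewrite (divr_gt0 E0).
apply: (@le_trans _ _ (\int[mu]_t (2 * L / a * gauss1 (a ^+ 2 / e / 2) t))).
  apply: le_Rintegral => //.
    by have := integrable_norm i12.
  move=> t _; rewrite -mulrBr -mulrBr.
  have H : `|Phi t - Phi 0 * ep t| <= L * `|t|.
    rewrite /ep indicE; have [t0|t0] := leP 0 t.
      by rewrite mem_set ?mulr1 ?(ger0_norm t0) ?PhiL//= in_itv/= t0.
    rewrite memNset ?mulr0 ?Phi0 ?subr0 ?normr0 ?mulr_ge0//=.
    by rewrite in_itv/= leNgt t0.
  rewrite normrM (ger0_norm (_ : 0 <= 2 * (Num.sqrt e)^-1)); last by rewrite mulr_ge0// invr_ge0 ltW.
  rewrite normrM (ger0_norm (gauss1_ge0 _ _)).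
  have N := norm_mul_gauss1_le t E0.
  rewrite sE invf_div in N.
  apply: (@le_trans _ _ (2 * (Num.sqrt e)^-1 * (L * (`|t| * gauss1 (a ^+ 2 / e) t)))).
    rewrite ler_wpM2l ?mulr_ge0 ?invr_ge0 ?(ltW se0)//.
    by rewrite mulrA mulrC ler_wpM2r ?gauss1_ge0.
  apply: (@le_trans _ _ (2 * (Num.sqrt e)^-1 * (L * (Num.sqrt e / a * gauss1 (a ^+ 2 / e / 2) t)))).
    by rewrite ler_wpM2l ?mulr_ge0 ?invr_ge0 ?(ltW se0)// ler_wpM2l.
  rewrite le_eqVlt; apply/orP; left; apply/eqP; field.
  by rewrite !gt_eqF.
rewrite RintegralZl//; last by apply: integrable_gauss1; rewrite (divr_gt0 E0).
rewrite Rintegral_gauss1 ?(divr_gt0 E0)//.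
have -> : Num.sqrt (a ^+ 2 / e / 2) = a / Num.sqrt e / Num.sqrt 2.
  by rewrite sqrtrM ?(ltW E0)// sE sqrtrV.
have s2 : Num.sqrt 2 <= 2 :> R.
  rewrite -[leRHS](gtr0_norm (ltr0n R 2)) -sqrtr_sqr ler_wsqrtr// expr2.
  by rewrite -natrM ler_nat.
have s20 : 0 < Num.sqrt 2 :> R by rewrite sqrtr_gt0.
rewrite [leLHS](_ : _ = Num.sqrt e * (2 * L / a ^+ 2) * Num.sqrt 2); last first.
  by field; rewrite !gt_eqF.
rewrite [leRHS](_ : _ = Num.sqrt e * (2 * L / a ^+ 2) * 2); last by ring.
by rewrite ler_wpM2l// !mulr_ge0// ?invr_ge0 ?sqr_ge0 ?(ltW se0).
Qed.

Hypothesis f_ge0 : forall x, 0 <= cos_transform x.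

Let cvg_damped_value :
  (fun n => \int[mu]_x (gauss1 (eps n) x * f x)) @ \oo --> Phi 0 / a.
Proof.
apply/cvgrPdist_le => e e0; near=> n.
rewrite distrC; apply: le_trans (damped_value (eps_gt0 n)) _.
near: n.
have : (fun n => Num.sqrt (eps n) * (4 * L / a ^+ 2)) @ \oo --> (0 : R).
  by rewrite -[X in _ --> X](mul0r (4 * L / a ^+ 2)); apply: cvgMl; exact: cvg_sqrt_eps.
by move/cvgr_le; apply.
Unshelve. all: end_near. Qed.

Let f_bound x : `|f x| <= 2 * B.
Proof.
rewrite /f /cos_transform.
apply: le_trans (le_normr_Rintegral _ (integrable_kernel _)) _ => //.
apply: le_trans (le_Rintegral _ _ (iB (2 * B)) _) _ => //.
- by have := integrable_norm (integrable_kernel (a * x)).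
- move=> t _; rewrite normrM -[leRHS]mulr1 ler_pM// ?cos_max//.
  by rewrite normrM normr_nat -mulrA ler_pM2l.
rewrite RintegralZl//; last exact: integrable_indic_itv.
by rewrite int_ind01 mulr1.
Qed.

(** The damping increases to 1, so the damped integrals tend to the integral of [f], whether finite
    or not; [cvg_damped_value] then shows that it is finite. *)
Let integral_f : (\int[mu]_x (f x)%:E)%E = (Phi 0 / a)%:E.
Proof.
have gi n : mu.-integrable setT (EFin \o (fun x => gauss1 (eps n) x * f x)).
  by apply: (@integrable_gauss1_bounded _ (eps n) f (2 * B)) => //; exact: mf.
have h1 : (\int[mu]_x (gauss1 (eps n) x * f x)%:E)%E @[n --> \oo] --> (Phi 0 / a)%:E.
  rewrite (_ : (fun n => _) = fun n => (\int[mu]_x (gauss1 (eps n) x * f x))%:E).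
    by apply: cvg_EFin; [exact: nearW|exact: cvg_damped_value].
  by apply/funext => n; rewrite EFin_Rintegral.
have h2 : (\int[mu]_x (gauss1 (eps n) x * f x)%:E)%E @[n --> \oo] --> (\int[mu]_x (f x)%:E)%E.
  have := @cvg_monotone_convergence _ _ R mu setT measurableT
     (fun n x => (gauss1 (eps n) x * f x)%:E).
  move=> /(_ _ _ _); rewrite (_ : (fun x => limn _) = EFin \o f).
    apply.
    - by move=> n; have /(measurable_int mu) := gi n.
    - by move=> n x _; rewrite lee_fin mulr_ge0 ?gauss1_ge0//; exact: f_ge0.
    - move=> x _ n m nm; rewrite lee_fin ler_wpM2r//; first exact: f_ge0.
      by apply: gauss1_le_param; rewrite lef_pV2 ?posrE// ler_nat ltnS.
  apply/funext => x; apply/cvg_lim => //.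
  apply: cvg_EFin; first exact: nearW.
  by rewrite -[X in _ --> X]mul1r; apply: cvgMl; exact: cvg_gauss_eps.
by rewrite -(cvg_lim _ h1)// (cvg_lim _ h2).
Qed.

Lemma integrable_cos_transform :
  mu.-integrable setT (EFin \o (fun x => cos_transform (a * x))).
Proof.
apply/integrableP; split; first by apply/measurable_EFinP; exact: mf.
under eq_integral => x _ do rewrite /= ger0_norm ?f_ge0//.
by rewrite integral_f ltry.
Qed.

Lemma Rintegral_cos_transform : \int[mu]_x cos_transform (a * x) = Phi 0 / a.
Proof. by rewrite /Rintegral integral_f. Qed.

(** The damped integrals tend to 0 by [damped_bound]; now that [f] is integrable, it dominates the
    damped integrands and the damping can be removed. *)
Lemma cos_transform_bandlimited xi al : a < `|xi| ->
  \int[mu]_x (cos_transform (a * x) * cos (2 * pi * xi * x + al)) = 0.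
Proof.
move=> axi.
pose g n x := gauss1 (eps n) x * cos (2 * pi * xi * x + al) * f x.
have h1 : (fun n => \int[mu]_x g n x) @ \oo --> (0 : R).
  apply/norm_cvg0P.
  have : (fun n => Num.sqrt (eps n) * (2 * B / (pi * (`|xi| - a) ^+ 2))) @ \oo --> (0 : R).
    rewrite -[X in _ --> X](mul0r (2 * B / (pi * (`|xi| - a) ^+ 2))).
    by apply: cvgMl; exact: cvg_sqrt_eps.
  apply: squeeze_cvgr; last exact: cvg_cst.
  by apply: nearW => n; rewrite normr_ge0/= damped_bound.
have mg n : measurable_fun setT (g n).
  apply: measurable_funM; last exact: mf.
  by apply: measurable_funM; [exact: measurable_gauss1|exact: measurable_cos_affine].
have mh : measurable_fun setT (fun x => f x * cos (2 * pi * xi * x + al)).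
  by apply: measurable_funM; [exact: mf|exact: measurable_cos_affine].
have [] := @dominated_convergence _ _ R mu setT measurableT
  (fun n x => (g n x)%:E) (fun x => (f x * cos (2 * pi * xi * x + al))%:E) (EFin \o f).
- by move=> n; apply/measurable_EFinP; exact: mg.
- exact/measurable_EFinP.
- apply: aeW => x _; apply: cvg_EFin; first exact: nearW.
  rewrite -[f x * _]mul1r (_ : fine \o _ = fun n => gauss1 (eps n) x * (f x * cos (2 * pi * xi * x + al))).
    by apply: cvgMl; exact: cvg_gauss_eps.
  by apply/funext => n; rewrite /= /g; ring.
- exact: integrable_cos_transform.
- apply: aeW => x n _; rewrite lee_fin /g normrM (ger0_norm (f_ge0 _)).
  rewrite ler_piMl ?f_ge0// normrM (ger0_norm (gauss1_ge0 _ _)).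
  by rewrite mulr_ile1 ?gauss1_ge0 ?cos_max// gauss1_le1// ltW.
move=> hi _ h2; apply: EFin_inj; rewrite EFin_Rintegral//.
have {}h2 : (\int[mu]_x (g n x)%:E)%E @[n --> \oo] --> (\int[mu]_x (f x * cos (2 * pi * xi * x + al))%:E)%E := h2.
rewrite -(cvg_lim _ h2)//; apply/cvg_lim => //.
rewrite (_ : (fun n => _) = fun n => (\int[mu]_x g n x)%:E).
  by apply: cvg_EFin; [exact: nearW|].
apply/funext => n; rewrite EFin_Rintegral//.
apply: (@integrable_le _ _ _ f) => //; last exact: integrable_cos_transform.
move=> x _; rewrite /g normrM (ger0_norm (f_ge0 _)).
rewrite ler_piMl ?f_ge0// normrM (ger0_norm (gauss1_ge0 _ _)).
by rewrite mulr_ile1 ?gauss1_ge0 ?cos_max// gauss1_le1// ltW.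
Qed.

End Bandlimited.

(** * The one-dimensional majorant on the real line *)

Section GaussSeries.
Variable R : realType.
Implicit Types (d x y t : R).

(** A single summable majorant for [g(k)], [k g(k)] and [k^2 g(k)]; the last occurs in the Lipschitz
    estimate of [phi] at 0. *)
Definition gauss_weight d (k : nat) : R := k.+1%:R ^+ 2 * gauss1 d k%:R.

Lemma gauss_weight_ge0 d k : 0 <= gauss_weight d k.
Proof. by rewrite mulr_ge0 ?gauss1_ge0// exprn_ge0. Qed.

Lemma is_cvg_gauss_weight d : 0 < d -> cvgn (series (gauss_weight d)).
Proof.
move=> d0; have pi0 := @pi_gt0 R.
(* With this [c] the Gaussian is [exp (- 4 c k^2) <= exp (- 4 c k)], while
   [(k + 1)^2 <= C^2 exp (2 c k)]; a geometric series of ratio [exp (- 2 c)] is left. *)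
pose c := pi * d / 4; have c0 : 0 < c by rewrite divr_gt0// mulr_gt0.
pose C := 1 + c^-1.
have C1 : 1 <= C by rewrite lerDl invr_ge0 ltW.
have kC (k : nat) : k.+1%:R <= C * expR (c * k%:R).
  apply: (@le_trans _ _ (C * (1 + c * k%:R))); last first.
    by rewrite ler_wpM2l ?expR_ge1Dx//; exact: le_trans C1.
  rewrite /C mulrDl mul1r mulrDr mulr1 mulKf ?gt_eqF// -addn1 natrD.
  have : 0 <= c^-1 by rewrite invr_ge0 ltW.
  have : 0 <= c * k%:R by rewrite mulr_ge0// ltW.
  lra.
apply: (@series_le_cvg _ _ (geometric (C ^+ 2) (expR (- (c * 2))))).
- exact: gauss_weight_ge0.
- by move=> n; rewrite geometric_ge0 ?expR_ge0 ?sqr_ge0.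
- move=> n; rewrite /geometric/= /gauss_weight -expRM_natl.
  apply: (@le_trans _ _ (C ^+ 2 * expR (c * n%:R) ^+ 2 * expR (- (c * 4 * n%:R)))).
    apply: ler_pM; rewrite ?exprn_ge0 ?gauss1_ge0//.
      by rewrite -exprMn ler_pXn2r ?nnegrE// mulr_ge0 ?expR_ge0//; exact: le_trans C1.
    rewrite /gauss1 ler_expR /c divfK// mulNr mulNr lerN2 (mulrC pi) ler_wpM2l//.
      by rewrite mulr_ge0 ?ltW.
    by rewrite -natrX ler_nat; case: n => // n; rewrite expn_gt0 || (by rewrite leq_pmulr).
  rewrite -mulrA ler_wpM2l ?sqr_ge0// -expRM_natl -expRD ler_expR.
  rewrite le_eqVlt; apply/orP; left; apply/eqP; ring.
- apply: is_cvg_geometric_series; rewrite ger0_norm ?expR_ge0//.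
  by rewrite -expR0 ltr_expR oppr_lt0 mulr_gt0.
Qed.

Lemma gauss1_le_weight d k : gauss1 d k%:R <= gauss_weight d k.
Proof.
by rewrite /gauss_weight ler_peMl ?gauss1_ge0// exprn_ege1// ler1n.
Qed.

Lemma mul_gauss1_le_weight d k : k%:R * gauss1 d k%:R <= gauss_weight d k.
Proof.
rewrite /gauss_weight ler_wpM2r ?gauss1_ge0// -natrX ler_nat.
by rewrite (leq_trans (leqnSn k))// leq_pmulr.
Qed.

Lemma sqr_mul_gauss1_le_weight d k : k%:R ^+ 2 * gauss1 d k%:R <= gauss_weight d k.
Proof.
by rewrite /gauss_weight ler_wpM2r ?gauss1_ge0// ler_pXn2r ?nnegrE// ler_nat.
Qed.

Lemma normr_series_le (u v : R^nat) l m :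
  (forall k, `|u k| <= v k) -> series u @ \oo --> l -> series v @ \oo --> m -> `|l| <= m.
Proof.
move=> uv ul vm; apply: (ler_cvg_to (cvg_norm ul) vm); apply: nearW => n.
by apply: le_trans (ler_norm_sum _ _ _) _; apply: ler_sum.
Qed.

Lemma is_cvg_series_norm_le (u v : R^nat) :
  (forall k, `|u k| <= v k) -> cvgn (series v) -> cvgn (series u).
Proof.
move=> uv cv; apply: normed_cvg; apply: series_le_cvg cv => //.
- by move=> n; exact: normr_ge0.
- by move=> n; exact: le_trans (uv n).
Qed.

Lemma normr_sin_le x : `|sin x| <= `|x|.
Proof.
wlog x0 : x / 0 < x => [hw|].
  have [|x0|->] := ltgtP x 0; last by rewrite sin0.
    by rewrite -oppr_gt0 => /hw; rewrite sinN !normrN.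
  exact: hw.
have [] := @MVT R sin cos 0 x x0.
- by apply: continuous_subspaceT => v; exact: continuous_sin.
move=> c _; rewrite sin0 !subr0 => ->.
by rewrite normrM ler_piMl// cos_max.
Qed.

Lemma normr_1Bcos_le x : `|1 - cos x| <= `|x|.
Proof.
wlog x0 : x / 0 < x => [hw|].
  have [|x0|->] := ltgtP x 0; last by rewrite cos0 subrr.
    by rewrite -oppr_gt0 => /hw; rewrite cosN normrN.
  exact: hw.
have [] := @MVT R cos (fun x => - sin x) 0 x x0.
- by apply: continuous_subspaceT => v; exact: continuous_cos.
move=> c _; rewrite cos0 !subr0 distrC => ->.
by rewrite normrM normrN ler_piMl// sin_max.
Qed.

End GaussSeries.

(** * The extremal function as a cosine transform *)

Section Interpolant.
Variable R : realType.
Notation mu := (@lebesgue_measure R).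
Variable d : R.
Hypothesis d0 : 0 < d.
Implicit Types (x y t : R) (k n : nat).

Let ind01 := \1_(`[0, 1]) : R -> R.

(** The double poles contribute the modulated [1 - t]. The simple poles contribute the sine, with
    coefficient [d * k], because [g'(k) = - 2 pi d k g(k)] and [sin (pi y)^2 / (pi y)] is the
    integral of [sin (2 pi y t)] over [[0, 1]]. *)
Let kernel01 k t : R := (1 - t) * cos (2 * pi * k%:R * t) + d * k%:R * sin (2 * pi * k%:R * t).

Definition phi_term k t : R :=
  if k == 0%N then 1 - t else 2 * gauss1 d k%:R * kernel01 k t.

(* The restriction to [0, 1] of the (even) Fourier transform of [m_delta d]: the Fejer
   kernel [(sin (pi * z) / (pi * z)) ^+ 2] has transform [1 - t] on [0, 1], and
   the nodes [k] and [- k] of [m_delta d] are paired in [kernel01 k]. *)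
Definition phi t : R := limn (series (phi_term ^~ t)) * ind01 t.

Let Bc := 2 * (1 + d).
Let Lc := 2 * (1 + 2 * pi + 2 * pi * d).

Let phi_term_le k t : 0 <= t -> t <= 1 -> `|phi_term k t| <= Bc * gauss_weight d k.
Proof.
move=> t0 t1; rewrite /phi_term; case: eqP => [->|_].
  rewrite /gauss_weight /gauss1 expr0n mulr0 expR0 expr1n mulr1 mulr1 ger0_norm ?subr_ge0//.
  by rewrite /Bc; have := d0; lra.
rewrite normrM ger0_norm ?mulr_ge0 ?gauss1_ge0// /Bc -!mulrA ler_pM2l//.
have g1 := gauss1_le_weight d k; have g2 := mul_gauss1_le_weight d k.
apply: (@le_trans _ _ (gauss1 d k%:R * (1 + d * k%:R))); last first.
  by have := d0; nra.
rewrite ler_wpM2l ?gauss1_ge0//; apply: le_trans (ler_normD _ _) _; apply: lerD.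
  by rewrite normrM ger0_norm ?subr_ge0// mulr_ile1 ?subr_ge0 ?cos_max//; lra.
rewrite normrM ger0_norm ?mulr_ge0 ?(ltW d0)//.
by rewrite ler_piMr ?sin_max// mulr_ge0 ?(ltW d0).
Qed.

Lemma phi_term0 k : phi_term k 0 = zpair (fun k : int => gauss1 d k%:~R) k.
Proof.
rewrite /phi_term; case: k => [|k]/=.
  by rewrite subr0 /gauss1 expr0n mulr0 expR0.
rewrite /kernel01 mulr0 cos0 sin0 !mulr0 addr0 subr0 mulr1.
rewrite mulrNz gauss1N mulr1; ring.
Qed.

Let phi_term_lip k t : 0 <= t -> t <= 1 ->
  `|phi_term k t - phi_term k 0| <= (Lc * t) * gauss_weight d k.
Proof.
move=> t0 t1; have pi0 := @pi_gt0 R; rewrite /phi_term; case: eqP => [->|_].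
  rewrite /gauss_weight /gauss1 expr0n mulr0 expR0 expr1n mulr1 mulr1 subr0.
  rewrite (_ : 1 - t - 1 = - t); last by ring.
  rewrite normrN ger0_norm// ler_peMl// /Lc.
  by have := d0; nra.
rewrite -mulrBr normrM ger0_norm ?mulr_ge0 ?gauss1_ge0//.
rewrite /kernel01 mulr0 cos0 sin0 mulr0 addr0 subr0 mulr1.
have g1 := gauss1_le_weight d k; have g2 := mul_gauss1_le_weight d k.
have g3 := sqr_mul_gauss1_le_weight d k.
have k0 : 0 <= k%:R :> R by [].
have u0 : 0 <= 2 * pi * k%:R * t by rewrite !mulr_ge0// ltW.
set G := gauss1 d k%:R in g1 g2 g3 *.
have G0 : 0 <= G by exact: gauss1_ge0.
apply: (@le_trans _ _ (2 * G * (t * (1 + 2 * pi * k%:R + 2 * pi * d * k%:R ^+ 2)))).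
  rewrite ler_wpM2l ?mulr_ge0//.
  rewrite (_ : _ - 1 = - (t * cos (2 * pi * k%:R * t)) + - (1 - cos (2 * pi * k%:R * t)) +
     d * k%:R * sin (2 * pi * k%:R * t)); last by ring.
  rewrite [leRHS](_ : _ = t + 2 * pi * k%:R * t + d * k%:R * (2 * pi * k%:R * t)); last by ring.
  apply: le_trans (ler_normD _ _) _; apply: lerD.
    apply: le_trans (ler_normD _ _) _; rewrite !normrN; apply: lerD.
      by rewrite normrM (ger0_norm t0) ler_piMr ?cos_max.
    by apply: le_trans (normr_1Bcos_le _) _; rewrite ger0_norm.
  rewrite normrM ger0_norm ?mulr_ge0 ?(ltW d0)//.
  rewrite ler_wpM2l ?mulr_ge0 ?(ltW d0)//.
  by apply: le_trans (normr_sin_le _) _; rewrite ger0_norm.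
rewrite [leLHS](_ : _ = 2 * t * (G + 2 * pi * (k%:R * G) + 2 * pi * d * (k%:R ^+ 2 * G))); last by ring.
rewrite [leRHS](_ : _ = 2 * t * (gauss_weight d k + 2 * pi * gauss_weight d k + 2 * pi * d * gauss_weight d k)); last first.
  by rewrite /Lc; ring.
rewrite ler_wpM2l ?mulr_ge0//; apply: lerD; first apply: lerD => //.
  by rewrite ler_wpM2l// mulr_ge0// ltW.
by rewrite ler_wpM2l// !mulr_ge0// ltW.
Qed.

Let cvgZ c : series (fun k => c * gauss_weight d k) @ \oo --> c * limn (series (gauss_weight d)).
Proof.
rewrite (_ : series _ = fun n => c * series (gauss_weight d) n).
  by apply: cvgMr; exact: is_cvg_gauss_weight.
by apply/funext => n; rewrite /series/= mulr_sumr.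
Qed.

Let is_cvg_phi t : 0 <= t -> t <= 1 -> cvgn (series (phi_term ^~ t)).
Proof.
move=> t0 t1; apply: (is_cvg_series_norm_le (fun k => phi_term_le k t0 t1)).
by apply/cvg_ex; eexists; exact: cvgZ.
Qed.

Let measurable_phi_term k : measurable_fun setT (phi_term k).
Proof.
apply: continuous_measurable_fun => t.
have dk : derivable (phi_term k) t 1; last exact/differentiable_continuous/derivable1_diffP.
by rewrite /phi_term/kernel01; case: eqP => _; apply: ex_derive.
Qed.

Let series_ind t : (series (phi_term ^~ t) n * ind01 t) @[n --> \oo] --> phi t.
Proof.
rewrite /phi; have [t01|t01] := boolP (t \in `[0, 1]%classic).
  apply: cvgMl; move: t01; rewrite inE/= in_itv/= => /andP[]; exact: is_cvg_phi.
rewrite /ind01 indicE (negbTE t01) !mulr0; under eq_fun do rewrite mulr0.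
exact: cvg_cst.
Qed.

Let measurable_partial n : measurable_fun setT (fun t => series (phi_term ^~ t) n * ind01 t).
Proof.
apply: measurable_funM; last exact: measurable_indic.
rewrite /series/=; exact: measurable_sum.
Qed.

Lemma measurable_phi : measurable_fun setT phi.
Proof.
apply: (@measurable_fun_cvg _ _ R setT
   (fun n t => series (phi_term ^~ t) n * ind01 t)) => //.
Qed.

Let W := limn (series (gauss_weight d)).

Lemma normr_phi_le t : `|phi t| <= Bc * W * ind01 t.
Proof.
rewrite /phi normrM /ind01 indicE; case: (boolP (t \in _)); last by rewrite normr0 !mulr0.
rewrite inE/= in_itv/= normr1 !mulr1 => /andP[t0 t1].
apply: (@normr_series_le _ (phi_term ^~ t) (fun k => Bc * gauss_weight d k)).
- by move=> k; exact: phi_term_le.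
- exact: is_cvg_phi.
- exact: cvgZ.
Qed.

Lemma phi_lipschitz t : 0 <= t -> `|phi t - phi 0| <= (Lc * W + `|phi 0|) * t.
Proof.
move=> t0; have [t1|t1] := leP t 1.
  have W0 : 0 <= `|phi 0| * t by rewrite mulr_ge0.
  apply: (@le_trans _ _ (Lc * W * t)); last by rewrite mulrDl lerDl.
  rewrite /phi /ind01 !indicE !mem_set ?mulr1/= ?in_itv/= ?t0 ?lexx ?ler01//.
  have c0 := is_cvg_phi (lexx 0) ler01; have ct := is_cvg_phi t0 t1.
  rewrite mulrAC.
  apply: (@normr_series_le _ (fun k => phi_term k t - phi_term k 0) (fun k => Lc * t * gauss_weight d k)); last exact: cvgZ.
    by move=> k; exact: phi_term_lip.
  rewrite (_ : series _ = fun n => series (phi_term^~ t) n - series (phi_term^~ 0) n).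
    exact: cvgB ct c0.
  by apply/funext => n; rewrite /series/= sumrB.
(* For [t > 1] the difference is [|phi 0| <= |phi 0| * t], which explains the second summand of the
   constant. *)
have -> : phi t = 0.
  by rewrite /phi /ind01 indicE memNset ?mulr0//= in_itv/= t0/= leNgt t1.
rewrite sub0r normrN mulrDl.
have W0 : 0 <= W.
  rewrite /W; apply: limr_ge; first exact: is_cvg_gauss_weight.
  by apply: nearW => n; apply: sumr_ge0 => k _; exact: gauss_weight_ge0.
apply: (@le_trans _ _ (`|phi 0| * t)); first by rewrite ler_peMr// ltW.
rewrite lerDr !mulr_ge0//; have := d0; have := @pi_gt0 R; nra.
Qed.

Lemma phi0E : phi 0 = limn (series (zpair (fun k : int => gauss1 d k%:~R))).
Proof.
rewrite /phi /ind01 indicE mem_set ?mulr1/= ?in_itv/= ?lexx ?ler01//.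
by congr (limn (series _)); apply/funext => k; exact: phi_term0.
Qed.

Let T k x := \int[mu]_t (2 * (phi_term k t * ind01 t) * cos (2 * pi * x * t)).

Let iT k x : mu.-integrable setT (EFin \o (fun t => 2 * (phi_term k t * ind01 t) * cos (2 * pi * x * t))).
Proof.
have ii : mu.-integrable setT (EFin \o (fun t => 2 * (Bc * gauss_weight d k) * ind01 t)).
  rewrite (_ : _ \o _ = fun t => (2 * (Bc * gauss_weight d k))%:E * (ind01 t)%:E)%E//.
  apply: integrableZl => //; exact: integrable_indic_itv.
apply: (integrable_le _ _ _ ii) => //.
  apply: measurable_funM.
    by apply: measurable_funM => //; apply: measurable_funM => //; exact: measurable_indic.
  have := @measurable_cos_affine R (2 * pi * x) 0 setT.
  by under eq_fun do rewrite addr0.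
move=> t _; rewrite normrM -[leRHS]mulr1 ler_pM ?cos_max//.
rewrite normrM normr_nat -mulrA ler_pM2l// normrM.
rewrite /ind01 indicE; case: (boolP (t \in _)); last by rewrite normr0 !mulr0.
by rewrite inE/= in_itv/= normr1 !mulr1 => /andP[t0 t1]; exact: phi_term_le.
Qed.

Lemma cvg_cos_transform_phi x :
  series (T ^~ x) @ \oo --> cos_transform phi x.
Proof.
have ii : mu.-integrable setT (EFin \o (fun t => 2 * (Bc * W) * ind01 t)).
  rewrite (_ : _ \o _ = fun t => (2 * (Bc * W))%:E * (ind01 t)%:E)%E//.
  apply: integrableZl => //; exact: integrable_indic_itv.
pose g n t := 2 * (series (phi_term ^~ t) n * ind01 t) * cos (2 * pi * x * t).
have mc : measurable_fun setT (fun t : R => cos (2 * pi * x * t)).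
  have := @measurable_cos_affine R (2 * pi * x) 0 setT.
  by under eq_fun do rewrite addr0.
have gle n t : `|g n t| <= 2 * (Bc * W) * ind01 t.
  rewrite /g normrM -[leRHS]mulr1 ler_pM ?cos_max//.
  rewrite normrM normr_nat -mulrA ler_pM2l// normrM.
  rewrite /ind01 indicE; case: (boolP (t \in _)); last by rewrite normr0 !mulr0.
  rewrite inE/= in_itv/= normr1 !mulr1 => /andP[t0 t1].
  apply: le_trans (ler_norm_sum _ _ _) _.
  apply: (@le_trans _ _ (series (fun k => Bc * gauss_weight d k) n)).
    by apply: ler_sum => k _; exact: phi_term_le.
  have -> : Bc * W = limn (series (fun k => Bc * gauss_weight d k)).
    by apply/esym/cvg_lim => //; exact: cvgZ.
  apply: nondecreasing_cvgn_le.
    apply/nondecreasing_seqP => k; rewrite /series/= big_nat_recr//= lerDl.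
    by rewrite mulr_ge0 ?gauss_weight_ge0// /Bc; have := d0; lra.
  by apply/cvg_ex; eexists; exact: cvgZ.
have mg n : measurable_fun setT (g n).
  by apply: measurable_funM => //; apply: measurable_funM.
have ig n : mu.-integrable setT (EFin \o g n).
  by apply: (integrable_le _ (mg n) _ ii) => // t _; exact: gle.
have mphi : measurable_fun setT (fun t => 2 * phi t * cos (2 * pi * x * t)).
  by apply: measurable_funM => //; apply: measurable_funM => //; exact: measurable_phi.
have [] := @dominated_convergence _ _ R mu setT measurableT
  (fun n t => (g n t)%:E) (fun t => (2 * phi t * cos (2 * pi * x * t))%:E)
  (fun t => (2 * (Bc * W) * ind01 t)%:E).
- by move=> n; apply/measurable_EFinP; exact: mg.
- exact/measurable_EFinP.
- apply: aeW => t _; apply: cvg_EFin; first exact: nearW.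
  by apply: cvgMl; apply: cvgMr; exact: series_ind.
- exact: ii.
- by apply: aeW => t n _; rewrite lee_fin.
move=> hi _ h.
have {}h : (\int[mu]_t (g n t)%:E)%E @[n --> \oo] --> (\int[mu]_t (2 * phi t * cos (2 * pi * x * t))%:E)%E := h.
move: h; rewrite -EFin_Rintegral// (_ : (fun n => _) = fun n => (series (T ^~ x) n)%:E).
  by move/fine_cvgP => [_ h2]; exact: h2.
apply/funext => n; rewrite -EFin_Rintegral//; congr EFin.
rewrite /series/= -Rintegral_sum//.
by apply: eq_Rintegral => t _; rewrite /g /series/= mulr_suml mulr_sumr mulr_suml.
Qed.


(** Up to constants [C1] and [S1] are [sin (pi y)^2 / y^2] and [sin (pi y)^2 / y] ([C1E], [S1E]),
    the contributions of a double and of a simple pole at one node. *)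
Let C1 y := \int[mu]_(t in `[0, 1]) ((1 - t) * cos (2 * pi * y * t)).
Let S1 y := \int[mu]_(t in `[0, 1]) sin (2 * pi * y * t).

Let FTC01 (f F : R -> R) : continuous f -> (forall t : R, is_derive t 1 F (f t)) ->
  \int[mu]_(t in `[0, 1]) f t = F 1 - F 0.
Proof.
move=> cf dF; rewrite /Rintegral (@continuous_FTC2 R f F 0 1)//.
- by apply: continuous_subspaceT.
- have cF t : {for t, continuous F}.
    apply/differentiable_continuous/derivable1_diffP.
    exact: (@ex_derive _ _ _ _ _ _ _ (dF t)).
  split.
  + by move=> x _; exact: (@ex_derive _ _ _ _ _ _ _ (dF x)).
  + by apply: cvg_at_right_filter; exact: cF.
  + by apply: cvg_at_left_filter; exact: cF.
- by move=> x _; rewrite derive1E; exact: (@derive_val _ _ _ _ _ _ _ (dF x)).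
Qed.

Let derivable_cont (f : R -> R) : (forall t : R, derivable f t 1) -> continuous f.
Proof. by move=> df t; apply/differentiable_continuous/derivable1_diffP. Qed.

Let cC1 y : continuous (fun t : R => (1 - t) * cos (2 * pi * y * t)).
Proof. by apply: derivable_cont => t; apply: ex_derive. Qed.

Let cS1 y : continuous (fun t : R => sin (2 * pi * y * t)).
Proof. by apply: derivable_cont => t; apply: ex_derive. Qed.

Let i01 (f : R -> R) : continuous f -> mu.-integrable `[0, 1] (EFin \o f).
Proof.
move=> cf; apply: continuous_compact_integrable; first exact: segment_compact.
exact: continuous_subspaceT.
Qed.

Let C1_0 : C1 0 = 2^-1.
Proof.
rewrite /C1; under eq_Rintegral do rewrite mulr0 mul0r cos0 mulr1.
have cf : continuous (fun t : R => 1 - t) by apply: derivable_cont => t; apply: ex_derive.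
have dF t : is_derive t 1 (fun t : R => t - t ^+ 2 / 2) (1 - t).
  by apply: trigger_derive; rewrite /GRing.scale/=; field.
by rewrite (FTC01 cf dF) expr1n expr0n/= mul0r !subr0; lra.
Qed.

Let S1_0 : S1 0 = 0.
Proof.
rewrite /S1; under eq_Rintegral do rewrite mulr0 mul0r sin0.
by rewrite Rintegral_cst// mul0r.
Qed.

Let cos2pi_sin y : 1 - cos (2 * pi * y) = 2 * sin (pi * y) ^+ 2.
Proof.
rewrite (_ : 2 * pi * y = (pi * y) *+ 2); last by rewrite mulr2n; ring.
by rewrite cos_mulr2n cos2sin2; ring.
Qed.

Let C1E y : y != 0 -> C1 y = sin (pi * y) ^+ 2 / (2 * pi ^+ 2 * y ^+ 2).
Proof.
move=> y0; have pin0 : pi != 0 :> R by rewrite gt_eqF// pi_gt0.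
have dF t : is_derive t 1 (fun t => (1 - t) * sin (2 * pi * y * t) / (2 * pi * y) -
   cos (2 * pi * y * t) / (2 * pi * y) ^+ 2) ((1 - t) * cos (2 * pi * y * t)).
  apply: trigger_derive; rewrite /GRing.scale/=.
  by move: pi pin0 => p p0; field; rewrite p0 y0.
rewrite /C1 (FTC01 (@cC1 y) dF).
rewrite mulr1 mulr0 cos0 sin0 subrr mul0r mul0r mulr0 mul0r !sub0r opprK.
rewrite addrC -mulrBl cos2pi_sin.
by move: pi pin0 => p p0; field; rewrite p0 y0.
Qed.

Let S1E y : y != 0 -> S1 y = sin (pi * y) ^+ 2 / (pi * y).
Proof.
move=> y0; have pin0 : pi != 0 :> R by rewrite gt_eqF// pi_gt0.
have dF t : is_derive t 1 (fun t => - cos (2 * pi * y * t) / (2 * pi * y)) (sin (2 * pi * y * t)).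
  apply: trigger_derive; rewrite /GRing.scale/=.
  by move: pi pin0 => p p0; field; rewrite p0 y0.
rewrite /S1 (FTC01 (@cS1 y) dF).
rewrite mulr1 mulr0 cos0 -mulrBl opprK addrC cos2pi_sin.
by move: pi pin0 => p p0; field; rewrite p0 y0.
Qed.

Let T01 k x : T k x = \int[mu]_(t in `[0, 1]) (2 * phi_term k t * cos (2 * pi * x * t)).
Proof.
rewrite /T [RHS]Rintegral_mkcond; apply: eq_Rintegral => t _.
by rewrite patchE /ind01 indicE; case: ifPn => _; rewrite ?mulr1// !mulr0 mul0r.
Qed.

Let T0E x : T 0 x = 2 * C1 x.
Proof.
rewrite T01 /C1 -RintegralZl//; last by apply: i01; exact: cC1.
by apply: eq_Rintegral => t _; rewrite /phi_term eqxx mulrA.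
Qed.

Let TSE k x : T k.+1 x = 2 * gauss1 d k.+1%:R * (C1 (x - k.+1%:R) + C1 (x + k.+1%:R) +
   d * k.+1%:R * (S1 (x + k.+1%:R) - S1 (x - k.+1%:R))).
Proof.
rewrite T01 /C1 /S1; set K := k.+1%:R.
have aux (g p e A B : R) : 2 * (2 * g * (p * cos A + e * sin A)) * cos B =
    2 * g * (p * cos (B - A) + p * cos (B + A) + e * (sin (B + A) - sin (B - A))).
  by rewrite cosB cosD sinB sinD; ring.
have ic y := i01 (@cC1 y); have iS y := i01 (@cS1 y).
rewrite -RintegralD// -RintegralB// -RintegralZl//; last exact: (integrableB _ (iS _) (iS _)).
rewrite -RintegralD//; last 2 first.
- exact: (integrableD _ (ic _) (ic _)).
- exact: (integrableZl _ _ (integrableB _ (iS _) (iS _))).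
rewrite -RintegralZl//; last first.
  exact: (integrableD _ (integrableD _ (ic _) (ic _)) (integrableZl _ _ (integrableB _ (iS _) (iS _)))).
apply: eq_Rintegral => t _; rewrite /phi_term/= /kernel01 -/K.
rewrite (_ : 2 * pi * (x - K) * t = 2 * pi * x * t - 2 * pi * K * t); last by ring.
rewrite (_ : 2 * pi * (x + K) * t = 2 * pi * x * t + 2 * pi * K * t); last by ring.
exact: aux.
Qed.

Definition gauss_hermite x (k : int) := gauss1 d k%:~R / (x - k%:~R) ^+ 2 +
   - (2 * pi * d * k%:~R) * gauss1 d k%:~R / (x - k%:~R).

(** As [sin^2] has period [pi], all values of [C1] and [S1] at [x - k] and [x + k] share the factor
    [sin (pi x)^2]; what is left of [T k x] is the pair of interpolation terms at [k] and [- k]. *)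
Lemma cvg_gauss_hermite x : (forall k : int, x != k%:~R) ->
  series (zpair (gauss_hermite x)) @ \oo --> pi ^+ 2 / sin (pi * x) ^+ 2 * cos_transform phi x.
Proof.
move=> xZ; have pin0 : pi != 0 :> R by rewrite gt_eqF// pi_gt0.
have s0 := sinpi_neq0 xZ.
have shift (k : int) : sin (pi * (x + k%:~R)) ^+ 2 = sin (pi * x) ^+ 2.
  by rewrite mulrDr sin_sqrDintpi.
rewrite (_ : series _ = fun n => pi ^+ 2 / sin (pi * x) ^+ 2 * series (T ^~ x) n).
  by apply: cvgMr; exact: cvg_cos_transform_phi.
apply/funext => n; rewrite /series/= mulr_sumr; apply: eq_bigr => k _.
case: k => [|k]/=.
  rewrite T0E C1E; last by have := xZ 0.
  rewrite /gauss_hermite /gauss1 subr0 !(expr0n, mulr0, expR0, mul0r, oppr0, addr0)/=.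
  have x0 : x != 0 by have := xZ 0.
  move: pi pin0 s0 => p p0 s0; field.
  by rewrite s0 p0 x0.
have xm : x - k.+1%:R != 0 by rewrite subr_eq0; exact: (xZ k.+1).
have xp : x + k.+1%:R != 0.
  by rewrite addr_eq0; have := xZ (- k.+1%:Z); rewrite mulrNz.
rewrite TSE !C1E// !S1E// /gauss_hermite mulrNz opprK gauss1N.
have -> : sin (pi * (x - k.+1%:R)) ^+ 2 = sin (pi * x) ^+ 2.
  by have := shift (- k.+1%:Z); rewrite mulrNz.
have -> : sin (pi * (x + k.+1%:R)) ^+ 2 = sin (pi * x) ^+ 2 by exact: (shift k.+1).
rewrite -[k.+1%:~R]/(k.+1%:R).
move: pi pin0 s0 (k.+1%:R) xm xp => p p0 s0 K xm xp; field.
by rewrite s0 p0 xm xp.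
Qed.

Let sinpi_int (k : int) : sin (pi * k%:~R) ^+ 2 = 0 :> R.
Proof. by have := sin_sqrDintpi k (0 : R); rewrite add0r sin0 expr0n. Qed.

Let C1_int (k : int) : k != 0 -> C1 k%:~R = 0.
Proof. by move=> k0; rewrite C1E ?intr_eq0// sinpi_int mul0r. Qed.

Let S1_int (k : int) : S1 k%:~R = 0.
Proof.
have [->|k0] := eqVneq k 0; first exact: S1_0.
by rewrite S1E ?intr_eq0// sinpi_int mul0r.
Qed.

Let TS_int k (m : int) : T k.+1 m%:~R = 2 * gauss1 d k.+1%:R *
  (C1 (m - k.+1%:Z)%:~R + C1 (m + k.+1%:Z)%:~R).
Proof.
rewrite TSE -[k.+1%:R]/(k.+1%:Z%:~R) -intrB -intrD !S1_int subr0 mulr0 addr0.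
by [].
Qed.

(** [S1] vanishes at all integers and [C1] at all but 0, so only the term [k = |m|] of the series
    survives. *)
Lemma cos_transform_phi_int (m : int) : cos_transform phi m%:~R = gauss1 d m%:~R.
Proof.
have h := @cvg_cos_transform_phi (m%:~R : R).
rewrite -(cvg_lim _ h)//; apply/cvg_lim => //.
have E k : T k m%:~R = if k == `|m|%N then gauss1 d m%:~R else 0.
  case: k => [|k].
    rewrite T0E; case: eqP => [m0|m0].
      have -> : m = 0 by lia.
      by rewrite mulr0z C1_0 mulfV// /gauss1 expr0n mulr0 expR0.
    by rewrite C1_int ?mulr0//; lia.
  rewrite TS_int; case: eqP => [mk|mk]; last by rewrite !C1_int ?addr0 ?mulr0//; lia.
  have [m0|m0] := leP 0 m.
    rewrite (C1_int (_ : m + k.+1%:Z != 0)) ?addr0; last by lia.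
    have -> : m = k.+1%:Z by lia.
    by rewrite subrr C1_0; field.
  rewrite (C1_int (_ : m - k.+1%:Z != 0)) ?add0r; last by lia.
  have -> : m = - k.+1%:Z by lia.
  by rewrite addNr C1_0 mulrNz gauss1N; field.
apply: cvg_near_cst; exists `|m|.+1 => // n /= mn.
rewrite /series/= (eq_bigr _ (fun k _ => E k)) -big_mkcond/= big_mkord.
rewrite (big_pred1 (Ordinal mn))//.
Qed.

Lemma gauss1_le_cos_transform_phi x : gauss1 d x <= cos_transform phi x.
Proof.
have [[k ->]|xZ] := pselect (exists k : int, x = k%:~R).
  by rewrite cos_transform_phi_int.
have {}xZ (k : int) : x != k%:~R by apply/eqP => xk; apply: xZ; exists k.
have := gauss_interpolation_ge d0 xZ (cvg_gauss_hermite xZ).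
rewrite mulrC ler_pM2l// divr_gt0 ?(exprn_gt0 2 (pi_gt0 R))//.
by rewrite lt_neqAle sqr_ge0 eq_sym expf_neq0 ?sinpi_neq0.
Qed.

End Interpolant.

(** * Bilateral series and complex exponentials *)

Section ComplexModulus.
Variable R : realType.
Implicit Types z w : R[i].

(** The norm of [R[i]] takes its values in [R[i]]; this real-valued copy makes real arithmetic and
    order available. *)
Definition cabs z : R := complex.Re `|z|.

Lemma cabsE z : `|z| = (cabs z)%:C.
Proof. by rewrite /cabs normc_def. Qed.

Lemma cabs_ge0 z : 0 <= cabs z.
Proof. by rewrite -ler0c -cabsE. Qed.

Lemma cabsM z w : cabs (z * w) = cabs z * cabs w.
Proof. by apply: complexI; rewrite -cabsE normrM !cabsE rmorphM. Qed.

Lemma cabsX z n : cabs (z ^+ n) = cabs z ^+ n.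
Proof. by apply: complexI; rewrite -cabsE normrX !cabsE rmorphXn. Qed.

Lemma cabsV z : cabs z^-1 = (cabs z)^-1.
Proof. by apply: complexI; rewrite -cabsE normfV !cabsE fmorphV. Qed.

Lemma cabsN z : cabs (- z) = cabs z.
Proof. by apply: complexI; rewrite -!cabsE normrN. Qed.

Lemma cabsD z w : cabs (z + w) <= cabs z + cabs w.
Proof. by rewrite -lecR rmorphD/= -!cabsE ler_normD. Qed.

Lemma cabs_real (x : R) : cabs x%:C = `|x|.
Proof. by rewrite /cabs normc_def/= expr0n addr0 sqrtr_sqr. Qed.

Lemma cabs_eq0 z : (cabs z == 0) = (z == 0).
Proof. by rewrite -[z == 0]normr_eq0 cabsE eq_complex/= eqxx andbT. Qed.

Lemma cabs_i : cabs 'i%C = 1.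
Proof. by rewrite /cabs normc_def/= expr0n add0r expr1n sqrtr1. Qed.

Lemma cabs_sqr z : cabs z ^+ 2 = complex.Re z ^+ 2 + complex.Im z ^+ 2.
Proof. by rewrite /cabs normc_def/= sqr_sqrtr ?addr_ge0 ?sqr_ge0. Qed.

Lemma normr_Re_le z : `|complex.Re z| <= cabs z.
Proof.
rewrite -(@ler_pXn2r _ 2) ?nnegrE ?cabs_ge0// cabs_sqr real_normK ?num_real//.
by rewrite lerDl sqr_ge0.
Qed.

Lemma normr_Im_le z : `|complex.Im z| <= cabs z.
Proof.
rewrite -(@ler_pXn2r _ 2) ?nnegrE ?cabs_ge0// cabs_sqr real_normK ?num_real//.
by rewrite lerDr sqr_ge0.
Qed.

Lemma cabs_le z : cabs z <= `|complex.Re z| + `|complex.Im z|.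
Proof.
rewrite {1}(complexE z); apply: le_trans (cabsD _ _) _.
by rewrite cabsM cabs_i mul1r !cabs_real.
Qed.

Lemma cvg_realC (T : Type) (F : set_system T) (f : T -> R) (l : R) : Filter F ->
  f x @[x --> F] --> l -> ((f x)%:C : R[i]^o) @[x --> F] --> (l%:C : R[i]^o).
Proof.
move=> FF fl; apply/cvgrPdist_le => e; rewrite ltcE/= => /andP[/eqP e_im e0].
have -> : e = (complex.Re e)%:C by case: e e_im {e0} => a b /= ->.
move/cvgrPdist_le : fl => /(_ _ e0); apply: filterS => x.
by rewrite -rmorphB/= cabsE cabs_real lecR.
Qed.

Lemma cvg_complex (u : nat -> R[i]) (a b : R) :
  (fun n => complex.Re (u n)) @ \oo --> a -> (fun n => complex.Im (u n)) @ \oo --> b ->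
  (u : nat -> R[i]^o) @ \oo --> (a +i* b : R[i]^o).
Proof.
move=> ua ub; rewrite (complexE (a +i* b))/=.
rewrite (_ : u = fun n => (complex.Re (u n))%:C + 'i%C * (complex.Im (u n))%:C); last first.
  by apply/funext => n; rewrite -complexE.
apply: (@cvgD _ R[i]^o); first exact: cvg_realC.
by apply: (@cvgMr R[i]); exact: cvg_realC.
Qed.

Lemma lim_complex_unique (T : Type) (F : set_system T) (f : T -> R[i]^o) (l : R[i]^o) :
  ProperFilter F -> f x @[x --> F] --> l -> lim (f x @[x --> F]) = l.
Proof. by move=> FF; apply: cvg_lim; exact: norm_hausdorff. Qed.

End ComplexModulus.

Section BilateralSeries.
Variable R : realType.
Implicit Types (f : int -> R) (b : nat -> R).

Definition rzsum f : R :=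
  limn (series (fun n : nat => f n%:Z)) + limn (series (fun n : nat => f (- n.+1%:Z))).

Definition zsummable f := cvgn (series (fun n : nat => f n%:Z)) /\
  cvgn (series (fun n : nat => f (- n.+1%:Z))).

Lemma zsum_complex (f : int -> R[i]) :
  zsummable (fun k => complex.Re (f k)) -> zsummable (fun k => complex.Im (f k)) ->
  zsum f = rzsum (fun k => complex.Re (f k)) +i* rzsum (fun k => complex.Im (f k)).
Proof.
move=> [r1 r2] [i1 i2]; rewrite /zsum /rzsum.
have E (g : nat -> R[i]) n : complex.Re (series g n) = series (fun k => complex.Re (g k)) n /\
    complex.Im (series g n) = series (fun k => complex.Im (g k)) n.
  rewrite /series/=; elim: n => [|n [IH1 IH2]]; first by rewrite !big_geq.
  by rewrite !big_nat_recr//= -IH1 -IH2; case: (\sum_(0 <= k < n) g k) (g n) => [? ?] [? ?].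
have L (g : nat -> R[i]) : cvgn (series (fun k => complex.Re (g k))) ->
    cvgn (series (fun k => complex.Im (g k))) ->
    limn (series (g : nat -> R[i]^o)) = limn (series (fun k => complex.Re (g k))) +i*
       limn (series (fun k => complex.Im (g k))).
  move=> c1 c2; apply: lim_complex_unique; apply: cvg_complex.
    by rewrite (_ : (fun n => _) = series (fun k => complex.Re (g k)))//; apply/funext => n; case: (E g n).
  by rewrite (_ : (fun n => _) = series (fun k => complex.Im (g k)))//; apply/funext => n; case: (E g n).
by rewrite !L.
Qed.

Lemma zsum_real f : zsummable f -> zsum (fun k => (f k)%:C) = (rzsum f)%:C.
Proof.
move=> fs; rewrite zsum_complex//=.
  congr (_ +i* _); rewrite /rzsum.
  have -> : series (fun=> 0) = fun=> 0 :> R.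
    by apply/funext => n; rewrite /series/= big1.
  by rewrite lim_cst// addr0.
have -> : (fun=> 0) = fun=> 0 :> R by [].
split; rewrite (_ : series _ = fun=> 0); try exact: is_cvg_cst;
  by apply/funext => n; rewrite /series/= big1.
Qed.

Lemma cvg_zpair_rzsum f : zsummable f -> series (zpair f) @ \oo --> rzsum f.
Proof. by move=> [f1 f2]; exact: cvg_series_zpair. Qed.

Lemma zsummableD f g : zsummable f -> zsummable g ->
  zsummable (fun k => f k + g k) /\ rzsum (fun k => f k + g k) = rzsum f + rzsum g.
Proof.
move=> [f1 f2] [g1 g2]; split.
  by split; exact: is_cvg_seriesD.
rewrite /rzsum addrACA; congr (_ + _); exact: lim_seriesD.
Qed.

Let delta_zsum (k0 : int) (c : R) : let f := fun k => if k == k0 then c else 0 in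
  zsummable f /\ rzsum f = c.
Proof.
have near0 (u : nat -> R) (m : nat) (l : R) :
    (forall n, u n = if n == m then l else 0) -> series u @ \oo --> l.
  move=> uE; apply: cvg_near_cst; exists m.+1 => // n /= mn.
  rewrite /series/= (eq_bigr _ (fun k _ => uE k)) -big_mkcond/= big_mkord.
  by rewrite (big_pred1 (Ordinal mn)).
have zero (u : nat -> R) : (forall n, u n = 0) -> series u @ \oo --> (0 : R).
  move=> uE; apply: cvg_near_cst; apply: nearW => n.
  by rewrite /series/= big1.
move=> f; have [p q] : exists2 p : R * R, series (fun n : nat => f n%:Z) @ \oo --> p.1 /\
   series (fun n : nat => f (- n.+1%:Z)) @ \oo --> p.2 & p.1 + p.2 = c.
  have [k00|k00] := leP 0 k0.
    exists (c, 0); rewrite /= ?addr0//; split.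
      by apply: (near0 _ `|k0|%N) => n; rewrite /f; congr (if _ then _ else _); lia.
    by apply: zero => n; rewrite /f ifF//; lia.
  exists (0, c); rewrite /= ?add0r//; split.
    by apply: zero => n; rewrite /f ifF//; lia.
  by apply: (near0 _ `|k0|.-1%N) => n; rewrite /f; congr (if _ then _ else _); lia.
case: p q => [p1 p2] /= [h1 h2] <-; split.
  by split; apply/cvg_ex; eexists; eauto.
by rewrite /rzsum (cvg_lim _ h1)// (cvg_lim _ h2).
Qed.

(** In the applications [k0] is the integer near the argument, whose term may be arbitrarily large;
    it is split off as a one-term series. Each unilateral half of the rest costs one
    [limn (series b)]. *)
Lemma zsummable_bound f b (k0 : int) :
  (forall k, k != k0 -> `|f k| <= b `|k|%N) -> (forall n, 0 <= b n) ->
  cvgn (series b) -> zsummable f /\ `|rzsum f - f k0| <= 2 * limn (series b).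
Proof.
move=> fb b0 cb; pose f' k := if k == k0 then 0 else f k.
have f'b k : `|f' k| <= b `|k|%N.
  by rewrite /f'; case: eqP => [_|/eqP /fb//]; rewrite normr0.
have mono : nondecreasing_seq (series b).
  by apply/nondecreasing_seqP => k; rewrite /series/= big_nat_recr//= lerDl.
have cb' : cvgn (series (fun n => b n.+1)).
  have : series (fun n => b n.+1) = fun n => series b n.+1 - b 0.
    by apply/funext => n; rewrite /series/= big_nat_recl// addrC addrA addNr add0r.
  move=> ->; apply: is_cvgB; last exact: is_cvg_cst.
  by apply/cvg_ex; exists (limn (series b)); rewrite (cvg_shiftS (series b)).
have lb' : limn (series (fun n => b n.+1)) <= limn (series b).
  apply: limr_le => //; apply: nearW => n.
  apply: (@le_trans _ _ (series b n.+1)); last exact: nondecreasing_cvgn_le.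
  by rewrite /series/= big_nat_recl// lerDr.
have z' : zsummable f'.
  split; first by apply: (is_cvg_series_norm_le _ cb) => k; exact: (f'b k).
  by apply: (is_cvg_series_norm_le _ cb') => k; have := f'b (- k.+1%:Z); rewrite abszN.
have [zd rd] := delta_zsum k0 (f k0).
have fE : f = fun k => f' k + (if k == k0 then f k0 else 0).
  by apply/funext => k; rewrite /f'; case: eqP => [->|]; rewrite ?add0r ?addr0.
have [zf rf] := zsummableD z' zd.
rewrite -fE rd in zf rf; split=> //; rewrite rf addrK.
rewrite mulrDl !mul1r; apply: le_trans (ler_normD _ _) _; apply: lerD.
  by apply: (normr_series_le _ z'.1 cb) => k; exact: (f'b k).
apply: le_trans lb'; apply: (normr_series_le _ z'.2 cb') => k.
by have := f'b (- k.+1%:Z); rewrite abszN.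
Qed.

(** The factor 2 of [zsummable_bound] is paid for the real and for the imaginary part. *)
Lemma zsum_bound (f : int -> R[i]) b (k0 : int) :
  (forall k, k != k0 -> cabs (f k) <= b `|k|%N) -> (forall n, 0 <= b n) ->
  cvgn (series b) -> cabs (zsum f - f k0) <= 4 * limn (series b).
Proof.
move=> fb b0 cb.
have [zr br] : zsummable (fun k => complex.Re (f k)) /\ _ :=
  @zsummable_bound (fun k => complex.Re (f k)) b k0
    (fun k kk => le_trans (normr_Re_le _) (fb k kk)) b0 cb.
have [zi bi] : zsummable (fun k => complex.Im (f k)) /\ _ :=
  @zsummable_bound (fun k => complex.Im (f k)) b k0
    (fun k kk => le_trans (normr_Im_le _) (fb k kk)) b0 cb.
rewrite zsum_complex//; apply: le_trans (cabs_le _) _.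
move: br bi; case: (f k0) => p q /= br bi; lra.
Qed.

End BilateralSeries.

(** * Second-order estimates for the complex exponential and sine *)

Section ComplexExp.
Variable R : realType.
Implicit Types (z h : R[i]) (a b x y : R).

Lemma expR_sub_le a : `|a| <= 2^-1 -> `|expR a - 1 - a| <= 2 * a ^+ 2.
Proof.
move=> ha; have h1 := expR_ge1Dx a; have h2 := expR_ge1Dx (- a).
have ha' : -2^-1 <= a <= 2^-1 by rewrite -ler_norml.
have h3 : expR a <= (1 - a)^-1.
  rewrite -[expR a]invrK -expRN lef_pV2 ?posrE ?expR_gt0//; lra.
have h4 : (1 - a)^-1 <= 1 + a + 2 * a ^+ 2.
  by rewrite -[leLHS]mul1r ler_pdivrMr; nra.
by rewrite ger0_norm; lra.
Qed.

Lemma sin_sub_le x : `|sin x - x| <= x ^+ 2.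
Proof.
wlog x0 : x / 0 < x => [hw|].
  have [|x0|->] := ltgtP x 0; last by rewrite sin0 subrr normr0 expr0n.
    by rewrite -oppr_gt0 => /hw; rewrite sinN sqrrN -opprD normrN.
  exact: hw.
have dh (v : R) : is_derive v 1 (fun v => sin v - v) (cos v - 1).
  by apply: trigger_derive; rewrite /GRing.scale/=; ring.
have ch : {within `[0, x], continuous (fun v : R => sin v - v)}.
  apply: continuous_subspaceT => v; apply/differentiable_continuous/derivable1_diffP.
  exact: (@ex_derive _ _ _ _ _ _ _ (dh v)).
have [c] := @MVT R (fun v => sin v - v) (fun v => cos v - 1) 0 x x0 (fun v _ => dh v) ch.
rewrite in_itv/= => /andP[c0 cx]; rewrite sin0 !subr0 => ->.
rewrite normrM (gtr0_norm x0) expr2 ler_wpM2r ?(ltW x0)// distrC.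
by apply: le_trans (normr_1Bcos_le _) _; rewrite gtr0_norm// ltW.
Qed.

Lemma cos_sub_le x : `|1 - cos x| <= x ^+ 2.
Proof.
have -> : 1 - cos x = 2 * sin (x / 2) ^+ 2.
  rewrite [in LHS](_ : x = (x / 2) *+ 2) ?cos_mulr2n ?cos2sin2; last by rewrite mulr2n; lra.
  by ring.
rewrite normrM normr_nat normrX.
have : `|sin (x / 2)| ^+ 2 <= `|x / 2| ^+ 2.
  by rewrite ler_pXn2r ?nnegrE// normr_sin_le.
rewrite [`|x / 2| ^+ 2]real_normK ?num_real// expr_div_n.
by have := sqr_ge0 x; lra.
Qed.

(** A crude constant is enough: through [csin_sub_le] this gives [sin z / z = 1 + O(|z|)], which is
    what the removable singularities call for. *)
Lemma cexp_sub_le z : cabs z <= 2^-1 -> cabs (cexp z - 1 - z) <= 4 * cabs z ^+ 2.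
Proof.
move=> hz; have ha := le_trans (normr_Re_le z) hz; have hb := le_trans (normr_Im_le z) hz.
rewrite cabs_sqr; apply: le_trans (cabs_le _) _.
case: z hz ha hb => a b /= hz ha hb; rewrite /cexp/= !(mul0r, mulr0, oppr0, subr0, addr0, add0r).
have e1 := expR_sub_le ha; have c1 := cos_sub_le b.
have s1 := sin_sub_le b; have s2 := normr_sin_le b.
have a1 : -2^-1 <= a <= 2^-1 by rewrite -ler_norml.
have ea : 0 <= expR a <= 2.
  rewrite expR_ge0/=; move: e1; rewrite ler_norml => /andP[_]; nra.
have ea1 : `|expR a - 1| <= 2 * `|a|.
  have -> : expR a - 1 = (expR a - 1 - a) + a by ring.
  apply: le_trans (ler_normD _ _) _.
  have : 2 * a ^+ 2 <= `|a|.
    by rewrite -[a ^+ 2]real_normK ?num_real//; have := normr_ge0 a; nra.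
  lra.
have r : `|expR a * cos b - 1 - a| <= 2 * a ^+ 2 + 2 * b ^+ 2.
  have -> : expR a * cos b - 1 - a = (expR a - 1 - a) - expR a * (1 - cos b) by ring.
  apply: le_trans (ler_normB _ _) _; apply: lerD => //.
  rewrite normrM; apply: ler_pM => //.
  by rewrite ger0_norm; case/andP: ea.
have i : `|expR a * sin b - b| <= a ^+ 2 + 2 * b ^+ 2.
  have -> : expR a * sin b - b = (expR a - 1) * sin b + (sin b - b) by ring.
  apply: le_trans (ler_normD _ _) _.
  have : `|(expR a - 1) * sin b| <= 2 * `|a| * `|b| by rewrite normrM ler_pM.
  have := sqr_ge0 (`|a| - `|b|); rewrite sqrrB !real_normK ?num_real//.
  have : 0 <= b ^+ 2 by exact: sqr_ge0.
  lra.
have := sqr_ge0 a; have := sqr_ge0 b.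
move: r i; lra.
Qed.

Lemma csin_sub_le z : cabs z <= 2^-1 -> cabs (csin z - z) <= 4 * cabs z ^+ 2.
Proof.
move=> hz; have i0 : 'i%C != 0 :> R[i] by rewrite -cabs_eq0 cabs_i oner_eq0.
have -> : csin z - z = ((cexp ('i%C * z) - 1 - 'i%C * z) - (cexp (- ('i%C * z)) - 1 - (- ('i%C * z)))) / (2 * 'i%C).
  rewrite /csin; field.
  by rewrite i0.
have iz : cabs ('i%C * z) = cabs z by rewrite cabsM cabs_i mul1r.
rewrite cabsM cabsV cabsM cabs_i mulr1 -[2]/(2%:R) -(rmorph_nat (real_complex R)) cabs_real normr_nat.
have h1 := @cexp_sub_le ('i%C * z); have h2 := @cexp_sub_le (- ('i%C * z)).
rewrite cabsN iz in h2; rewrite iz in h1.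
have := cabsD (cexp ('i%C * z) - 1 - 'i%C * z) (- (cexp (- ('i%C * z)) - 1 - - ('i%C * z))).
rewrite cabsN; have := h1 hz; have := h2 hz; lra.
Qed.

Lemma csin_real x : csin x%:C = (sin x)%:C.
Proof.
rewrite /csin /cexp/= !(mul0r, mul1r, mulr0, mulr1, subr0, add0r, addr0, oppr0, expR0, cosN, sinN).
apply/eqP; rewrite eq_complex/=; apply/andP; split; apply/eqP; simpl.
  by field.
by field.
Qed.

Lemma csin_sqrDintpi z (k : int) : csin (z + (pi * k%:~R)%:C) ^+ 2 = csin z ^+ 2.
Proof.
have s0 : sin (pi * k%:~R) = 0 :> R.
  by apply/eqP; rewrite -sqrf_eq0; have := sin_sqrDintpi k (0 : R); rewrite add0r sin0 expr0n => ->.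
have c2 : cos (pi * k%:~R) ^+ 2 = 1 :> R by rewrite cos2sin2 s0 expr0n subr0.
set e := cos (pi * k%:~R) in c2.
suff -> : csin (z + (pi * k%:~R)%:C) = e%:C * csin z.
  by rewrite exprMn -rmorphXn c2 mul1r.
rewrite /csin mulrA; congr (_ / _); case: z => x y.
rewrite /cexp/= !(mul0r, mul1r, mulr0, mulr1, add0r, sub0r, addr0, subr0, oppr0, cosN, sinN, sinD, cosD, s0) -/e.
by apply/eqP; rewrite eq_complex/=; apply/andP; split; apply/eqP; ring.
Qed.

End ComplexExp.

(** * Values of m_delta on the real line *)

Section MDelta.
Variable R : realType.
Variable d : R.
Hypothesis d0 : 0 < d.
Implicit Types (w h : R[i]) (x : R) (k : int).

Lemma derive1_gauss1 x : derive1 (gauss1 d) x = - (2 * pi * d * x) * gauss1 d x.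
Proof. by rewrite derive1E; exact: (@derive_val _ _ _ _ _ _ _ (is_derive_gauss1 d x)). Qed.

Lemma gauss1_absz k : gauss1 d k%:~R = gauss1 d (`|k|%N)%:R :> R.
Proof. by rewrite /gauss1 natr_absz intr_norm real_normK ?num_real. Qed.

Let t1 w k : R[i] := (gauss1 d k%:~R)%:C / (w - k%:~R) ^+ 2.
Let t2 w k : R[i] := (derive1 (gauss1 d) k%:~R)%:C / (w - k%:~R).
Let W := limn (series (gauss_weight d)).

Let cvgcW (c : R) : series (fun n => c * gauss_weight d n) @ \oo --> c * W.
Proof.
rewrite (_ : series _ = fun n => c * series (gauss_weight d) n).
  by apply: cvgMr; exact: is_cvg_gauss_weight.
by apply/funext => n; rewrite /series/= mulr_sumr.
Qed.

Let is_cvgcW (c : R) : cvgn (series (fun n => c * gauss_weight d n)).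
Proof. by apply/cvg_ex; exists (c * W); exact: cvgcW. Qed.

Let limcW (c : R) : limn (series (fun n => c * gauss_weight d n)) = c * W.
Proof. by apply/cvg_lim => //; exact: cvgcW. Qed.

Let intC k : (k%:~R : R[i]) = (k%:~R)%:C.
Proof. by rewrite rmorph_int. Qed.

Let dist_int w k0 k : cabs (w - k0%:~R) <= 2^-1 -> k != k0 -> 2^-1 <= cabs (w - k%:~R).
Proof.
move=> wk0 kk0.
have : 1 <= cabs ((k0%:~R - k%:~R) : R[i]).
  rewrite -intrB intC cabs_real -intr_norm.
  by rewrite -[1]/(1%:~R) ler_int; lia.
have := cabsD (k0%:~R - w) (w - k%:~R); rewrite addrA subrK -(cabsN (k0%:~R - w)) opprB.
lra.
Qed.

Let inv_dist w k0 k : cabs (w - k0%:~R) <= 2^-1 -> k != k0 -> (cabs (w - k%:~R))^-1 <= 2.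
Proof.
move=> wk kk; have h := dist_int wk kk; rewrite -[leRHS]invrK lef_pV2// posrE; lra.
Qed.

Let t1_bound w k0 k : cabs (w - k0%:~R) <= 2^-1 -> k != k0 ->
  cabs (t1 w k) <= 4 * gauss_weight d `|k|%N.
Proof.
move=> wk kk; have h := inv_dist wk kk.
rewrite /t1 cabsM cabs_real cabsV cabsX ger0_norm ?gauss1_ge0// gauss1_absz mulrC.
apply: ler_pM; rewrite ?gauss1_ge0 ?invr_ge0 ?exprn_ge0 ?cabs_ge0 ?gauss1_le_weight//.
rewrite -exprVn (_ : 4 = 2 ^+ 2); last by rewrite -natrX.
by rewrite ler_pXn2r// nnegrE// invr_ge0 cabs_ge0.
Qed.

Let t2_bound w k0 k : cabs (w - k0%:~R) <= 2^-1 -> k != k0 ->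
  cabs (t2 w k) <= (4 * pi * d) * gauss_weight d `|k|%N.
Proof.
move=> wk kk; have h := inv_dist wk kk; have pi0 := @pi_gt0 R.
rewrite /t2 cabsM cabs_real cabsV derive1_gauss1 normrM normrN.
rewrite (ger0_norm (gauss1_ge0 _ _)) normrM gtr0_norm ?mulr_gt0// gauss1_absz.
rewrite -intr_norm -natr_absz -mulrA.
rewrite [leRHS](_ : _ = 2 * pi * d * gauss_weight d `|k|%N * 2); last by ring.
apply: ler_pM => //; rewrite ?mulr_ge0 ?gauss1_ge0 ?invr_ge0 ?cabs_ge0 ?(ltW pi0) ?(ltW d0)//.
by rewrite ler_wpM2l ?mulr_ge0 ?(ltW pi0) ?(ltW d0)// mul_gauss1_le_weight.
Qed.

Let pd0 : 0 <= 4 * pi * d.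
Proof. by rewrite !mulr_ge0 ?pi_ge0 ?(ltW d0). Qed.

Let zt1 w k0 : cabs (w - k0%:~R) <= 2^-1 -> cabs (zsum (t1 w) - t1 w k0) <= 16 * W.
Proof.
move=> wk; have := @zsum_bound R (t1 w) (fun n => 4 * gauss_weight d n) k0.
rewrite limcW mulrA -natrM; apply.
- by move=> k; exact: t1_bound.
- by move=> n; rewrite mulr_ge0 ?gauss_weight_ge0.
- exact: cvgcW.
Qed.

Let zt2 w k0 : cabs (w - k0%:~R) <= 2^-1 -> cabs (zsum (t2 w) - t2 w k0) <= 16 * pi * d * W.
Proof.
move=> wk; have := @zsum_bound R (t2 w) (fun n => 4 * pi * d * gauss_weight d n) k0.
rewrite limcW (_ : 4 * (4 * pi * d * W) = 16 * pi * d * W); last by ring.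
apply.
- by move=> k; exact: t2_bound.
- by move=> n; rewrite mulr_ge0 ?gauss_weight_ge0 ?pd0.
- exact: cvgcW.
Qed.

Lemma m_formula_real x : (forall k, x != k%:~R) ->
  m_formula d x%:C = (cos_transform (phi d) x)%:C.
Proof.
move=> xZ; have pin0 : pi != 0 :> R by rewrite gt_eqF// pi_gt0.
(* A nearest integer to [x]: all other nodes are at distance at least 1/2, which bounds the
   remaining terms of both series. *)
pose k0 := Num.floor (x + 2^-1).
have xk0 : cabs (x%:C - k0%:~R) <= 2^-1.
  rewrite intC -rmorphB cabs_real ler_norml.
  have h1 : k0%:~R <= x + 2^-1 by exact: floor_le_tmp.
  have h2 : x + 2^-1 < k0%:~R + 1 by have := floorD1_gt (x + 2^-1); rewrite intrD.
  lra.
pose r1 k := gauss1 d k%:~R / (x - k%:~R) ^+ 2.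
pose r2 k := - (2 * pi * d * k%:~R) * gauss1 d k%:~R / (x - k%:~R).
have E1 k : t1 x%:C k = (r1 k)%:C.
  by rewrite /t1 /r1 intC -rmorphB -rmorphXn -fmorphV -rmorphM.
have E2 k : t2 x%:C k = (r2 k)%:C.
  by rewrite /t2 /r2 derive1_gauss1 intC -rmorphB -fmorphV -rmorphM.
have gw0 n : 0 <= 4 * gauss_weight d n by rewrite mulr_ge0 ?gauss_weight_ge0.
have gw1 n : 0 <= 4 * pi * d * gauss_weight d n.
  by rewrite mulr_ge0 ?gauss_weight_ge0 ?pd0.
have q1 k : k != k0 -> `|r1 k| <= 4 * gauss_weight d `|k|%N.
  by move=> kk; rewrite -cabs_real -E1; exact: (t1_bound xk0).
have q2 k : k != k0 -> `|r2 k| <= 4 * pi * d * gauss_weight d `|k|%N.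
  by move=> kk; rewrite -cabs_real -E2; exact: (t2_bound xk0).
have cw1 := @is_cvgcW 4; have cw2 := @is_cvgcW (4 * pi * d).
have [s1 _] := @zsummable_bound R r1 _ k0 q1 gw0 cw1.
have [s2 _] := @zsummable_bound R r2 _ k0 q2 gw1 cw2.
rewrite /m_formula -rmorphM csin_real -[zsum _]/(zsum (t1 x%:C)) -[X in _ + X]/(zsum (t2 x%:C)).
rewrite (_ : t1 x%:C = fun k => (r1 k)%:C); last by apply/funext.
rewrite (_ : t2 x%:C = fun k => (r2 k)%:C); last by apply/funext.
rewrite !zsum_real// -rmorphD -fmorphV -rmorphM -rmorphXn -rmorphM; congr (_%:C).
have [sz <-] := zsummableD s1 s2.
have := cvg_unique _ (cvg_zpair_rzsum sz) (cvg_gauss_hermite d0 xZ) => -> //.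
have := sinpi_neq0 xZ; move: pi pin0 => p p0 sp; field.
by rewrite p0 sp.
Qed.

(** With [h = w - k0] and [s = sin (pi h) / (pi h)], periodicity of the squared sine turns the
    formula into [s^2 (g + g' h + r h^2)], where [r], the two series without their [k0] terms, is
    bounded near [k0]. The limit [g] is thus approached at a linear rate. *)
Lemma cvg_m_formula_int k0 :
  (m_formula d w : R[i]^o) @[w --> ((k0%:~R : R[i]) : R[i]^o)^'] --> ((gauss1 d k0%:~R)%:C : R[i]^o).
Proof.
have pi0 := @pi_gt0 R.
set g := gauss1 d k0%:~R; set g' := derive1 (gauss1 d) k0%:~R.
have W0 : 0 <= W.
  apply: limr_ge; first exact: is_cvg_gauss_weight.
  by apply: nearW => n; apply: sumr_ge0 => k _; exact: gauss_weight_ge0.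
pose B := 16 * W + 16 * pi * d * W.
have B0 : 0 <= B by rewrite addr_ge0// !mulr_ge0// ltW.
pose C := 12 * pi * `|g| + 3 * (`|g'| + B).
have C0 : 0 <= C.
  apply: addr_ge0; apply: mulr_ge0 => //; last exact: addr_ge0.
  by rewrite mulr_ge0 ?(ltW pi0).
(* The radius makes [|pi h| <= 1/8], so [|s - 1| <= 4 pi |h| <= 1/2]; hence [|s^2| <= 3] and
   [|s^2 - 1| <= 12 pi |h|], the constants that enter [C]. *)
have main w : w != k0%:~R -> cabs (w - k0%:~R) <= (8 * pi)^-1 ->
    cabs (m_formula d w - g%:C) <= C * cabs (w - k0%:~R).
  set h := w - k0%:~R => wk hk.
  have h0 : h != 0 by rewrite subr_eq0.
  have p2 := pi_ge2 R.
  have hk' : cabs h * (8 * pi) <= 1 by rewrite -ler_pdivlMr ?mulr_gt0// mul1r.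
  have ch0 := cabs_ge0 h.
  have hk2 : cabs h <= 2^-1 by nra.
  have piC0 : (pi%:C : R[i]) != 0 by rewrite -cabs_eq0 cabs_real normr_eq0 gt_eqF.
  pose s := csin (pi%:C * h) / (pi%:C * h).
  have ph : cabs (pi%:C * h) = pi * cabs h by rewrite cabsM cabs_real gtr0_norm.
  have ch1 : 0 < cabs h by rewrite lt_neqAle ch0 eq_sym cabs_eq0 h0.
  have s1 : cabs (s - 1) <= 4 * pi * cabs h.
    have ph2 : cabs (pi%:C * h) <= 2^-1 by rewrite ph; nra.
    have := csin_sub_le ph2.
    have -> : csin (pi%:C * h) - pi%:C * h = (pi%:C * h) * (s - 1).
      have u0 : pi%:C * h != 0 by rewrite mulf_neq0.
      by rewrite /s; move: (pi%:C * h) u0 (csin _) => u u0 v; field; exact: u0.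
    rewrite cabsM ph => H.
    have : pi * cabs h * cabs (s - 1) <= pi * cabs h * (4 * pi * cabs h) by nra.
    by rewrite ler_pM2l// mulr_gt0.
  have s2 : cabs (s + 1) <= 3.
    have -> : s + 1 = (s - 1) + 2%:R by ring.
    apply: le_trans (cabsD _ _) _; rewrite -(rmorph_nat (real_complex R)) cabs_real normr_nat.
    nra.
  have s3 : cabs (s ^+ 2) <= 3.
    rewrite cabsX; have : cabs s <= 3 / 2.
      rewrite -[s](subrK 1); apply: le_trans (cabsD _ _) _.
      rewrite -(rmorph1 (real_complex R)) cabs_real normr1; nra.
    have := cabs_ge0 s; nra.
  have s4 : cabs (s ^+ 2 - 1) <= 12 * pi * cabs h.
    have -> : s ^+ 2 - 1 = (s - 1) * (s + 1) by ring.
    rewrite cabsM; have := cabs_ge0 (s - 1); have := cabs_ge0 (s + 1); nra.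
  pose r := (zsum (t1 w) - t1 w k0) + (zsum (t2 w) - t2 w k0).
  have rB : cabs r <= B.
    by apply: le_trans (cabsD _ _) _; apply: lerD; [exact: zt1|exact: zt2].
  have mE : m_formula d w = s ^+ 2 * (g%:C + g'%:C * h + r * h ^+ 2).
    rewrite /m_formula -[zsum _]/(zsum (t1 w)) -[X in _ + X]/(zsum (t2 w)).
    have -> : zsum (t1 w) + zsum (t2 w) = g%:C / h ^+ 2 + g'%:C / h + r.
      by rewrite /r /t1 /t2 -/h -/g -/g'; ring.
    rewrite expr_div_n.
    have -> : csin (pi%:C * w) ^+ 2 = csin (pi%:C * h) ^+ 2.
      rewrite -(csin_sqrDintpi (pi%:C * h) k0) rmorphM/= rmorph_int -mulrDr.
      by rewrite /h subrK.
    rewrite /s; move: (csin _) => v; move: (pi%:C) piC0 => u u0; field.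
    by rewrite h0 u0.
  have -> : m_formula d w - g%:C = (s ^+ 2 - 1) * g%:C + s ^+ 2 * (g'%:C + r * h) * h.
    by rewrite mE; ring.
  apply: le_trans (cabsD _ _) _; rewrite (cabsM (s ^+ 2 - 1)) (cabsM _ h) (cabsM (s ^+ 2)).
  have -> : C * cabs h = 12 * pi * `|g| * cabs h + 3 * (`|g'| + B) * cabs h by rewrite /C mulrDl.
  apply: lerD.
    by rewrite cabs_real -mulrA [`|g| * _]mulrC mulrA ler_wpM2r.
  rewrite ler_wpM2r//; apply: (ler_pM (cabs_ge0 _) (cabs_ge0 _) s3).
  apply: le_trans (cabsD _ _) _; rewrite cabs_real cabsM lerD2l.
  have := cabs_ge0 r; nra.
apply/cvgrPdist_le => e; rewrite ltcE/= => /andP[/eqP e_im e0].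
have {e_im} -> : e = (complex.Re e)%:C by case: e e_im {e0} => a b /= ->.
set e' := complex.Re e in e0 *.
pose del := Num.min ((8 * pi)^-1) (e' / (C + 1)).
have del0 : 0 < del by rewrite lt_min invr_gt0 mulr_gt0//= divr_gt0//; lra.
exists del%:C => /=; first by rewrite ltcR.
move=> w /=; rewrite distrC cabsE ltcR => wd wk.
rewrite distrC cabsE lecR; apply: le_trans (main _ wk _) _.
  by apply: ltW; apply: lt_le_trans wd _; rewrite /del ge_min lexx.
apply: (@le_trans _ _ (C * (e' / (C + 1)))).
  rewrite ler_wpM2l//; apply: ltW; apply: lt_le_trans wd _.
  by rewrite /del ge_min lexx orbT.
rewrite mulrCA ler_piMr ?(ltW e0)// ler_pdivrMr; lra.
Qed.

(** At an integer, the limit in [m_delta] and the interpolated value of the cosine transform are the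
    same value of the Gaussian. *)
Lemma m_delta_real x : m_delta d x%:C = (cos_transform (phi d) x)%:C.
Proof.
rewrite /m_delta; case: asboolP => [[k xk]|xZ]; last first.
  apply: m_formula_real => k; apply/eqP => xk; apply: xZ; exists k.
  by rewrite xk intC.
have -> : x = k%:~R by apply: complexI; rewrite xk intC.
rewrite cos_transform_phi_int// -intC; apply: lim_complex_unique.
exact: cvg_m_formula_int.
Qed.

End MDelta.

(** * Integration of products on R^d *)

Section Transfer.
Variable R : realType.

Lemma integral_eq_measure dd (T : measurableType dd) (m1 m2 : {measure set T -> \bar R})
    (f : T -> R) : (forall A, measurable A -> m1 A = m2 A) ->
  m1.-integrable setT (EFin \o f) ->
  m2.-integrable setT (EFin \o f) /\ \int[m2]_x f x = \int[m1]_x f x.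
Proof.
move=> m12 /integrableP[mf fi]; split.
  apply/integrableP; split => //.
  rewrite (eq_measure_integral m1)// => A mA _; exact/esym/m12.
rewrite /Rintegral; congr fine; apply: eq_measure_integral => A mA _.
exact/esym/m12.
Qed.

Lemma integral_image dd1 dd2 (X : measurableType dd1) (Y : measurableType dd2)
    (p : X -> Y) (m1 : {measure set X -> \bar R}) (m2 : {measure set Y -> \bar R})
    (f : Y -> R) :
  measurable_fun setT p -> (forall A, measurable A -> m2 A = m1 (p @^-1` A)) ->
  measurable_fun setT f -> m1.-integrable setT (EFin \o (f \o p)) ->
  m2.-integrable setT (EFin \o f) /\ \int[m2]_y f y = \int[m1]_x f (p x).
Proof.
move=> mp m12 mf fi.
pose m3 : {measure set Y -> \bar R} :=
  measure_function_pushforward__canonical__measure_function_Measure m1 mp.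
have mf' : measurable_fun setT (EFin \o f) by exact/measurable_EFinP.
have i3 : m3.-integrable setT (EFin \o f).
  by apply: integrable_pushforward => //; rewrite preimage_setT.
have e3 : \int[m3]_y f y = \int[m1]_x f (p x).
  rewrite /Rintegral; congr fine; rewrite integral_pushforward// ?preimage_setT//.
by have [? ->] := @integral_eq_measure _ _ m3 m2 f (fun A mA => esym (m12 A mA)) i3.
Qed.

Lemma measurable_lebesgue_id d : measurable_fun setT
  (id : caratheodory_type ((@borel_lebesgue R d)^*)%mu -> rvec R d).
Proof.
move=> _ A mA; rewrite setTI.
by apply: sub_caratheodory; apply: sub_sigma_algebra.
Qed.

(** The identity from the completed space to the Borel one is measurable and carries [lebesgue] to
    [borel_lebesgue]. Product functions can therefore be integrated against the Borel measure, where
    Fubini applies. *)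
Lemma lebesgue_transfer d (f : rvec R d -> R) :
  (@borel_lebesgue R d).-integrable setT (EFin \o f) ->
  (lebesgue R d).-integrable setT (EFin \o f) /\
  \int[lebesgue R d]_x f x = \int[@borel_lebesgue R d]_x f x.
Proof.
move=> fi.
have mf : measurable_fun setT f by apply/measurable_EFinP; exact: measurable_int fi.
pose idm : caratheodory_type ((@borel_lebesgue R d)^*)%mu -> rvec R d := id.
have mid : measurable_fun setT idm.
  exact: measurable_lebesgue_id.
have E (A : set (rvec R d)) : measurable A -> borel_lebesgue A = lebesgue R d (idm @^-1` A).
  by move=> mA; rewrite /lebesgue /completed_measure_extension/= measurable_mu_extE.
have li : (lebesgue R d).-integrable setT (EFin \o (f \o idm)).
  apply/integrableP; split.
    by apply/measurable_EFinP; exact: (measurableT_comp mf mid).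
  have /integrableP[_] := fi; apply: le_lt_trans.
  pose m3 : {measure set (rvec R d) -> \bar R} :=
    measure_function_pushforward__canonical__measure_function_Measure (lebesgue R d) mid.
  have m3E : forall A, measurable A -> A `<=` setT -> borel_lebesgue A = m3 A.
    by move=> A mA _; exact: E.
  rewrite (eq_measure_integral m3 m3E) [leRHS]ge0_integral_pushforward ?preimage_setT//.
  by apply: measurableT_comp => //; exact/measurable_EFinP.
split => //.
by have [_ ->] := integral_image mid E mf li.
Qed.

End Transfer.

Section ProductFunctions.
Variable R : realType.
Notation mu := (@lebesgue_measure R).

Definition cmeasurable dd (T : measurableType dd) (H : T -> R[i]) :=
  measurable_fun setT (@complex.Re R \o H) /\ measurable_fun setT (@complex.Im R \o H).

Definition cintegrable dd (T : measurableType dd) (m : {measure set T -> \bar R}) (H : T -> R[i]) :=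
  m.-integrable setT (EFin \o (@complex.Re R \o H)) /\
  m.-integrable setT (EFin \o (@complex.Im R \o H)).

Definition cint dd (T : measurableType dd) (m : {measure set T -> \bar R}) (H : T -> R[i]) : R[i] :=
  (\int[m]_x complex.Re (H x)) +i* (\int[m]_x complex.Im (H x)).

Lemma cmeasurableM dd (T : measurableType dd) (G H : T -> R[i]) :
  cmeasurable G -> cmeasurable H -> cmeasurable (fun x => G x * H x).
Proof.
move=> [g1 g2] [h1 h2]; split.
  rewrite (_ : _ \o _ = fun x => complex.Re (G x) * complex.Re (H x) - complex.Im (G x) * complex.Im (H x)).
    by apply: measurable_funB; apply: measurable_funM.
  by apply/funext => x /=; case: (G x) (H x) => [? ?] [? ?].
rewrite (_ : _ \o _ = fun x => complex.Re (G x) * complex.Im (H x) + complex.Im (G x) * complex.Re (H x)).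
  by apply: measurable_funD; apply: measurable_funM.
by apply/funext => x /=; case: (G x) (H x) => [? ?] [? ?].
Qed.

Lemma cmeasurable_prod dd (T : measurableType dd) (I : Type) (s : seq I) (H : I -> T -> R[i]) :
  (forall i, cmeasurable (H i)) -> cmeasurable (fun x => \prod_(i <- s) H i x).
Proof.
move=> mH; elim: s => [|i s IH].
  by under eq_fun do rewrite big_nil; split; exact: measurable_cst.
under eq_fun do rewrite big_cons; exact: cmeasurableM.
Qed.

Lemma cint_prod dd1 dd2 (T1 : measurableType dd1) (T2 : measurableType dd2)
    (m1 : {sigma_finite_measure set T1 -> \bar R})
    (m2 : {sigma_finite_measure set T2 -> \bar R}) (G : T1 -> R[i]) (H : T2 -> R[i]) :
  cintegrable m1 G -> cintegrable m2 H ->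
  cintegrable (m1 \x m2)%E (fun z => G z.1 * H z.2) /\
  cint (m1 \x m2)%E (fun z => G z.1 * H z.2) = cint m1 G * cint m2 H.
Proof.
move=> [g1 g2] [h1 h2].
have p11 := integrable_prod g1 h1; have p22 := integrable_prod g2 h2.
have p12 := integrable_prod g1 h2; have p21 := integrable_prod g2 h1.
have reE z : complex.Re (G z.1 * H z.2) = complex.Re (G z.1) * complex.Re (H z.2) -
    complex.Im (G z.1) * complex.Im (H z.2) by case: (G z.1) (H z.2) => [? ?] [? ?].
have imE z : complex.Im (G z.1 * H z.2) = complex.Re (G z.1) * complex.Im (H z.2) +
    complex.Im (G z.1) * complex.Re (H z.2) by case: (G z.1) (H z.2) => [? ?] [? ?].
split.
  split.
    rewrite (_ : _ \o _ = EFin \o (fun z => complex.Re (G z.1) * complex.Re (H z.2) -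
      complex.Im (G z.1) * complex.Im (H z.2))); last by apply/funext => z /=; rewrite reE.
    exact: (integrableB _ p11 p22).
  rewrite (_ : _ \o _ = EFin \o (fun z => complex.Re (G z.1) * complex.Im (H z.2) +
      complex.Im (G z.1) * complex.Re (H z.2))); last by apply/funext => z /=; rewrite imE.
  exact: (integrableD _ p12 p21).
rewrite /cint; under eq_Rintegral do rewrite reE.
under [X in _ +i* X]eq_Rintegral do rewrite imE.
rewrite RintegralB// RintegralD//.
by rewrite (Rintegral_prod g1 h1) (Rintegral_prod g2 h2) (Rintegral_prod g1 h2) (Rintegral_prod g2 h1).
Qed.

Lemma measurable_cons_vec d :
  measurable_fun setT (@cons_vec R d).
Proof. exact: (measurable_cons measurable_fst measurable_snd). Qed.

(** Complex factors accommodate the characters of the Fourier integral. In the induction, [cons_vec]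
    carries the product measure of [cint_prod] to the measure in dimension [d + 1]. *)
Lemma cint_tensor d (h : 'I_d -> R -> R[i]) :
  (forall j, cintegrable mu (h j)) ->
  cintegrable (@borel_lebesgue R d) (fun x => \prod_(j < d) h j (tnth x j)) /\
  cint (@borel_lebesgue R d) (fun x => \prod_(j < d) h j (tnth x j)) =
  \prod_(j < d) cint mu (h j).
Proof.
elim: d h => [|d IH] h ih.
  (* In dimension 0 the measure is a Dirac mass, and both sides are an empty product. *)
  have di (c : R) : (@borel_lebesgue R 0).-integrable setT (EFin \o cst c).
    apply/integrableP; split; first exact/measurable_EFinP.
    rewrite [ltLHS](_ : _ = `|c|%:E)%E ?ltry//.
    rewrite -[LHS]/(\int[_]_(x in setT) cst (`|c|%:E) x)%E.
    by rewrite integral_cst//= /borel_lebesgue diracE mem_set// mule1.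
  have dv (c : R) : \int[@borel_lebesgue R 0]_x c = c.
    rewrite -[LHS]/(\int[_]_(x in setT) cst c x) Rintegral_cst//.
    by rewrite (_ : fine _ = 1) ?mulr1// -[LHS]/(fine (\d_[tuple] [set: rvec R 0])) diracT.
  under eq_fun do rewrite big_ord0.
  rewrite big_ord0; split.
    by split; exact: di.
  by rewrite /cint /= !dv.
have [iH eH] := IH (fun j => h (lift ord0 j)) (fun j => ih _).
have [iP eP] := cint_prod (ih ord0) iH.
pose H (x : rvec R d.+1) := \prod_(j < d.+1) h j (tnth x j).
have HE z : H (cons_vec z) = h ord0 z.1 * \prod_(j < d) h (lift ord0 j) (tnth z.2 j).
  rewrite /H big_ord_recl tnth0; congr (_ * _); apply: eq_bigr => j _.
  by rewrite tnthS; congr (h _ (tnth _ _)); exact/val_inj.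
have mH : cmeasurable H.
  apply: cmeasurable_prod => j; have [m1 m2] := ih j.
  have {}m1 : measurable_fun setT (@complex.Re R \o h j) by apply/measurable_EFinP; exact: (measurable_int mu m1).
  have {}m2 : measurable_fun setT (@complex.Im R \o h j) by apply/measurable_EFinP; exact: (measurable_int mu m2).
  split.
    exact: (measurableT_comp m1 (measurable_tnth j)).
  exact: (measurableT_comp m2 (measurable_tnth j)).
have E A : measurable A -> @borel_lebesgue R d.+1 A = (mu \x @borel_lebesgue R d)%E (@cons_vec R d @^-1` A) by [].
have HP : (fun z : measurableTypeR R * rvec R d =>
    h ord0 z.1 * \prod_(j < d) h (lift ord0 j) (tnth z.2 j)) = H \o @cons_vec R d.
  by apply/funext => z; rewrite /= HE.
rewrite HP in iP; have [iP1 iP2] := iP.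
have [r1 r2] := integral_image (@measurable_cons_vec d) E mH.1 iP1.
have [j1 j2] := integral_image (@measurable_cons_vec d) E mH.2 iP2.
split; first by split.
rewrite big_ord_recl -eH -eP /cint; congr (_ +i* _).
  by rewrite [LHS]r2; apply: eq_Rintegral => z _ /=; rewrite HE.
by rewrite [LHS]j2; apply: eq_Rintegral => z _ /=; rewrite HE.
Qed.

End ProductFunctions.

(** * Theta series on the imaginary axis *)

Section ThetaSeries.
Variable R : realType.
Implicit Types (e r : R) (k : int).

(** This is [Theta (0; i e)], summed symmetrically because Fejer means are Cesaro means of symmetric
    partial sums. *)
Definition theta e : R := limn (series (zpair (fun k : int => gauss1 e k%:~R))).

Lemma zsummable_gauss1 e : 0 < e -> zsummable (fun k : int => gauss1 e k%:~R).
Proof.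
move=> e0; have bd k : k != 0 -> `|gauss1 e k%:~R| <= gauss_weight e `|k|%N.
  by move=> _; rewrite ger0_norm ?gauss1_ge0// gauss1_absz gauss1_le_weight.
by have [] := @zsummable_bound R _ (gauss_weight e) 0 bd (gauss_weight_ge0 e) (is_cvg_gauss_weight e0).
Qed.

Lemma thetaE e : 0 < e -> theta e = rzsum (fun k : int => gauss1 e k%:~R).
Proof. by move=> e0; apply/cvg_lim => //; exact: cvg_zpair_rzsum (zsummable_gauss1 e0). Qed.

Lemma cvg_theta e : 0 < e ->
  series (zpair (fun k : int => gauss1 e k%:~R)) @ \oo --> theta e.
Proof. by move=> e0; rewrite thetaE//; exact: cvg_zpair_rzsum (zsummable_gauss1 e0). Qed.

Lemma cexp_real r : cexp r%:C = (expR r)%:C.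
Proof. by rewrite /cexp/= cos0 sin0 mulr1. Qed.

Lemma Theta0_imag r : 0 < r -> Theta 0 ('i%C * r%:C) = (theta r)%:C.
Proof.
move=> r0; rewrite thetaE// -(zsum_real (zsummable_gauss1 r0)) /Theta; congr zsum.
apply/funext => k; rewrite mulr0 -[0]/((0 : R)%:C) cexp_real expR0 mul1r.
rewrite -cexp_real; congr cexp.
rewrite rmorphM rmorphXn rmorph_int rmorphM/= rmorphN/=.
rewrite (_ : pi%:C * 'i * ('i * r%:C) = pi%:C * r%:C * 'i ^+ 2); last by ring.
by rewrite sqr_i; ring.
Qed.

End ThetaSeries.

(** * Fourier transforms of tensor products *)

Section FourierTensor.
Variable R : realType.
Notation mu := (@lebesgue_measure R).
Implicit Types (t : R).

(** This is [exp (- i t)], with the minus sign of the Fourier kernel. *)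
Definition cis t : R[i] := cos t +i* - sin t.

Lemma cisD s t : cis (s + t) = cis s * cis t.
Proof. by rewrite /cis cosD sinD; simpc; congr (_ +i* _); ring. Qed.

Lemma cis0 : cis 0 = 1.
Proof. by rewrite /cis cos0 sin0 oppr0. Qed.

Lemma cis_sum (I : Type) (s : seq I) (th : I -> R) :
  cis (\sum_(i <- s) th i) = \prod_(i <- s) cis (th i).
Proof. exact: (big_morph cis cisD cis0). Qed.

Lemma cexp_cis t : cexp (- (2 * pi%:C * 'i%C * t%:C)) = cis (2 * pi * t).
Proof.
have -> : - (2 * pi%:C * 'i%C * t%:C) = 0 +i* - (2 * pi * t).
  have -> : (2 : R[i]) = (2%:R : R)%:C by rewrite rmorph_nat.
  by simpc; congr (_ +i* _); ring.
by rewrite /cexp/= expR0 mul1r cosN sinN.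
Qed.

(* [al = 0] and [al = pi / 2] give the real and the imaginary part of the
   Fourier transform. *)
Definition cos_hat (h : R -> R) xi al := \int[mu]_x (h x * cos (2 * pi * xi * x + al)).

Lemma integrable_mul_cos (h : R -> R) xi al : mu.-integrable setT (EFin \o h) ->
  mu.-integrable setT (EFin \o (fun x => h x * cos (2 * pi * xi * x + al))).
Proof.
move=> hi; apply: (le_integrable _ _ _ hi) => //.
  apply/measurable_EFinP; apply: measurable_funM; last exact: measurable_cos_affine.
  by apply/measurable_EFinP; exact: (measurable_int mu hi).
by move=> x _ /=; rewrite lee_fin normrM ler_piMr// ler_norml cos_geN1 cos_le1.
Qed.

Lemma cint_cis (h : R -> R) xi : mu.-integrable setT (EFin \o h) ->
  cintegrable mu (fun x => cis (2 * pi * (x * xi)) * (h x)%:C) /\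
  cint mu (fun x => cis (2 * pi * (x * xi)) * (h x)%:C) =
  cos_hat h xi 0 +i* cos_hat h xi (pi / 2).
Proof.
move=> hi.
have re x : complex.Re (cis (2 * pi * (x * xi)) * (h x)%:C) = h x * cos (2 * pi * xi * x + 0).
  by rewrite /= mulr0 subr0 addr0 mulrC; congr (_ * cos _); ring.
have im x : complex.Im (cis (2 * pi * (x * xi)) * (h x)%:C) = h x * cos (2 * pi * xi * x + pi / 2).
  by rewrite /= mulr0 add0r cosDpihalf mulrC; congr (_ * - sin _); ring.
split; last first.
  by congr (_ +i* _); apply: eq_Rintegral => x _; rewrite ?re ?im.
split.
  by rewrite (_ : _ \o _ = fun x => h x * cos (2 * pi * xi * x + 0)); [exact: integrable_mul_cos|apply/funext => x; exact: re].
by rewrite (_ : _ \o _ = fun x => h x * cos (2 * pi * xi * x + pi / 2)); [exact: integrable_mul_cos|apply/funext => x; exact: im].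
Qed.

Lemma cint_real (h : R -> R) : mu.-integrable setT (EFin \o h) ->
  cintegrable mu (fun x => (h x)%:C) /\ cint mu (fun x => (h x)%:C) = (\int[mu]_x h x)%:C.
Proof.
move=> hi; split; first by split; [exact: hi|exact: integrable0].
by rewrite /cint; congr (_ +i* _); rewrite /= /Rintegral integral0.
Qed.

Variable d : nat.
Implicit Types (h : 'I_d -> R -> R) (x xi : d.-tuple R).

Lemma cintegral_tensor (H : 'I_d -> R -> R[i]) : (forall j, cintegrable mu (H j)) ->
  (lebesgue R d).-integrable setT (EFin \o (fun x => complex.Re (\prod_(j < d) H j (tnth x j)))) /\
  cintegral (fun x => \prod_(j < d) H j (tnth x j)) = \prod_(j < d) cint mu (H j).
Proof.
move=> /cint_tensor[[iR iI] <-].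
have [lR eR] := lebesgue_transfer iR; have [lI eI] := lebesgue_transfer iI.
by split => //; rewrite /cintegral /cint; congr (_ +i* _).
Qed.

Lemma Rintegral_tensor h : (forall j, mu.-integrable setT (EFin \o h j)) ->
  (lebesgue R d).-integrable setT (EFin \o (fun x => \prod_(j < d) h j (tnth x j))) /\
  \int[lebesgue R d]_x (\prod_(j < d) h j (tnth x j)) = \prod_(j < d) \int[mu]_x h j x.
Proof.
move=> ih; have [iH eH] := @cintegral_tensor (fun j t => (h j t)%:C) (fun j => (cint_real (ih j)).1).
have E x : \prod_(j < d) (h j (tnth x j))%:C = (\prod_(j < d) h j (tnth x j))%:C.
  by rewrite rmorph_prod.
split.
  by move: iH; congr (_.-integrable _ _); apply/funext => x /=; rewrite E.
apply: complexI; rewrite rmorph_prod.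
transitivity (\prod_(j < d) cint mu (fun t => (h j t)%:C)); last first.
  by apply: eq_bigr => j _; exact: (cint_real (ih j)).2.
rewrite -eH /cintegral; congr (_ +i* _).
  by apply: eq_Rintegral => x _; rewrite E.
apply/esym; rewrite -[RHS](_ : \int[lebesgue R d]_x (cst 0 x) = 0); last first.
  by rewrite /Rintegral integral0.
by apply: eq_Rintegral => x _; rewrite E.
Qed.

Lemma fourier_tensor h xi : (forall j, mu.-integrable setT (EFin \o h j)) ->
  fourier (fun x => \prod_(j < d) h j (tnth x j)) xi =
  \prod_(j < d) (cos_hat (h j) (tnth xi j) 0 +i* cos_hat (h j) (tnth xi j) (pi / 2)).
Proof.
move=> ih; under [RHS]eq_bigr => j _ do rewrite -(cint_cis (tnth xi j) (ih j)).2.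
have [_ <-] := @cintegral_tensor
  (fun j t => cis (2 * pi * (t * tnth xi j)) * (h j t)%:C) (fun j => (cint_cis _ (ih j)).1).
rewrite /fourier; congr cintegral; apply/funext => x.
by rewrite cexp_cis /dotp mulr_sumr cis_sum rmorph_prod -big_split.
Qed.

Lemma Re_fourier (F : d.-tuple R -> R) xi :
  complex.Re (fourier F xi) = \int[lebesgue R d]_x (F x * cos (2 * pi * dotp x xi)).
Proof.
apply: eq_Rintegral => x _; rewrite cexp_cis /= mulr0 subr0; exact: mulrC.
Qed.

Lemma measurable_cos_dotp xi :
  measurable_fun setT (fun x : caratheodory_type ((@borel_lebesgue R d)^*)%mu =>
    cos (2 * pi * dotp x xi)).
Proof.
have m : measurable_fun setT (fun x : rvec R d => cos (2 * pi * dotp x xi)).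
  apply: (measurableT_comp (continuous_measurable_fun (@continuous_cos R))).
  apply: measurable_funM => //; apply: measurable_sum => j.
  by apply: measurable_funM => //; exact: measurable_tnth.
exact: (measurableT_comp m (@measurable_lebesgue_id R d)).
Qed.

Lemma integrable_mul_cos_dotp (F : d.-tuple R -> R) xi :
  (lebesgue R d).-integrable setT (EFin \o F) ->
  (lebesgue R d).-integrable setT (EFin \o (fun x => F x * cos (2 * pi * dotp x xi))).
Proof.
move=> iF; apply: (le_integrable _ _ _ iF) => //.
  apply/measurable_EFinP; apply: measurable_funM; last exact: measurable_cos_dotp.
  by apply/measurable_EFinP; exact: (measurable_int _ iF).
by move=> x _ /=; rewrite lee_fin normrM ler_piMr// ler_norml cos_geN1 cos_le1.
Qed.

End FourierTensor.

(** * The lower bound and the extremal function *)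

Section LowerBound.
Variables (R : realType) (d : nat).
Notation mu := (@lebesgue_measure R).
Notation leb := (lebesgue R d).
Implicit Types (x xi a lam : d.-tuple R) (F : d.-tuple R -> R).

Lemma cvg_prodR (T I : Type) (G : set_system T) (s : seq I) (u : I -> T -> R) (l : I -> R) :
  Filter G -> (forall i, u i x @[x --> G] --> l i) ->
  \prod_(i <- s) u i x @[x --> G] --> \prod_(i <- s) l i.
Proof. by move=> GF ul; apply: cvg_big => [|i _]; [exact: mul_continuous|exact: ul]. Qed.

Lemma cvg_sumR (T I : Type) (G : set_system T) (s : seq I) (u : I -> T -> R) (l : I -> R) :
  Filter G -> (forall i, u i x @[x --> G] --> l i) ->
  \sum_(i <- s) u i x @[x --> G] --> \sum_(i <- s) l i.
Proof. by move=> GF ul; apply: cvg_big => [|i _]; [exact: add_continuous|exact: ul]. Qed.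

Lemma integrable_gaussian lam : Lambda lam -> leb.-integrable setT (EFin \o gaussian lam).
Proof.
move=> l0; have [iG _] := @Rintegral_tensor R d (fun j => gauss1 (tnth lam j))
  (fun j => integrable_gauss1 (l0 j)).
exact: iG.
Qed.

Lemma fourier_gaussian lam xi : Lambda lam ->
  fourier (gaussian lam) xi = (\prod_(j < d) gauss_hat (tnth lam j) (tnth xi j))%:C.
Proof.
move=> l0; rewrite [LHS](@fourier_tensor R d (fun j => gauss1 (tnth lam j)) xi
  (fun j => integrable_gauss1 (l0 j))).
rewrite rmorph_prod; apply: eq_bigr => j _.
by rewrite /cos_hat !gauss_cos// cos0 mulr1 cos_pihalf mulr0.
Qed.

(** Indexing the exponentials by functions [p] and [q] lets the product of [d] double sums expand
    into a single double sum over [(p, q)], term by term the expanded square. *)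
Lemma fejer_lower_bound a lam (b : 'I_d -> R) F N :
  Lambda a -> Lambda lam -> (forall j, tnth a j < b j) ->
  leb.-integrable setT (EFin \o F) -> (forall x, gaussian lam x <= F x) ->
  (forall xi, ~ Qbox a xi -> fourier F xi = 0) ->
  \prod_(j < d) fejer_sum (fun k => gauss_hat (tnth lam j) (b j * k%:~R)) N <=
  (N ^ d)%:R * \int[leb]_x F x.
Proof.
move=> a0 l0 ab iF GF F0.
pose xi (p q : {ffun 'I_d -> 'I_N}) : d.-tuple R :=
  [tuple b j * ((p j)%:Z - (q j)%:Z)%:~R | j < d].
pose S x := \sum_p \sum_q cos (2 * pi * dotp x (xi p q)).
have S0 x : 0 <= S x.
  have := sum_cosB_ge0 (fun p : {ffun 'I_d -> 'I_N} =>
    2 * pi * \sum_(j < d) tnth x j * (b j * (p j)%:R)).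
  congr (0 <= _); do 2 (apply: eq_bigr => ? _); congr cos.
  rewrite -mulrBr /dotp -sumrB; congr (_ * _); apply: eq_bigr => j _.
  by rewrite tnth_mktuple intrB !mulrBr.
pose T (H : d.-tuple R -> R) x := \sum_p \sum_q H x * cos (2 * pi * dotp x (xi p q)).
have TE H x : T H x = H x * S x.
  by rewrite /S mulr_sumr; apply: eq_bigr => p _; rewrite mulr_sumr.
have iT H : leb.-integrable setT (EFin \o H) -> leb.-integrable setT (EFin \o T H).
  move=> iH; do 2 (apply: integrable_sumR => // ?); exact: integrable_mul_cos_dotp.
have IT H : leb.-integrable setT (EFin \o H) ->
    \int[leb]_x T H x = \sum_p \sum_q complex.Re (fourier H (xi p q)).
  move=> iH; rewrite Rintegral_sum//; last first.
    by move=> ?; apply: integrable_sumR => // ?; exact: integrable_mul_cos_dotp.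
  apply: eq_bigr => p _; rewrite Rintegral_sum//; last first.
    by move=> ?; exact: integrable_mul_cos_dotp.
  by apply: eq_bigr => q _; rewrite Re_fourier.
have iG := integrable_gaussian l0.
have : \int[leb]_x T (gaussian lam) x <= \int[leb]_x T F x.
  apply: le_Rintegral => //; [exact: iT|exact: iT|move=> x _].
  by rewrite !TE ler_wpM2r.
rewrite !IT//.
have -> : \sum_p \sum_q complex.Re (fourier F (xi p q)) = (N ^ d)%:R * \int[leb]_x F x.
  have E p q : complex.Re (fourier F (xi p q)) = if p == q then \int[leb]_x F x else 0.
    case: eqP => [<-|pq].
      rewrite Re_fourier; apply: eq_Rintegral => x _.
      rewrite /dotp big1 ?mulr0 ?cos0 ?mulr1// => j _.
      by rewrite tnth_mktuple subrr mulr0 mulr0.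
    (* Otherwise some coordinate of [xi p q] is at least [b j > tnth a j]. *)
    rewrite F0//= => Q; apply: pq; apply/ffunP => j; apply/val_inj.
    have := Q j; rewrite tnth_mktuple -ler_norml normrM -intr_norm => h.
    have b0 := lt_trans (a0 j) (ab j); rewrite gtr0_norm// in h.
    have : (`|(p j)%:Z - (q j)%:Z| < 1)%R.
      rewrite -(ltr_int R) -(ltr_pM2l b0) mulr1; exact: le_lt_trans h (ab j).
    by move=> /=; lia.
  under eq_bigr do under eq_bigr do rewrite E.
  under eq_bigr => p _ do rewrite -big_mkcond (big_pred1 p) ?(fun q => eq_sym p q)//.
  by rewrite sumr_const card_ffun !card_ord mulr_natl.
apply: le_trans; rewrite le_eqVlt; apply/orP; left; apply/eqP.
rewrite /fejer_sum bigA_distr_bigA; apply: eq_bigr => p _.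
rewrite bigA_distr_bigA; apply: eq_bigr => q _.
by rewrite fourier_gaussian//=; apply: eq_bigr => j _; rewrite tnth_mktuple.
Qed.

Lemma continuous_gauss_hat l : continuous (gauss_hat l : R -> R).
Proof. by move=> x; apply: cvgMr; exact: continuous_gauss1. Qed.

Lemma theta_lower_bound a lam F : Lambda a -> Lambda lam ->
  leb.-integrable setT (EFin \o F) -> (forall x, gaussian lam x <= F x) ->
  (forall xi, ~ Qbox a xi -> fourier F xi = 0) ->
  \prod_(j < d) ((Num.sqrt (tnth lam j))^-1 * theta (tnth a j ^+ 2 / tnth lam j)) <=
  \int[leb]_x F x.
Proof.
move=> a0 l0 iF GF F0.
have main N : \prod_(j < d) fejer_sum (fun k => gauss_hat (tnth lam j) (tnth a j * k%:~R)) N <=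
    (N ^ d)%:R * \int[leb]_x F x.
  pose b (m : nat) j := tnth a j * (1 + harmonic m).
  have bl j : (b ^~ j) @ \oo --> tnth a j.
    have c : (fun m => 1 + harmonic m : R) @ \oo --> (1 + 0 : R).
      by apply: cvgD; [exact: cvg_cst|exact: cvg_harmonic].
    have : (b ^~ j) @ \oo --> tnth a j * (1 + 0) by apply: cvgMr.
    by rewrite addr0 mulr1.
  have c : (fun m => \prod_(j < d) fejer_sum (fun k => gauss_hat (tnth lam j) (b m j * k%:~R)) N)
      @ \oo --> \prod_(j < d) fejer_sum (fun k => gauss_hat (tnth lam j) (tnth a j * k%:~R)) N.
    apply: cvg_prodR => j; do 2 (apply: cvg_sumR => ?).
    apply: (@cvg_comp _ _ _ (fun m => b m j * _) (gauss_hat (tnth lam j))); last exact: continuous_gauss_hat.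
    by apply: cvgMl; exact: bl.
  apply: (ler_cvg_to c (cvg_cst _)); apply: nearW => m.
  apply: (fejer_lower_bound N a0 l0 _ iF GF F0) => j.
  by rewrite /b mulrDr mulr1 ltrDl mulr_gt0 ?a0 ?harmonic_gt0.
(* The weight [N^(-d)] is shared out as [N^(-1)] per coordinate, so that each coordinate carries its
   own Cesaro mean. *)
have c : (fun N => \prod_(j < d) (N.+1%:R^-1 *
      fejer_sum (fun k => gauss_hat (tnth lam j) (tnth a j * k%:~R)) N.+1)) @ \oo -->
    \prod_(j < d) ((Num.sqrt (tnth lam j))^-1 * theta (tnth a j ^+ 2 / tnth lam j)).
  apply: cvg_prodR => j.
  under eq_cvg => N do rewrite (eq_fejer_sum _ (fun k => gauss_hatM (tnth lam j) (tnth a j) k%:~R)) fejer_sumZ mulrCA.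
  apply: cvgMr; apply: fejer_mean_cvg; apply: cvg_theta.
  by rewrite divr_gt0 ?exprn_gt0 ?a0 ?l0.
apply: (ler_cvg_to c (cvg_cst _)); apply: nearW => N.
rewrite big_split/= prodr_const card_ord exprVn -natrX.
by rewrite mulrC ler_pdivrMr ?ltr0n ?expn_gt0// mulrC main.
Qed.

End LowerBound.

Section Majorant.
Variable R : realType.
Notation mu := (@lebesgue_measure R).
Implicit Types (e r al : R).

Let majorant1 e r (t : R) := cos_transform (phi e) (r * t).

Lemma cos_transform_phi_ge0 e t : 0 < e -> 0 <= cos_transform (phi e) t.
Proof. by move=> e0; apply: le_trans (gauss1_le_cos_transform_phi e0 t); exact: gauss1_ge0. Qed.

Lemma integrable_majorant1 e r : 0 < e -> 0 < r ->
  mu.-integrable setT (EFin \o majorant1 e r).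
Proof.
move=> e0 r0; exact: (integrable_cos_transform (measurable_phi e0) (normr_phi_le e0)
  (phi_lipschitz e0) r0 (fun x => cos_transform_phi_ge0 x e0)).
Qed.

Lemma Rintegral_majorant1 e r : 0 < e -> 0 < r ->
  \int[mu]_x majorant1 e r x = theta e / r.
Proof.
move=> e0 r0; rewrite /theta -phi0E.
exact: (Rintegral_cos_transform (measurable_phi e0) (normr_phi_le e0)
  (phi_lipschitz e0) r0 (fun x => cos_transform_phi_ge0 x e0)).
Qed.

Lemma majorant1_bandlimited e r (xi : R) al : 0 < e -> 0 < r -> r < `|xi| ->
  cos_hat (majorant1 e r) xi al = 0.
Proof.
move=> e0 r0; exact: (cos_transform_bandlimited (measurable_phi e0) (normr_phi_le e0)
  (phi_lipschitz e0) r0 (fun x => cos_transform_phi_ge0 x e0)).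
Qed.

Definition majorant d (lam a x : d.-tuple R) : R :=
  \prod_(j < d) cos_transform (phi (tnth lam j / tnth a j ^+ 2)) (tnth a j * tnth x j).

Variable d : nat.
Implicit Types (lam a x xi : d.-tuple R).

Let scale_gt0 lam a : Lambda lam -> Lambda a -> forall j, 0 < tnth lam j / tnth a j ^+ 2.
Proof. by move=> l0 a0 j; rewrite divr_gt0 ?exprn_gt0 ?l0 ?a0. Qed.

Lemma majorantE lam a x : Lambda lam -> Lambda a ->
  (majorant lam a x)%:C = M_scaled lam a (map_tuple (fun t => t%:C) x).
Proof.
move=> l0 a0; rewrite rmorph_prod; apply: eq_bigr => j _.
by rewrite !tnth_mktuple tnth_map -rmorphM m_delta_real//; exact: scale_gt0.
Qed.

Lemma gaussian_le_majorant lam a x : Lambda lam -> Lambda a ->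
  gaussian lam x <= majorant lam a x.
Proof.
move=> l0 a0; apply: ler_prod => j _; rewrite expR_ge0/=.
apply: le_trans (gauss1_le_cos_transform_phi (scale_gt0 l0 a0 j) _).
rewrite /gauss1 ler_expR le_eqVlt; apply/orP; left; apply/eqP.
have := a0 j; move: pi (tnth a j) => p r r0; field.
by rewrite gt_eqF.
Qed.

Lemma integrable_majorant lam a : Lambda lam -> Lambda a ->
  (lebesgue R d).-integrable setT (EFin \o majorant lam a) /\
  \int[lebesgue R d]_x majorant lam a x =
  \prod_(j < d) (theta (tnth lam j / tnth a j ^+ 2) / tnth a j).
Proof.
move=> l0 a0; have sc := scale_gt0 l0 a0.
have [iM eM] := @Rintegral_tensor R d
  (fun j => majorant1 (tnth lam j / tnth a j ^+ 2) (tnth a j))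
  (fun j => integrable_majorant1 (sc j) (a0 j)).
split; first exact: iM.
by rewrite [LHS]eM; apply: eq_bigr => j _; rewrite Rintegral_majorant1 ?sc ?a0.
Qed.

(** One coordinate outside its interval suffices: the transform is a product, and both the real and
    the imaginary part of that factor vanish. *)
Lemma fourier_majorant lam a xi : Lambda lam -> Lambda a -> ~ Qbox a xi ->
  fourier (majorant lam a) xi = 0.
Proof.
move=> l0 a0 /existsNP[j /negP]; rewrite -ler_norml -ltNge => axi.
have sc := scale_gt0 l0 a0.
rewrite [LHS](@fourier_tensor R d
  (fun j => majorant1 (tnth lam j / tnth a j ^+ 2) (tnth a j)) xi
  (fun j => integrable_majorant1 (sc j) (a0 j))).
by rewrite (bigD1 j)//= !majorant1_bandlimited ?sc ?a0// mul0r.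
Qed.

End Majorant.

(** * Jacobi's inversion formula *)

Section Jacobi.
Variable R : realType.
Implicit Types (e l r : R).

Let theta_le e : 0 < e -> (Num.sqrt e)^-1 * theta e^-1 <= theta e.
Proof.
move=> e0; pose a := [tuple (1 : R) | _ < 1]; pose l := [tuple e | _ < 1].
have a0 : Lambda a by move=> j; rewrite tnth_mktuple.
have l0 : Lambda l by move=> j; rewrite tnth_mktuple.
have [iM eM] := integrable_majorant l0 a0.
have := theta_lower_bound a0 l0 iM (fun x => gaussian_le_majorant x l0 a0)
  (fun xi => @fourier_majorant R 1 l a xi l0 a0).
by rewrite eM !big_ord1 !tnth_mktuple expr1n divr1 divr1 div1r.
Qed.

Lemma theta_jacobi e : 0 < e -> theta e = (Num.sqrt e)^-1 * theta e^-1.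
Proof.
move=> e0; apply/eqP; rewrite eq_le theta_le// andbT.
have ei : 0 < e^-1 by rewrite invr_gt0.
have := theta_le ei; rewrite invrK sqrtrV ?(ltW e0)// invrK.
by rewrite ler_pdivlMl// sqrtr_gt0.
Qed.

(** The left side is the integral of one factor of the extremal function, the right side the
    matching factor of the lower bound; inversion at [l / r^2] links them. *)
Lemma theta_scale l r : 0 < l -> 0 < r ->
  theta (l / r ^+ 2) / r = (Num.sqrt l)^-1 * theta (r ^+ 2 / l) :> R.
Proof.
move=> l0 r0; rewrite theta_jacobi ?divr_gt0 ?exprn_gt0// invf_div.
rewrite sqrtrM ?(ltW l0)// sqrtrV ?exprn_ge0 ?(ltW r0)// sqrtr_sqr gtr0_norm//.
have sl : Num.sqrt l != 0 by rewrite gt_eqF ?sqrtr_gt0.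
field; by rewrite sl gt_eqF.
Qed.

End Jacobi.

Theorem theorem1 (R : realType) (d : nat) (a lambda : d.-tuple R)
    (d_ge1 : (1 <= d)%N) (a_Lambda : Lambda a) (lambda_Lambda : Lambda lambda) :
  (forall F : d.-tuple R -> R,
     (lebesgue R d).-integrable setT (EFin \o F) ->
     (forall x, gaussian lambda x <= F x) ->
     (forall xi, ~ Qbox a xi -> fourier F xi = 0) ->
     \prod_(j < d) ((tnth lambda j `^ (- 2^-1))%:C *
                    Theta 0 ('i%C * (tnth a j ^+ 2 / tnth lambda j)%:C))
     <= (\int[lebesgue R d]_x F x)%:C) /\
  (exists F : d.-tuple R -> R,
     [/\ forall x, (F x)%:C = M_scaled lambda a (map_tuple (fun t => t%:C) x),
         (lebesgue R d).-integrable setT (EFin \o F),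
         forall x, gaussian lambda x <= F x,
         forall xi, ~ Qbox a xi -> fourier F xi = 0
       & (\int[lebesgue R d]_x F x)%:C =
         \prod_(j < d) ((tnth lambda j `^ (- 2^-1))%:C *
                        Theta 0 ('i%C * (tnth a j ^+ 2 / tnth lambda j)%:C))]).
Proof.
have -> : \prod_(j < d) ((tnth lambda j `^ (- 2^-1))%:C *
      Theta 0 ('i%C * (tnth a j ^+ 2 / tnth lambda j)%:C)) =
    (\prod_(j < d) ((Num.sqrt (tnth lambda j))^-1 *
      theta (tnth a j ^+ 2 / tnth lambda j)))%:C.
  rewrite rmorph_prod; apply: eq_bigr => j _.
  have l0 := lambda_Lambda j.
  have r0 : 0 < tnth a j ^+ 2 / tnth lambda j by rewrite divr_gt0 ?exprn_gt0 ?a_Lambda.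
  by rewrite (Theta0_imag r0) powRN powR12_sqrt ?(ltW l0)// rmorphM.
split=> [F iF GF F0|]; first by rewrite lecR; exact: theta_lower_bound iF GF F0.
have [iM eM] := integrable_majorant lambda_Lambda a_Lambda.
exists (majorant lambda a); split => //.
- by move=> x; exact: majorantE.
- by move=> x; exact: gaussian_le_majorant.
- by move=> xi; exact: fourier_majorant.
rewrite eM; congr (_%:C); apply: eq_bigr => j _.
by rewrite theta_scale ?a_Lambda ?lambda_Lambda.
Qed.
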